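(* Let $n\ge1$ be an odd integer and let $\mathbb{F}$ be a field of characteristic zero containing a primitive $n$-th root of unity. Let $k\ge1$ be an integer and let $\mathbb{F}(C_2\times C_{2n})=Z(D_{C_2\times C_{2n},k})$ be the center of the generic $(C_2\times C_{2n})$-crossed product over $\mathbb{F}$, where $C_j$ denotes the cyclic group of order $j$. Then the extension $\mathbb{F}(C_2\times C_{2n})/\mathbb{F}$ is stably rational.
   Context: Generic crossed product. Let $G$ be a finite group, $\mathbb{F}$ a field of characteristic zero, $k\ge1$. Take indeterminates $x_{h,g}^{(i)}$ ($h,g\in G$, $1\le i\le k$) algebraically independent over $\mathbb{F}$, and index rows and columns of matrices in $M_{|G|}(\mathbb{F}(x_{h,g}^{(i)}))$ by $G$, with matrix units $E_{g,h}$. For $g\in G$, $1\le i\le k$ put $X_{g,i}=\sum_{h\in G}x^{(i)}_{h,hg}E_{h,hg}$. Let $R_{G,k}$ be the unital $\mathbb{F}$-subalgebra generated by all $X_{g,i}$ ($g\in G$, $1\le i\le k$). The generic $G$-crossed product $D_{G,k}$ is obtained from $R_{G,k}$ by inverting all its nonzero central elements; its center is denoted $\mathbb{F}(G)=Z(D_{G,k})$ and is a field extension of $\mathbb{F}$. A finitely generated field extension $\mathbb{L}/\mathbb{F}$ is rational if it is purely transcendental, i.e. $\mathbb{L}=\mathbb{F}(x_1,\dots,x_n)$ with the $x_i$ algebraically independent over $\mathbb{F}$; it is stably rational if $\mathbb{L}(y_1,\dots,y_r)$ is rational over $\mathbb{F}$ for some $y_1,\dots,y_r$ algebraically independent over $\mathbb{L}$.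 *)

(* Defs.v *)
From HB Require Import structures.
From mathcomp Require Import all_boot all_order all_algebra all_fingroup.
From mathcomp Require Import boolp mpoly.
Set Implicit Arguments.
Unset Strict Implicit.
Unset Printing Implicit Defensive.
Import GRing.Theory.
Local Open Scope ring_scope.

(* A field extension L / F is given by a morphism iota : F -> L. *)
Section Rationality.

Definition algebraically_independent (F L : fieldType)
    (iota : {rmorphism F -> L}) (n : nat) (x : 'I_n -> L) : Prop :=
  forall p : {mpoly F[n]}, mmap iota x p = 0 -> p = 0.

Definition field_generated_by (F L : fieldType)
    (iota : {rmorphism F -> L}) (n : nat) (x : 'I_n -> L) : Prop :=
  forall z : L, exists p q : {mpoly F[n]},
    mmap iota x q != 0 /\ z = mmap iota x p / mmap iota x q.

Definition rational_extension (F L : fieldType)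
    (iota : {rmorphism F -> L}) : Prop :=
  exists (n : nat) (x : 'I_n -> L),
    algebraically_independent iota x /\ field_generated_by iota x.

Definition ratfun_embedding (F L : fieldType) (iota : {rmorphism F -> L})
    (r : nat) : {rmorphism F -> {fraction {mpoly L[r]}}} :=
  (@tofrac {mpoly L[r]} \o (@mpolyC r L \o iota)).

Definition stably_rational (F L : fieldType)
    (iota : {rmorphism F -> L}) : Prop :=
  exists r : nat, rational_extension (ratfun_embedding iota r).

End Rationality.

Definition central_in (K : fieldType) (n : nat) (S : 'M[K]_n -> Prop)
    (A : 'M[K]_n) : Prop :=
  S A /\ forall B : 'M[K]_n, S B -> A *m B = B *m A.

(* invmx C = C when C is singular, so this is the localization of S at its
   nonzero central elements only when these are invertible matrices. *)
Definition central_localization (K : fieldType) (n : nat)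
    (S : 'M[K]_n -> Prop) (A : 'M[K]_n) : Prop :=
  exists C B : 'M[K]_n,
    [/\ central_in S C, C != 0, S B & A = invmx C *m B].

Section CentralLocalization.

Variables (K : fieldType) (n : nat) (S : 'M[K]_n -> Prop).
Hypothesis S1 : S 1%:M.
Hypothesis SB : forall A B, S A -> S B -> S (A - B).
Hypothesis SM : forall A B, S A -> S B -> S (A *m B).
Hypothesis S_scalar : forall A, central_in S A -> exists c, A = c%:M.
Hypothesis n_gt0 : (0 < n)%N.

Let D := central_localization S.
Let i0 := Ordinal n_gt0.

Lemma scalar_mx_neq0 (c : K) : (c%:M != 0 :> 'M_n) = (c != 0).
Proof.
apply/idP/idP; first by apply: contraNneq => ->; rewrite raddf0.
by apply: contraNneq => /matrixP/(_ i0 i0); rewrite !mxE eqxx mulr1n => ->.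
Qed.

Lemma central_localizationP A : D A <->
  exists c B, [/\ c != 0, S c%:M, S B & A = c^-1 *: B].
Proof.
split=> [[C [B [ZC C0 RB ->]]]|[c [B [c0 Rc RB ->]]]].
  have [c cE] := S_scalar ZC; exists c, B.
  split=> //; first by rewrite -scalar_mx_neq0 -cE.
    by rewrite -cE; case: ZC.
  by rewrite cE invmx_scalar mul_scalar_mx.
exists c%:M, B; split=> //.
- by split=> // B' _; rewrite scalar_mxC.
- by rewrite scalar_mx_neq0.
- by rewrite invmx_scalar mul_scalar_mx.
Qed.

Lemma sub_central_localization A : S A -> D A.
Proof.
move=> SA; apply/central_localizationP; exists 1, A.
by split; rewrite ?oner_eq0 ?invr1 ?scale1r.
Qed.

Lemma central_localizationB A B : D A -> D B -> D (A - B).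
Proof.
move=> /central_localizationP [c [A' [c0 Sc SA ->]]].
move=> /central_localizationP [d [B' [d0 Sd SB' ->]]].
apply/central_localizationP; exists (c * d), (d%:M *m A' - c%:M *m B'); split.
- by rewrite mulf_neq0.
- by rewrite scalar_mxM; apply: SM.
- by apply: SB; apply: SM.
rewrite !mul_scalar_mx scalerBr !scalerA invfM; congr (_ *: _ - _ *: _).
  by rewrite mulfVK.
by rewrite mulrAC mulVf // mul1r.
Qed.

Lemma central_localizationM A B : D A -> D B -> D (A *m B).
Proof.
move=> /central_localizationP [c [A' [c0 Sc SA ->]]].
move=> /central_localizationP [d [B' [d0 Sd SB' ->]]].
apply/central_localizationP; exists (c * d), (A' *m B'); split.
- by rewrite mulf_neq0.
- by rewrite scalar_mxM; apply: SM.
- exact: SM.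
by rewrite -scalemxAl -scalemxAr scalerA invfM.
Qed.

Lemma center_scalar A : central_in D A ->
  exists b c, [/\ c != 0, S c%:M, S b%:M & A = (b / c)%:M].
Proof.
move=> [/central_localizationP [c [B [c0 Sc SB' AE]]] AC].
have BE : B = c *: A by rewrite AE scalerA mulfV // scale1r.
have [b bE] : exists b, B = b%:M.
  apply: S_scalar; split=> // B' RB'.
  by rewrite BE -scalemxAl -scalemxAr AC //; apply: sub_central_localization.
exists b, c; split; rewrite -?bE // AE bE -mul_scalar_mx -scalar_mxM.
by rewrite mulrC.
Qed.

Lemma center_unitmx A : central_in D A -> A != 0 -> A \in unitmx.
Proof.
move=> /center_scalar [b [c [_ _ _ ->]]].
by rewrite scalar_mx_neq0 unitmxE det_scalar unitfE => /expf_neq0 ->.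
Qed.

Lemma center1 : central_in D 1%:M.
Proof.
by split=> [|B _]; [apply: sub_central_localization | rewrite scalar_mxC].
Qed.

Lemma centerB A B : central_in D A -> central_in D B -> central_in D (A - B).
Proof.
move=> [DA AC] [DB BC]; split; first exact: central_localizationB.
by move=> C DC; rewrite mulmxBl mulmxBr AC ?BC.
Qed.

Lemma centerM A B : central_in D A -> central_in D B -> central_in D (A *m B).
Proof.
move=> [DA AC] [DB BC]; split; first exact: central_localizationM.
by move=> C DC; rewrite -mulmxA (BC C DC) mulmxA (AC C DC) mulmxA.
Qed.

Lemma center_inv A : central_in D A -> central_in D (invmx A).
Proof.
move=> /center_scalar [b [c [c0 Sc Sb ->]]].
rewrite invmx_scalar invf_div; split; last by move=> B _; rewrite scalar_mxC.
have [->|b0] := eqVneq b 0.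
  rewrite invr0 mulr0; apply: sub_central_localization.
  by rewrite -(subrr c) raddfB; apply: SB.
apply/central_localizationP; exists b, c%:M; split=> //.
by rewrite -mul_scalar_mx -scalar_mxM mulrC.
Qed.

End CentralLocalization.

Section GenericCrossedProduct.

Variables (F : fieldType) (gT : finGroupType) (k : nat).

(* F(x_{h,g}^{(i)}); the variable x_{h,g}^{(i)} is numbered by the rank of
   (i, (h, g)), and row (or column) g of a matrix by the rank of g. *)
Definition gcp_field : fieldType :=
  {fraction {mpoly F[#|{: 'I_k * (gT * gT)}|]}}.

Definition gcp_const (c : F) : gcp_field := tofrac (mpolyC _ c).

Definition gcp_var (i : 'I_k) (h g : gT) : gcp_field :=
  tofrac (mpolyX _ (mnm1 (enum_rank (i, (h, g))))).

Notation matG := 'M[gcp_field]_#|gT|.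

Definition gcp_X (g : gT) (i : 'I_k) : matG :=
  \sum_(h : gT) gcp_var i h (h * g)%g *:
     delta_mx (enum_rank h) (enum_rank (h * g)%g).

(* The unital F-subalgebra R_{G,k}; opposites come from the constant -1. *)
Inductive gcp_R : matG -> Prop :=
  | gcp_R_const (c : F) : gcp_R (gcp_const c)%:M
  | gcp_R_X (g : gT) (i : 'I_k) : gcp_R (gcp_X g i)
  | gcp_R_add (A B : matG) : gcp_R A -> gcp_R B -> gcp_R (A + B)
  | gcp_R_mul (A B : matG) : gcp_R A -> gcp_R B -> gcp_R (A *m B).

(* D_{G,k}, inside M_{|G|}(F(x)): a nonzero C in Z(R_{G,k}) is an invertible
   scalar matrix (gcp_R_central_scalar, gcp_R_central_unitmx below), so the
   localization of R_{G,k} at Z(R_{G,k}) \ {0} embeds in the matrix ring. *)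
Definition gcp_D : matG -> Prop := central_localization gcp_R.

Definition gcp_ZD : pred matG := fun A => `[< central_in gcp_D A >].

Lemma gcp_var_neq0 i h g : gcp_var i h g != 0.
Proof.
rewrite /gcp_var tofrac_eq0; apply/eqP.
move=> /(congr1 (fun p => p@_(mnm1 (enum_rank (i, (h, g)))))) /eqP.
by rewrite mcoeffX eqxx mcoeff0 oner_eq0.
Qed.

Lemma gcp_var_inj i h g h' g' :
  gcp_var i h g = gcp_var i h' g' -> (h, g) = (h', g').
Proof.
move=> /eqP; rewrite /gcp_var -subr_eq0 -rmorphB tofrac_eq0 subr_eq0 => /eqP.
move/(congr1 (fun p => p@_(mnm1 (enum_rank (i, (h, g)))))).
rewrite !mcoeffX eqxx eq_sym; case: eqP => [|_ /eqP]; last by rewrite oner_eq0.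
move=> /(congr1 (fun m : 'X_{1.._} => m (enum_rank (i, (h, g))))).
rewrite !mnm1E eqxx; case: eqP => // /enum_rank_inj [-> ->] //.
Qed.

Lemma gcp_XE g i a b :
  gcp_X g i (enum_rank a) (enum_rank b) =
  if b == (a * g)%g then gcp_var i a b else 0.
Proof.
rewrite /gcp_X summxE (bigD1 a) //= big1 ?addr0; last first.
  move=> h ha; rewrite !mxE (inj_eq enum_rank_inj) eq_sym (negbTE ha) /=.
  by rewrite mulr0.
rewrite !mxE eqxx (inj_eq enum_rank_inj) /=.
by case: eqP => [->|_]; rewrite ?mulr1 ?mulr0.
Qed.

Lemma gcp_mulXE g i (A : matG) a b :
  (gcp_X g i *m A) (enum_rank a) b =
  gcp_var i a (a * g)%g * A (enum_rank (a * g)%g) b.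
Proof.
rewrite mxE (bigD1 (enum_rank (a * g)%g)) //= gcp_XE eqxx big1 ?addr0 //.
move=> j; rewrite -[j]enum_valK (inj_eq enum_rank_inj) gcp_XE => /negbTE ->.
by rewrite mul0r.
Qed.

Lemma gcp_mulEX g i (A : matG) a b :
  (A *m gcp_X g i) a (enum_rank (b * g)%g) =
  A a (enum_rank b) * gcp_var i b (b * g)%g.
Proof.
rewrite mxE (bigD1 (enum_rank b)) //= gcp_XE eqxx big1 ?addr0 //.
move=> j; rewrite -[j]enum_valK (inj_eq enum_rank_inj) gcp_XE => jb.
by rewrite (inj_eq (mulIg g)) eq_sym (negbTE jb) mulr0.
Qed.

Lemma gcp_R_central_scalar A : central_in gcp_R A -> exists c, A = c%:M.
Proof.
have [k0|] := posnP k.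
  case=> + _; elim=> [c|g i|B C _ [b ->] _ [c ->]|B C _ [b ->] _ [c ->]].
  - by exists (gcp_const c).
  - by exfalso; case: i => i; rewrite k0.
  - by exists (b + c); rewrite raddfD.
  - by exists (b * c); rewrite -scalar_mxM.
move=> k_gt0 [_ AC]; pose i := Ordinal k_gt0.
exists (A (enum_rank 1%g) (enum_rank 1%g)); apply/matrixP=> a b.
rewrite -[a]enum_valK -[b]enum_valK; move: (enum_val a) (enum_val b) => {}a {}b.
rewrite [RHS]mxE (inj_eq enum_rank_inj); case: eqP => [<-{b}|/eqP ab].
  have /matrixP/(_ (enum_rank 1%g) (enum_rank (1 * a)%g)) :=
    AC _ (gcp_R_X a i).
  rewrite gcp_mulEX gcp_mulXE mulrC mul1g => /(mulfI (gcp_var_neq0 _ _ _)).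
  by move=> <-; rewrite mulr1n.
rewrite mulr0n.
have /matrixP/(_ (enum_rank a) (enum_rank (b * 1)%g)) := AC _ (gcp_R_X 1%g i).
rewrite gcp_mulEX gcp_mulXE !mulg1 mulrC => /eqP.
rewrite -subr_eq0 -mulrBl mulf_eq0 => /orP[|/eqP //].
rewrite subr_eq0 => /eqP/gcp_var_inj [ba _].
by rewrite ba eqxx in ab.
Qed.

Lemma gcp_R_central_unitmx A :
  central_in gcp_R A -> A != 0 -> A \in unitmx.
Proof.
move=> /gcp_R_central_scalar [c ->] c0.
have [cz|cz] := eqVneq c 0; first by rewrite cz raddf0 eqxx in c0.
by rewrite unitmxE det_scalar unitfE expf_neq0.
Qed.

Lemma gcp_R1 : gcp_R 1%:M.
Proof. by have := gcp_R_const 1; rewrite /gcp_const !rmorph1. Qed.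

Lemma gcp_RB A B : gcp_R A -> gcp_R B -> gcp_R (A - B).
Proof.
move=> RA RB; apply: gcp_R_add => //.
have N1 : gcp_const (-1) = -1 by rewrite /gcp_const !rmorphN1.
by have := gcp_R_mul (gcp_R_const (-1)) RB; rewrite N1 mul_scalar_mx scaleN1r.
Qed.

Lemma gcp_dim_gt0 : (0 < #|gT|)%N.
Proof. by apply/card_gt0P; exists 1%g. Qed.

Lemma gcp_ZD_const c : gcp_ZD (gcp_const c)%:M.
Proof.
apply/asboolP; split; last by move=> B _; rewrite scalar_mxC.
exact: (sub_central_localization gcp_R1 gcp_R_central_scalar gcp_dim_gt0
  (gcp_R_const c)).
Qed.

Lemma gcp_ZD_subring : subring_closed gcp_ZD.
Proof.
split=> [|A B /asboolP ZA /asboolP ZB|A B /asboolP ZA /asboolP ZB];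
  apply/asboolP.
- exact: (center1 gcp_R1 gcp_R_central_scalar gcp_dim_gt0).
- exact: (centerB gcp_RB gcp_R_mul gcp_R_central_scalar gcp_dim_gt0 ZA ZB).
- exact: (centerM gcp_R_mul gcp_R_central_scalar gcp_dim_gt0 ZA ZB).
Qed.

Lemma gcp_ZD_inv A : gcp_ZD A -> gcp_ZD (invmx A).
Proof.
move=> /asboolP ZA; apply/asboolP.
exact: (center_inv gcp_R1 gcp_RB gcp_R_central_scalar gcp_dim_gt0 ZA).
Qed.

Lemma gcp_ZD_unitmx A : gcp_ZD A -> A != 0 -> A \in unitmx.
Proof.
move=> /asboolP ZA; exact: (center_unitmx gcp_R1 gcp_R_central_scalar
  gcp_dim_gt0 ZA).
Qed.

(* F(G) = Z(D_{G,k}), with the operations inherited from the matrix ring. *)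
Record gcp_center : Type := GcpCenter {
  gcp_center_val :> matG;
  gcp_center_valP : gcp_ZD gcp_center_val }.

HB.instance Definition _ := [isSub for gcp_center_val].
HB.instance Definition _ := [Choice of gcp_center by <:].
HB.instance Definition _ := GRing.SubChoice_isSubPzRing.Build
  matG gcp_ZD gcp_center gcp_ZD_subring.

Lemma gcp_center_mulC : commutative (@GRing.mul gcp_center).
Proof.
move=> A B; apply: val_inj; rewrite !rmorphM /=.
have [_] := asboolP _ (gcp_center_valP A); apply.
by have [] := asboolP _ (gcp_center_valP B).
Qed.

HB.instance Definition _ :=
  GRing.PzRing_hasCommutativeMul.Build gcp_center gcp_center_mulC.

Lemma gcp_center_oner_neq0 : (1 : gcp_center) != 0.
Proof.
rewrite -(inj_eq val_inj) rmorph1 rmorph0.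
by rewrite (scalar_mx_neq0 gcp_dim_gt0) oner_eq0.
Qed.

HB.instance Definition _ :=
  GRing.PzSemiRing_isNonZero.Build gcp_center gcp_center_oner_neq0.

Definition gcp_center_inv (A : gcp_center) : gcp_center :=
  GcpCenter (gcp_ZD_inv (gcp_center_valP A)).

Lemma gcp_center_mulVf A : A != 0 -> gcp_center_inv A * A = 1.
Proof.
move=> A0; apply: val_inj; rewrite rmorphM rmorph1 /=; apply: mulVmx.
apply: (gcp_ZD_unitmx (gcp_center_valP A)).
by apply: contra_neq A0 => A0; apply: val_inj; rewrite rmorph0.
Qed.

Lemma gcp_center_inv0 : gcp_center_inv 0 = 0.
Proof.
apply: val_inj; change (invmx (val (0 : gcp_center)) = val (0 : gcp_center)).
have -> : val (0 : gcp_center) = 0%:M by rewrite rmorph0 raddf0.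
by rewrite invmx_scalar invr0.
Qed.

HB.instance Definition _ := GRing.ComNzRing_isField.Build gcp_center
  gcp_center_mulVf gcp_center_inv0.

Definition gcp_center_const (c : F) : gcp_center := GcpCenter (gcp_ZD_const c).

Lemma gcp_center_const_is_zmod_morphism : zmod_morphism gcp_center_const.
Proof.
by move=> a b; apply: val_inj; rewrite rmorphB /= /gcp_const !raddfB.
Qed.

Lemma gcp_center_const_is_monoid_morphism : monoid_morphism gcp_center_const.
Proof.
split; first by apply: val_inj; rewrite rmorph1 /= /gcp_const !rmorph1.
by move=> a b; apply: val_inj; rewrite rmorphM /= /gcp_const !rmorphM.
Qed.

HB.instance Definition _ := GRing.isZmodMorphism.Build F gcp_center
  gcp_center_const gcp_center_const_is_zmod_morphism.
HB.instance Definition _ := GRing.isMonoidMorphism.Build F gcp_center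
  gcp_center_const gcp_center_const_is_monoid_morphism.

End GenericCrossedProduct.

(* Main.v *)
Require Import Defs.
From HB Require Import structures.
From mathcomp Require Import all_boot all_order all_algebra all_fingroup.
From mathcomp Require Import boolp mpoly.
From mathcomp Require Import generic_quotient.
From mathcomp Require Import ring zify.

(* Let G = <a> x <b> with a^2 = b^(2n) = 1, let beta = b^n, and let G act on
   E = F(x_{h,g}^(i), s, r, t, f_m, e_l) by x_{h,g} -> x_{uh,ug}, fixing the f_m
   and e_l, with a s = -s, b r = -r, b t = w t and the other values trivial.
   The scalars of D_{G,k} form a subfield L of the fixed field E^G, and it
   suffices to find, inside E^G, families y independent over L and z
   independent over F with L(y) = F(z).  Here y consists of the f_m, the e_l and
   s, r, t divided by semi-invariants coming from D_{G,k}.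

   Averaging against the characters s^i r^j t^l attaches to a subfield S of E^G
   the G-stable field of the elements with coordinates in S, and its invariants
   are again S.  So z may be chosen by describing a G-stable field.  It has to
   contain x_{h,g} p_h / p_g, where p_g is the product of the edges along a
   path from 1 to g; these ratios are products of conjugates of
   U = al_1 be_a / (be_1 al_b), A = al_1 al_a, B = prod_j b^j be_1, where
   al_h = x_{h,ha} and be_h = x_{h,hb}, and of loops at 1.

   Put kappa = sum f_m s^m_1 r^m_2, tau = sum e_l t^l and 4q = n^2 - 1.  The
   twisted elements X = U kappa N(U)^q tau and sigma (a sum over t^l alone)
   carry free coordinates, and U, kappa, tau are recovered multiplicatively from
   X, sigma and W, since the exponents form unimodular matrices (this is where
   n odd enters).
   W lies in the fixed field of b^2, on which G acts as a Klein four group, and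
   a suitable p, a twist of the conjugate of B^-n by a, satisfies beta p = p
   and N_beta(W) = p / a p.  For Q = p / W = x + y s + z r + w rs and
   p = p_0 + p_1 s this reads xy = r^2 zw and
   s^2 (y^2 - r^2 w^2 + p_1^2) = p_0^2 - x^2 + r^2 z^2, so that r^2 and s^2 are
   rational in the free parameters x, y, z, w, p_0, p_1.

   Independence follows by counting: all variables of E are algebraic over z
   and the p_g with g <> 1, which are together as many as the variables. *)
Set Implicit Arguments.
Unset Strict Implicit.
Unset Printing Implicit Defensive.
Import GRing.Theory.
Local Open Scope ring_scope.

(** * Subfields, algebraicity and exchange *)

Section FractionLift.

Variables (R : idomainType) (Q : fieldType) (f : {rmorphism R -> Q}).
Hypothesis f_inj : injective f.

Lemma fracE (u : {fraction R}) : u = tofrac \n_(repr u) / tofrac \d_(repr u).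
Proof.
have d0 : tofrac \d_(repr u) != 0 by rewrite tofrac_eq0 denom_ratioP.
apply: (mulIf d0); rewrite divfK // => {d0}.
elim/quotW: u => x; rewrite !piE; apply/eqmodP.
rewrite /= FracField.equivfE /FracField.mulf !numden_Ratio ?mulf_neq0 ?oner_eq0 //.
all: by rewrite ?mulr1 ?FracField.equivf_r ?denom_ratioP.
Qed.

(** The injectivity proof is an argument so that the morphism instances declared below can attach to
    [frac_lift]; it guarantees that the chosen denominator has nonzero image. *)
Definition frac_lift of injective f := fun u : {fraction R} =>
  f \n_(repr u) / f \d_(repr u).

Local Notation flift := (frac_lift f_inj).

Lemma inj_rmorph_eq0 x : (f x == 0) = (x == 0).
Proof. by rewrite -(inj_eq f_inj) rmorph0. Qed.

(** Independence of the representative: two fractions for one element cross-multiply to the same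
    element of [R], and so do their images. *)
Lemma frac_lift_div n d : d != 0 -> flift (tofrac n / tofrac d) = f n / f d.
Proof.
move=> d0; rewrite /frac_lift; set u := (X in repr X).
have du0 : \d_(repr u) != 0 by apply: denom_ratioP.
apply/eqP; rewrite eqr_div ?inj_rmorph_eq0 // -!rmorphM /= (inj_eq f_inj).
have /eqP := fracE u.
rewrite {1}/u eqr_div ?tofrac_eq0 // -!rmorphM /= tofrac_eq => /eqP <-.
by rewrite mulrC.
Qed.

Lemma frac_lift_tofrac x : flift (tofrac x) = f x.
Proof.
by rewrite -[tofrac x]divr1 -[1]tofrac1 frac_lift_div ?oner_eq0 // rmorph1 divr1.
Qed.

Lemma frac_lift_zmod_morphism : zmod_morphism flift.
Proof.
move=> u v; rewrite [u]fracE [v]fracE; set a := \n__; set b := \d__.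
set c := \n__; set d := \d__.
have b0 : b != 0 := denom_ratioP _; have d0 : d != 0 := denom_ratioP _.
have -> : tofrac a / tofrac b - tofrac c / tofrac d =
    tofrac (a * d - c * b) / tofrac (b * d).
  rewrite -[- (_ / _)]mulNr addf_div ?tofrac_eq0 // mulNr.
  by rewrite -!rmorphM -rmorphB.
rewrite !frac_lift_div ?mulf_neq0 // rmorphB !rmorphM.
by rewrite -[- (f c / _)]mulNr addf_div ?inj_rmorph_eq0 // mulNr.
Qed.

Lemma frac_lift_monoid_morphism : monoid_morphism flift.
Proof.
split; first by rewrite -[1]tofrac1 frac_lift_tofrac rmorph1.
move=> u v; rewrite [u]fracE [v]fracE; set a := \n__; set b := \d__.
set c := \n__; set d := \d__.
have b0 : b != 0 := denom_ratioP _; have d0 : d != 0 := denom_ratioP _.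
rewrite mulf_div -!rmorphM !frac_lift_div ?mulf_neq0 // mulf_div.
by rewrite !rmorphM.
Qed.

HB.instance Definition _ := GRing.isZmodMorphism.Build _ _ flift
  frac_lift_zmod_morphism.
HB.instance Definition _ := GRing.isMonoidMorphism.Build _ _ flift
  frac_lift_monoid_morphism.

End FractionLift.

(** * Subfields of [E] and adjunction of finitely many elements *)

Section Subfields.

Variable E : fieldType.
Implicit Types (S T : divringClosed E) (x y z : seq E).

(** The closure operations are those of [divring_closed]; division carries no side condition since
    [a / 0 = 0]. *)
Inductive generated (X : E -> Prop) : E -> Prop :=
  | generated_in a : X a -> generated X a
  | generated1 : generated X 1
  | generatedB a b : generated X a -> generated X b -> generated X (a - b)
  | generated_div a b : generated X a -> generated X b -> generated X (a / b).

Definition adjoin_pred S x : pred E :=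
  fun a => `[< generated (fun b => (b \in S) || (b \in x)) a >].

Lemma adjoin_closed S x : divring_closed (adjoin_pred S x).
Proof.
split=> [|a b /asboolP Ga /asboolP Gb|a b /asboolP Ga /asboolP Gb];
  apply/asboolP; first exact: generated1.
- exact: generatedB.
- exact: generated_div.
Qed.

HB.instance Definition _ S x :=
  GRing.isDivringClosed.Build E (adjoin_pred S x) (adjoin_closed S x).

Definition adjoin S x : divringClosed E :=
  GRing.DivringClosed.clone E (adjoin_pred S x) _.

Lemma adjoin_base S x : {subset S <= adjoin S x}.
Proof. by move=> a Sa; apply/asboolP/generated_in; rewrite Sa. Qed.

Lemma adjoin_mem S x : {subset x <= adjoin S x}.
Proof. by move=> a xa; apply/asboolP/generated_in; rewrite xa orbT. Qed.

Lemma adjoin_min S x T :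
  {subset S <= T} -> {subset x <= T} -> {subset adjoin S x <= T}.
Proof.
move=> ST xT a /asboolP; elim=> [b /orP[/ST|/xT] //||b c _ Tb _ Tc|b c _ Tb _ Tc].
- exact: rpred1.
- exact: rpredB.
- exact: rpred_div.
Qed.

Lemma adjoin_sub S T x y :
  {subset S <= T} -> {subset x <= y} -> {subset adjoin S x <= adjoin T y}.
Proof.
move=> ST xy; apply: adjoin_min => a; first by move/ST; apply: adjoin_base.
by move/xy; apply: adjoin_mem.
Qed.

End Subfields.

(** * Subfields as field types, to which the theory of [algebraicOver] applies *)

Section SubfieldType.

Variables (E : fieldType) (S : divringClosed E).

Record subfield_of := SubfieldOf { sfval :> E; _ : sfval \in S }.

HB.instance Definition _ := [isSub for sfval].
HB.instance Definition _ := [Choice of subfield_of by <:].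
HB.instance Definition _ := [SubChoice_isSubIntegralDomain of subfield_of by <:].
HB.instance Definition _ := [SubIntegralDomain_isSubField of subfield_of by <:].

End SubfieldType.

(** * Algebraic elements, exchange and the size of independent families *)

Section Algebraic.

Variable E : fieldType.
Implicit Types (S T : divringClosed E) (x y z : seq E).

Definition algebraic S (a : E) := 
  exists p : {poly E}, [/\ p != 0, p \is a polyOver S & root p a].

Lemma algebraicE S a :
  algebraic S a <-> algebraicOver (val : subfield_of S -> E) a.
Proof.
split=> [[p [p0 Sp pa]]|[p p0 pa]]; last first.
  exists (map_poly val p); split=> //; first by rewrite map_poly_eq0.
  by apply/polyOverP => i; rewrite coef_map; apply: valP.
pose q := \poly_(i < size p) (insubd (0 : subfield_of S) p`_i).
have qE : map_poly val q = p.
  apply/polyP=> i; rewrite coef_map coef_poly; case: ltnP => [_|pi] /=.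
    by rewrite insubdK // (polyOverP Sp).
  by rewrite nth_default.
by exists q; rewrite ?qE // -(map_poly_eq0 (val : {rmorphism _ -> _})) qE.
Qed.

Lemma algebraic_base S a : a \in S -> algebraic S a.
Proof. by move=> Sa; apply/algebraicE/(algebraic_id val (SubfieldOf Sa)). Qed.

Definition algebraic_pred S : pred E := fun a => `[< algebraic S a >].

Lemma algebraic_closure_closed S : divring_closed (algebraic_pred S).
Proof.
split=> [|a b /asboolP/algebraicE Aa /asboolP/algebraicE Ab|
          a b /asboolP/algebraicE Aa /asboolP/algebraicE Ab];
  apply/asboolP; first exact/algebraic_base/rpred1.
- exact/algebraicE/algebraic_sub.
- exact/algebraicE/algebraic_div.
Qed.

HB.instance Definition _ S :=
  GRing.isDivringClosed.Build E (algebraic_pred S)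
    (algebraic_closure_closed S).

Definition algebraic_closure S : divringClosed E :=
  GRing.DivringClosed.clone E (algebraic_pred S) _.

Lemma algebraic_sub S T a :
  {subset S <= T} -> algebraic S a -> algebraic T a.
Proof.
by move=> ST [p [p0 Sp pa]]; exists p; split=> //; apply: polyOverS Sp.
Qed.

Lemma algebraic_trans S T a :
  (forall b, b \in T -> algebraic S b) -> algebraic T a -> algebraic S a.
Proof.
move=> TS [p [p0 Tp pa]]; apply/algebraicE/integral_algebraic.
apply: (integral_root p0 pa) => _ /(nthP 0) [i _ <-].
by apply/integral_algebraic/algebraicE/TS/(polyOverP Tp).
Qed.

Lemma algebraic_adjoin S T x a :
  {subset S <= T} -> (forall b, b \in x -> algebraic T b) ->
  algebraic (adjoin S x) a -> algebraic T a.
Proof.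
move=> ST xT; apply: algebraic_trans => b Sb; apply/asboolP.
move: b Sb; apply: (@adjoin_min _ _ _ (algebraic_closure T)) => b.
  by move/ST => Tb; apply/asboolP/algebraic_base.
by move/xT => Tb; apply/asboolP.
Qed.

Lemma adjoin1P S b a : a \in adjoin S [:: b] ->
  exists p q : {poly E}, [/\ p \is a polyOver S, q \is a polyOver S,
    q.[b] != 0 & a = p.[b] / q.[b]].
Proof.
move/asboolP; elim=> [c /orP[Sc|]||c d _ [p [q [Sp Sq q0 ->]]] _
  [p' [q' [Sp' Sq' q'0 ->]]]|c d _ [p [q [Sp Sq q0 ->]]] _
  [p' [q' [Sp' Sq' q'0 ->]]]].
- exists c%:P, 1; rewrite polyOverC rpred1 !hornerE oner_eq0 ?divr1 ?invr1 ?mulr1.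
  by split.
- rewrite inE => /eqP ->; exists 'X, 1.
  by rewrite polyOverX rpred1 !hornerE oner_eq0 ?divr1 ?invr1 ?mulr1; split.
- by exists 1, 1; rewrite rpred1 !hornerE oner_eq0 ?divr1 ?invr1 ?mulr1; split.
- exists (p * q' - p' * q), (q * q'); split.
  + by rewrite rpredB ?rpredM.
  + by rewrite rpredM.
  + by rewrite hornerM mulf_neq0.
  + by rewrite -mulNr addf_div // !hornerE mulNr.
- have [p'0|p'0] := eqVneq p'.[b] 0.
    exists 0, 1; rewrite rpred0 rpred1 !hornerE p'0 oner_eq0.
    by rewrite mul0r invr0 mulr0; split.
  exists (p * q'), (q * p'); split; rewrite ?rpredM // ?hornerM ?mulf_neq0 //.
  by rewrite invf_div mulf_div.
Qed.

Lemma common_denominator S b (s : seq E) :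
  {subset s <= adjoin S [:: b]} ->
  exists2 q : {poly E}, q \is a polyOver S /\ q.[b] != 0 &
  forall a, a \in s -> exists2 p, p \is a polyOver S & a * q.[b] = p.[b].
Proof.
elim: s => [_|a s IHs ss].
  by exists 1 => //; rewrite rpred1 hornerE oner_eq0.
have [|q [Sq q0] sq] := IHs; first by move=> c sc; apply: ss; rewrite inE sc orbT.
have [|p [q' [Sp Sq' q'0 aE]]] := @adjoin1P S b a; first by rewrite ss ?mem_head.
exists (q * q'); first by rewrite rpredM // hornerM mulf_neq0.
move=> c; rewrite inE => /orP[/eqP ->|/sq [r Sr cE]].
  exists (p * q); first by rewrite rpredM.
  by rewrite aE !hornerM [q.[b] * _]mulrC mulrA divfK.
by exists (r * q'); rewrite ?rpredM // !hornerM mulrA cE.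
Qed.

(* Clearing denominators in an equation of [a] over [S(b)] gives an equation
   over [S[b]]; read as an equation in [b] over [S(a)] it can only vanish
   identically if [a] is algebraic over [S]. *)
Lemma algebraic_exchange S a b :
  algebraic (adjoin S [:: b]) a -> ~ algebraic S a ->
  algebraic (adjoin S [:: a]) b.
Proof.
move=> [p [p0 Sp pa]] NSa.
have sub_p : {subset (p : seq E) <= adjoin S [:: b]}.
  by move=> _ /(nthP 0) [i _ <-]; apply: (polyOverP Sp).
have [q [Sq q0] pq] := common_denominator sub_p.
have /(_ _)/cid2 coefP (i : 'I_(size p)) := pq p`_i (mem_nth 0 (ltn_ord i)).
pose c i := s2val (coefP i).
have Sc i : c i \is a polyOver S by rewrite /c; case: (coefP i).
have cE (i : 'I_(size p)) : p`_i * q.[b] = (c i).[b] by rewrite /c; case: (coefP i).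
pose N := \max_i size (c i).
(* The cleared equation is a polynomial in two variables, with [c i] the coefficient of the i-th
   power of the first; [Q] collects it by powers of the second, with the first set to [a]. *)
pose Q := \poly_(k < N) \sum_i (c i)`_k * a ^+ i.
exists Q; split; last 1 first.
- have pqab : p.[a] * q.[b] = 0 by rewrite (rootP pa) mul0r.
  apply/eqP; rewrite horner_poly -[RHS]pqab horner_coef mulr_suml.
  transitivity (\sum_(k < N) \sum_i (c i)`_k * a ^+ i * b ^+ k).
    by apply: eq_bigr => k _; rewrite mulr_suml.
  rewrite exchange_big /=; apply: eq_bigr => i _.
  rewrite mulrAC cE (@horner_coef_wide _ N) ?(leq_bigmax i) // mulr_suml.
  by apply: eq_bigr => k _; rewrite mulrAC.
(* If [Q] vanished, [a] would be a root of every [r k]; the leading coefficient of [c l], for the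
   top index [l], makes one of these nonzero. *)
- apply/eqP=> Q0; apply: NSa.
  pose r k := \poly_(i < size p) (if insub i is Some j then (c j)`_k else 0).
  have rE k : (r k).[a] = 0.
    have := congr1 (fun P : {poly E} => P`_k) Q0.
    rewrite coef0 coef_poly; case: ltnP => [_ <-|kN _].
      by rewrite horner_poly; apply: eq_bigr => i _; rewrite valK.
    rewrite horner_poly big1 // => i _; rewrite valK nth_default ?mul0r //.
    by rewrite (leq_trans _ kN) // (leq_bigmax i).
  have lp : ((size p).-1 < size p)%N by rewrite prednK // size_poly_gt0.
  pose l := Ordinal lp.
  have cl0 : c l != 0.
    apply: contraNneq p0 => cl0; rewrite -lead_coef_eq0 lead_coefE.
    by rewrite -[_ == _](mulIr_eq0 _ (mulIf q0)) (cE l) cl0 horner0.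
  exists (r (size (c l)).-1); split; last by rewrite rootE rE.
    apply: contraNneq cl0 => /(congr1 (fun P : {poly E} => P`_l)).
    rewrite coef0 coef_poly ltn_ord valK -lead_coefE => /eqP.
    by rewrite lead_coef_eq0.
  apply/polyOverP => i; rewrite coef_poly; case: ifP => // _; last exact: rpred0.
  by case: insub => [j|]; [apply: (polyOverP (Sc j)) | apply: rpred0].
- apply/polyOverP => k; rewrite coef_poly; case: ifP => _; last exact: rpred0.
  apply: rpred_sum => i _; rewrite rpredM ?rpredX //.
    by apply: adjoin_base; apply: (polyOverP (Sc i)).
  by apply: adjoin_mem; rewrite mem_head.
Qed.

(** Sequential form of algebraic independence, suited to induction on the list. *)
Definition independent S x := forall i, (i < size x)%N ->
  ~ algebraic (adjoin S (take i x)) x`_i.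

Lemma independent_cons S a x : independent S (a :: x) ->
  ~ algebraic S a /\ independent (adjoin S [:: a]) x.
Proof.
move=> ind; split.
  move=> Sa; apply: (ind 0%N isT); apply: algebraic_sub Sa; exact: adjoin_base.
move=> i ix Sa; apply: (ind i.+1 ix); apply: algebraic_sub Sa => /=.
apply: adjoin_min => b.
  by apply: adjoin_sub => // c; rewrite !inE => ->.
by move=> xb; apply: adjoin_mem; rewrite inE xb orbT.
Qed.

(** Steinitz exchange: the head of [x] replaces the entry of [y] at which it first becomes
    algebraic, and the induction continues over [S] with this head adjoined. *)
Lemma independent_size S x y : independent S x ->
  (forall a, a \in x -> algebraic (adjoin S y) a) -> (size x <= size y)%N.
Proof.
elim: x S y => // a x IHx S y /independent_cons [NSa ind] xy.
have [y1 [b [y2 [yE Na Aa]]]] : exists y1 b y2, [/\ y = y1 ++ b :: y2,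
    ~ algebraic (adjoin S y1) a & algebraic (adjoin S (rcons y1 b)) a].
  have {IHx ind xy} : algebraic (adjoin S y) a by apply: xy; rewrite mem_head.
  elim/last_ind: y => [Sa|y b IHy].
    case: NSa; apply: algebraic_sub Sa; exact: adjoin_min.
  have [/IHy [y1 [c [y2 [-> Nc Ac]]]] _|Na Aa] :=
      pselect (algebraic (adjoin S y) a).
    by exists y1, c, (rcons y2 b); rewrite rcons_cat rcons_cons.
  by exists y, b, [::]; rewrite cats1.
have Ab : algebraic (adjoin (adjoin S y1) [:: a]) b.
  apply: algebraic_exchange Na; apply: algebraic_sub Aa.
  apply: adjoin_min => c; first by move=> Sc; do 2!apply: adjoin_base.
  rewrite mem_rcons inE => /orP[/eqP ->|y1c]; last first.
    exact/adjoin_base/adjoin_mem.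
  by apply: adjoin_mem; rewrite mem_head.
rewrite yE size_cat addnS ltnS -size_cat; apply: IHx ind _ => c xc.
have : algebraic (adjoin S y) c by apply: xy; rewrite inE xc orbT.
apply: algebraic_adjoin => d; first by move=> Sd; do 2!apply: adjoin_base.
rewrite yE mem_cat inE orbCA -mem_cat => /orP[/eqP ->|yd]; last first.
  exact/algebraic_base/adjoin_mem.
apply: algebraic_sub Ab; apply: adjoin_min => e.
  apply: adjoin_sub => f; first exact: adjoin_base.
  by rewrite mem_cat => ->.
by move=> ae; apply/adjoin_base/adjoin_mem.
Qed.

(** An entry of [z] algebraic over the others could be dropped, and [x] would be algebraic over a
    family shorter than itself. *)
Lemma independent_generators S x z : independent S x -> size x = size z ->
  (forall a, a \in x -> algebraic (adjoin S z) a) ->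
  forall i, (i < size z)%N ->
    ~ algebraic (adjoin S (take i z ++ drop i.+1 z)) z`_i.
Proof.
move=> ind sz xz i iz Aza; suff : (size x <= (size z).-1)%N.
  by rewrite sz; case: (size z) iz => // m _; rewrite ltnn.
have -> : (size z).-1 = size (take i z ++ drop i.+1 z).
  by rewrite size_cat size_drop size_takel ?(ltnW iz) // subnS -subn1 -subn1 
    addnBA ?subnKC ?(ltnW iz) // subn_gt0.
apply: independent_size ind _ => a /xz; apply: algebraic_adjoin => b.
  exact: adjoin_base.
rewrite -{1}[z](cat_take_drop i) (drop_nth 0 iz) mem_cat inE orbCA -mem_cat.
by case/orP => [/eqP -> //|zb]; apply/algebraic_base/adjoin_mem.
Qed.

End Algebraic.

(** * Stable rationality inside an overfield *)

Local Notation widen := (widen_ord (leqnSn _)).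

Lemma mmap_muni (R S : comNzRingType) n (f : {rmorphism R -> S})
    (h : 'I_n.+1 -> S) (p : {mpoly R[n.+1]}) :
  mmap f h p =
  (map_poly (mmap f (fun i => h (widen i))) (muni p)).[h ord_max].
Proof.
rewrite muniE rmorph_sum /= horner_sum; apply: eq_bigr => m _.
rewrite linearZ /= map_polyXn hornerZ hornerXn mmapZ mmapX -mulrA.
congr (_ * _); rewrite /mmap1 big_ord_recr /=; congr (_ * _).
by apply: eq_bigr => i _; rewrite mnmE.
Qed.

(** Evaluating at the variables themselves through [mmap_muni] gives [p] back from [muni p]. *)
Lemma muni_eq0 (R : comNzRingType) n (p : {mpoly R[n.+1]}) :
  (muni p == 0) = (p == 0).
Proof.
apply/eqP/eqP => [p0|->]; last exact: muni0.
have <- : mmap (@mpolyC n.+1 R) (fun i => 'X_i) p = p.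
  rewrite [RHS]mpolyE; apply: eq_bigr => m _.
  by rewrite mmap1_id mul_mpolyC.
by rewrite mmap_muni p0 rmorph0 horner0.
Qed.

(** * Algebraic independence over a base field mapped into [E] *)

Section FieldOfFractionsOfPolynomials.

Variables (F E : fieldType) (iota : {rmorphism F -> E}).

Definition fimage_pred : pred E := fun a => `[< exists c, a = iota c >].

Lemma fimage_closed : divring_closed fimage_pred.
Proof.
split=> [|_ _ /asboolP [c ->] /asboolP [d ->]|
          _ _ /asboolP [c ->] /asboolP [d ->]]; apply/asboolP.
- by exists 1; rewrite rmorph1.
- by exists (c - d); rewrite rmorphB.
- by exists (c / d); rewrite rmorphM fmorphV.
Qed.

HB.instance Definition _ :=
  GRing.isDivringClosed.Build E fimage_pred fimage_closed.

Definition fimage : divringClosed E :=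
  GRing.DivringClosed.clone E fimage_pred _.

Lemma fimageP a : reflect (exists c, a = iota c) (a \in fimage).
Proof. exact: asboolP. Qed.

Lemma fimage_id c : iota c \in fimage.
Proof. by apply/fimageP; exists c. Qed.

Lemma mmap_in (S : divringClosed E) n (z : 'I_n -> E) p :
  {subset fimage <= S} -> (forall i, z i \in S) -> mmap iota z p \in S.
Proof.
move=> FS zS; rewrite /mmap rpred_sum // => m _; apply: rpredM.
  exact/FS/fimage_id.
by rewrite /mmap1 rpred_prod // => i _; apply/rpredX/zS.
Qed.

(** Induction on the number of variables, reading [p] as a polynomial in the last one: either a
    nonzero coefficient already vanishes at the other entries, or the last entry is a root of a
    nonzero polynomial over them. *)
Lemma dependent_algebraic n (z : 'I_n -> E) (p : {mpoly F[n]}) :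
  p != 0 -> mmap iota z p = 0 -> exists i,
    algebraic (adjoin fimage [seq z j | j <- enum 'I_n & j != i]) (z i).
Proof.
elim: n z p => [|n IHn] z p p0 pz.
  have pE : p = (p@_0%MM)%:MP.
    apply/mpolyP => m; rewrite mcoeffC; have -> : m = 0%MM.
      by apply/mnmP => -[].
    by rewrite eqxx mulr1.
  move: pz p0; rewrite pE mmapC => /eqP; rewrite fmorph_eq0 => /eqP ->.
  by rewrite mpolyC0 eqxx.
have [[k ck0]|cz] := pselect (exists k, ((muni p)`_k != 0) &&
    (mmap iota (fun i => z (widen i)) (muni p)`_k == 0)).
  case/andP: ck0 => ck0 /eqP/(IHn _ _ ck0) [i Ai].
  exists (widen i); apply: algebraic_sub Ai; apply: adjoin_sub => // a.
  case/mapP => j; rewrite mem_filter => /andP[ji _] ->; apply/mapP.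
  exists (widen j) => //; rewrite mem_filter mem_enum andbT.
  by apply: contraNneq ji => /(congr1 val) /= ji; apply/eqP/val_inj.
exists ord_max; exists (map_poly (mmap iota (fun i => z (widen i))) (muni p)).
split; last by rewrite rootE -mmap_muni pz.
- have lc0 : lead_coef (muni p) != 0 by rewrite lead_coef_eq0 muni_eq0.
  apply: contra_notN cz => /eqP P0; exists (size (muni p)).-1.
  by rewrite -lead_coefE lc0 /= lead_coefE -coef_map P0 coef0.
- apply/polyOverP => k; rewrite coef_map; apply: mmap_in => [a Fa|i].
    exact: adjoin_base.
  apply: adjoin_mem; apply/mapP; exists (widen i) => //.
  rewrite mem_filter mem_enum andbT; apply/eqP => /(congr1 val) /= /eqP.
  by rewrite ltn_eqF.
Qed.

(** [z'] completes [z] to a family as long as [x] over which [x] is algebraic; a relation among the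
    entries of [z] would make one of them redundant. *)
Lemma independent_generators_mpoly (x z z' : seq E) :
  independent fimage x -> size x = size (z ++ z') ->
  (forall a, a \in x -> algebraic (adjoin fimage (z ++ z')) a) ->
  algebraically_independent iota (fun i : 'I_(size z) => z`_i).
Proof.
move=> ind sz xz p pz; apply: contrapT => /eqP p0.
have [i Ai] := dependent_algebraic p0 pz.
have lt_cat (j : 'I_(size z)) : (j < size (z ++ z'))%N.
  by rewrite size_cat ltn_addr.
apply: (independent_generators ind sz xz (lt_cat i)).
rewrite nth_cat ltn_ord; apply: algebraic_sub Ai; apply: adjoin_sub => // a.
case/mapP => j; rewrite mem_filter => /andP[ji _] ->; rewrite mem_cat.
have -> : z`_j = (z ++ z')`_j by rewrite nth_cat ltn_ord.
move: ji (lt_cat i) (lt_cat j); rewrite -val_eqE neq_ltn.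
move: (z ++ z') => u /orP[] /= ij iu ju.
  by rewrite -(nth_take _ ij) mem_nth // size_takel // ltnW.
apply/orP; right; rewrite -(subnKC ij) -nth_drop mem_nth //.
by rewrite size_drop ltn_sub2r // (leq_ltn_trans ij).
Qed.

Lemma adjoin_ratfun (z : seq E) a : a \in adjoin fimage z ->
  exists p q : {mpoly F[size z]},
    mmap iota (fun i : 'I_(size z) => z`_i) q != 0 /\
    a = mmap iota (fun i : 'I_(size z) => z`_i) p /
        mmap iota (fun i : 'I_(size z) => z`_i) q.
Proof.
pose ev : {rmorphism {mpoly F[size z]} -> E} :=
  mmap iota (fun i : 'I_(size z) => z`_i).
suff : a \in adjoin fimage z -> exists p q, ev q != 0 /\ a = ev p / ev q by [].
move/asboolP; elim=> [b /orP[/fimageP [c ->]|/(nthP 0) [i iz <-]]||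
    b c _ [p [q [q0 ->]]] _ [p' [q' [q'0 ->]]]|
    b c _ [p [q [q0 ->]]] _ [p' [q' [q'0 ->]]]].
- by exists c%:MP, 1; rewrite rmorph1 oner_eq0 /ev /= mmapC divr1.
- exists 'X_(Ordinal iz), 1.
  by rewrite rmorph1 oner_eq0 /ev /= mmapX mmap1U divr1.
- by exists 1, 1; rewrite rmorph1 oner_eq0 divr1.
- exists (p * q' - p' * q), (q * q'); rewrite rmorphM mulf_neq0 //; split=> //.
  by rewrite rmorphB !rmorphM -[- (ev p' / _)]mulNr addf_div // mulNr.
- have [p'0|p'0] := eqVneq (ev p') 0.
    exists 0, 1; rewrite rmorph0 rmorph1 oner_eq0 p'0 !mul0r invr0 mulr0.
    by split.
  exists (p * q'), (q * p'); rewrite !rmorphM mulf_neq0 //; split=> //.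
  by rewrite invf_div mulf_div.
Qed.

(** If an entry were a root of a nonzero [p] over its predecessors, applying [lam] repeatedly would
    make its multiples by all powers of 2 roots of [p], infinitely many in characteristic zero. *)
Lemma independent_scaling (S : divringClosed E) (x : seq E) :
  [pchar E] =i pred0 ->
  (forall i, (i < size x)%N -> x`_i != 0 /\
    exists lam : {rmorphism E -> E}, [/\ forall a, a \in S -> lam a = a,
      forall j, (j < i)%N -> lam x`_j = x`_j & lam x`_i = x`_i *+ 2]) ->
  independent S x.
Proof.
move=> charE xS i ix [p [p0 Sp px]]; have [xi0 [lam [lamS lamj lami]]] := xS i ix.
have lam_adj a : a \in adjoin S (take i x) -> lam a = a.
  move/asboolP; elim=> [b /orP[/lamS //|]||b c _ bE _ cE|b c _ bE _ cE].
  - case/(nthP 0) => j; rewrite size_takel ?(ltnW ix) // => ji <-.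
    by rewrite nth_take // lamj.
  - exact: rmorph1.
  - by rewrite rmorphB bE cE.
  - by rewrite rmorphM fmorphV bE cE.
have proot k : root p (x`_i *+ (2 ^ k)).
  elim: k => [|k IHk]; first by rewrite expn0 mulr1n.
  have lamp : map_poly lam p = p.
    by apply/polyP => l; rewrite coef_map /= lam_adj // (polyOverP Sp).
  have := rmorph_root lam IHk; rewrite lamp rmorphMn lami.
  by rewrite -mulrnA expnS.
have := max_poly_roots (rs := [seq x`_i *+ (2 ^ k) | k <- seq.iota 0 (size p)]) p0.
rewrite size_map size_iota ltnn => H; suff: false by []; apply: H.
  by apply/allP => _ /mapP [k _ ->].
rewrite map_inj_uniq ?iota_uniq // => k l /eqP.
have natE m : (m%:R == 0 :> E) = (m == 0%N) by move/pcharf0P: charE => ->.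
suff inj a b : (a <= b)%N -> x`_i *+ a == x`_i *+ b -> a = b.
  case: (leqP (2 ^ k) (2 ^ l)) => [le|/ltnW le] H1.
    by move/eqP: (inj _ _ le H1); rewrite eqn_exp2l // => /eqP.
  by rewrite eq_sym in H1; move/esym/eqP: (inj _ _ le H1);
     rewrite eqn_exp2l // => /eqP.
move=> ab; rewrite eq_sym -subr_eq0 -mulrnBr // -mulr_natr mulf_eq0.
by rewrite (negbTE xi0) natE subn_eq0 => ba; apply/eqP; rewrite eqn_leq ab.
Qed.

End FieldOfFractionsOfPolynomials.

(** Independence of [y] extends [j] to an isomorphism [psi] from the rational functions over [L]
    onto the field generated by [y]; the preimages of [z] under [psi] are then free generators over
    [F]. *)
Lemma stably_rational_criterion (F L E : fieldType) (iota : {rmorphism F -> L})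
    (j : {rmorphism L -> E}) (y z : seq E) :
  algebraically_independent j (fun i : 'I_(size y) => y`_i) ->
  algebraically_independent (j \o iota) (fun i : 'I_(size z) => z`_i) ->
  adjoin (fimage (j \o iota)) z =i adjoin (fimage j) y ->
  stably_rational iota.
Proof.
move=> indy indz zy; exists (size y).
set ev : {mpoly L[size y]} -> E := mmap j (fun i : 'I_(size y) => y`_i).
have ev_inj : injective ev.
  move=> p q /eqP; rewrite -subr_eq0 -rmorphB => /eqP/indy/eqP.
  by rewrite subr_eq0 => /eqP.
pose psi : {rmorphism {fraction {mpoly L[size y]}} -> E} := frac_lift ev_inj.
have psi_surj a : a \in adjoin (fimage j) y -> exists u, psi u = a.
  case/adjoin_ratfun => p [q [q0 ->]]; exists (tofrac p / tofrac q).
  rewrite /psi /= frac_lift_div //.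
  by apply: contra_neq q0 => ->; rewrite rmorph0.
have /(_ _)/cid xP (i : 'I_(size z)) : exists u, psi u = z`_i.
  by apply: psi_surj; rewrite -zy; apply/adjoin_mem/mem_nth.
pose x i := sval (xP i).
have psi_x p : psi (mmap (ratfun_embedding iota (size y)) x p) =
    mmap (j \o iota) (fun i : 'I_(size z) => z`_i) p.
  rewrite rmorph_sum; apply: eq_bigr => m _; rewrite rmorphM rmorph_prod.
  congr (_ * _).
    by rewrite /ratfun_embedding /psi /= frac_lift_tofrac; apply: mmapC.
  by apply: eq_bigr => i _; rewrite rmorphXn /x /=; case: (xP i) => u /= ->.
exists (size z), x; split=> [p px|u].
  by apply: indz; rewrite -psi_x px rmorph0.
have : psi u \in adjoin (fimage (j \o iota)) z.
  rewrite zy [u]fracE rmorphM fmorphV /psi /= !frac_lift_tofrac.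
  have evS p : ev p \in adjoin (fimage j) y.
    apply: mmap_in => [a|i]; first exact: adjoin_base.
    exact/adjoin_mem/mem_nth.
  exact: rpred_div.
case/adjoin_ratfun => p [q [q0 uE]]; exists p, q; rewrite -!psi_x in q0 uE.
split; first by apply: contra_neq q0 => ->; rewrite rmorph0.
by apply: (fmorph_inj psi); rewrite uE rmorphM fmorphV.
Qed.

(** * Rational function fields and monomial morphisms *)

Section RationalFunctionField.

Variable F : fieldType.

Lemma mpoly_morph_ext n (R : comNzRingType)
    (f g : {rmorphism {mpoly F[n]} -> R}) :
  (forall c, f c%:MP = g c%:MP) -> (forall i, f 'X_i = g 'X_i) -> f =1 g.
Proof.
move=> fgC fgX p; rewrite [p]mpolyE !rmorph_sum; apply: eq_bigr => m _.
rewrite -mul_mpolyC !rmorphM fgC; congr (_ * _).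
rewrite mpolyXE_id !rmorph_prod; apply: eq_bigr => i _.
by rewrite !rmorphXn fgX.
Qed.

(** With [V = 'I_k * (gT * gT)] this unfolds to [gcp_field F gT k], so monomial morphisms apply to
    that field too. *)
Definition ratfun (V : finType) : fieldType := {fraction {mpoly F[#|V|]}}.

Definition ratfun_const (V : finType) : {rmorphism F -> ratfun V} :=
  @tofrac {mpoly F[#|V|]} \o @mpolyC #|V| F.

Definition ratfun_var (V : finType) (v : V) : ratfun V :=
  tofrac (mpolyX _ (mnm1 (enum_rank v))).

Lemma ratfun_ext (V : finType) (Q : fieldType) (f g : {rmorphism ratfun V -> Q}) :
  (forall c, f (ratfun_const V c) = g (ratfun_const V c)) ->
  (forall v, f (ratfun_var v) = g (ratfun_var v)) -> f =1 g.
Proof.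
move=> fgC fgV.
have fg p : f (tofrac p) = g (tofrac p).
  apply: (mpoly_morph_ext (f := f \o @tofrac {mpoly F[#|V|]})
                          (g := g \o @tofrac {mpoly F[#|V|]})) => // i /=.
  by rewrite -(enum_valK i) fgV.
by move=> u; rewrite [u]fracE !rmorphM !fmorphV !fg.
Qed.

Lemma ratfun_var_neq0 (V : finType) (v : V) : ratfun_var v != 0.
Proof.
rewrite tofrac_eq0; apply/eqP => /(congr1 (fun p => p@_U_(enum_rank v))) /eqP.
by rewrite mcoeffX eqxx mcoeff0 oner_eq0.
Qed.

Section MonomialMorphism.

Variables (V W : finType) (c : V -> F) (pi : V -> W).
Hypotheses (c0 : forall v, c v != 0) (pi_inj : injective pi).

Definition mono_subst : {rmorphism {mpoly F[#|V|]} -> {mpoly F[#|W|]}} :=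
  mmap (@mpolyC #|W| F)
    (fun i => (c (enum_val i))%:MP * 'X_(enum_rank (pi (enum_val i)))).

Lemma mono_subst_inj : injective (@tofrac {mpoly F[#|W|]} \o mono_subst).
Proof.
(* A left inverse: it inverts the coefficients, and variables outside the image of [pi] may go to
   0. *)
pose back : {rmorphism {mpoly F[#|W|]} -> {mpoly F[#|V|]}} :=
  mmap (@mpolyC #|V| F) (fun j =>
    if [pick v | pi v == enum_val j] is Some v
    then ((c v)^-1)%:MP * 'X_(enum_rank v) else 0).
have backK : cancel mono_subst back.
  apply: (mpoly_morph_ext (f := back \o mono_subst) (g := idfun)) => [d|i] /=.
    by rewrite !mmapC.
  rewrite mmapX mmap1U rmorphM /= mmapC mmapX mmap1U enum_rankK.
  case: pickP => [v /eqP/pi_inj ->|/(_ (enum_val i))]; last by rewrite eqxx.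
  by rewrite mulrA -rmorphM mulfV // rmorph1 mul1r enum_valK.
move=> p q /= /eqP; rewrite tofrac_eq => /eqP; exact: can_inj backK _ _.
Qed.

(* Opaque, so that unification never unfolds the quotient. *)
Lemma mono_morph_exists : {f : {rmorphism ratfun V -> ratfun W} |
  (forall a, f (ratfun_const V a) = ratfun_const W a) /\
  (forall v, f (ratfun_var v) = ratfun_const W (c v) * ratfun_var (pi v))}.
Proof.
exists (frac_lift mono_subst_inj : {rmorphism ratfun V -> ratfun W}).
split=> [d|v] /=; rewrite frac_lift_tofrac /=; first by rewrite mmapC.
by rewrite mmapX mmap1U rmorphM /= !enum_rankK.
Qed.

Definition mono_morph := sval mono_morph_exists.

Lemma mono_morph_const a :
  mono_morph (ratfun_const V a) = ratfun_const W a.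
Proof. by have [] := svalP mono_morph_exists. Qed.

Lemma mono_morph_var v :
  mono_morph (ratfun_var v) = ratfun_const W (c v) * ratfun_var (pi v).
Proof. by have [] := svalP mono_morph_exists. Qed.

End MonomialMorphism.

Section Scaling.

Variables (V : finType) (v : V).
Hypothesis two_neq0 : 2%:R != 0 :> F.

Lemma scaling_coef_neq0 u : (if u == v then 2%:R else 1 : F) != 0.
Proof. by case: ifP; rewrite ?oner_eq0. Qed.

(** These endomorphisms move a single variable; they feed [independent_scaling] and the nonvanishing
    arguments below. *)
Definition scaling : {rmorphism ratfun V -> ratfun V} :=
  mono_morph scaling_coef_neq0 (@inj_id V).

Lemma scaling_const a : scaling (ratfun_const V a) = ratfun_const V a.
Proof. exact: mono_morph_const. Qed.

Lemma scaling_var : scaling (ratfun_var v) = ratfun_var v *+ 2.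
Proof. by rewrite /scaling mono_morph_var eqxx rmorph_nat mulr_natl. Qed.

Lemma scaling_var_neq u : u != v -> scaling (ratfun_var u) = ratfun_var u.
Proof.
by move=> uv; rewrite /scaling mono_morph_var (negbTE uv) rmorph1 mul1r.
Qed.

End Scaling.

End RationalFunctionField.

(** A relation over [L] becomes, through [g], a relation over the larger field [K]. *)
Lemma algebraically_independent_comp (L K E : fieldType) (g : {rmorphism L -> K})
    (j : {rmorphism K -> E}) n (y : 'I_n -> E) :
  algebraically_independent j y -> algebraically_independent (j \o g) y.
Proof.
move=> indy p py; pose gp : {mpoly K[n]} := map_mpoly g p.
have gp0 : gp = 0.
  apply: indy; rewrite -py; apply: (mpoly_morph_ext
    (f := mmap j y \o map_mpoly g) (g := mmap (j \o g) y)) => [c|i] /=.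
    by rewrite map_mpolyC !mmapC.
  by rewrite map_mpolyX !mmapX.
apply/mpolyP => m; apply: (fmorph_inj g).
by rewrite mcoeff0 rmorph0 -mcoeff_map_mpoly -/gp gp0 mcoeff0.
Qed.

(** * Kummer theory by averaging *)

Section Kummer.

Variables (E : fieldType) (gT : finGroupType) (act : gT -> {rmorphism E -> E}).
Hypothesis act1 : forall f, act 1%g f = f.
Hypothesis actM : forall u v f, act (u * v)%g f = act u (act v f).
Hypothesis card_neq0 : #|gT|%:R != 0 :> E.

Definition invariant (f : E) := forall u, act u f = f.

Definition average (f : E) : E := #|gT|%:R^-1 * \sum_u act u f.

Lemma average_inv f : invariant (average f).
Proof.
move=> v; rewrite rmorphM fmorphV rmorph_nat; congr (_ * _).
rewrite rmorph_sum [RHS](reindex_inj (mulgI v)) /=.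
by apply: eq_bigr => u _; rewrite actM.
Qed.

Lemma average_id f : invariant f -> average f = f.
Proof.
move=> fI; rewrite /average (eq_bigr (fun=> f)) => [|u _]; last exact: fI.
by rewrite sumr_const cardT -cardE -[f *+ _]mulr_natl mulKf.
Qed.

Lemma average_act v f : average (act v f) = average f.
Proof.
congr (_ * _); rewrite [RHS](reindex_inj (mulIg v)) /=.
by apply: eq_bigr => u _; rewrite actM.
Qed.

Lemma averageMl c f : invariant c -> average (c * f) = c * average f.
Proof.
move=> cI; rewrite /average mulrCA; congr (_ * _); rewrite mulr_sumr.
by apply: eq_bigr => u _; rewrite rmorphM cI.
Qed.

Lemma average_sum (J : finType) (f : J -> E) :
  average (\sum_j f j) = \sum_j average (f j).
Proof.
rewrite /average -mulr_sumr exchange_big /=; congr (_ * _).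
by apply: eq_bigr => u _; rewrite rmorph_sum.
Qed.

Lemma averageB f g : average (f - g) = average f - average g.
Proof.
rewrite /average -mulrBr -sumrB; congr (_ * _).
by apply: eq_bigr => u _; rewrite rmorphB.
Qed.

(** The average of [act u f] equals that of [f], and it is also [c] times it. *)
Lemma average_eigen c u f : act u f = c * f -> invariant c -> c != 1 ->
  average f = 0.
Proof.
move=> uf cI c1; have := average_act u f; rewrite uf averageMl // => /eqP.
rewrite -subr_eq0 -{2}[average f]mul1r -mulrBl mulf_eq0 subr_eq0 (negbTE c1).
by move/eqP.
Qed.

Variables (I : finType) (i0 : I) (th : I -> E) (chi : I -> gT -> E).
Hypothesis th_neq0 : forall i, th i != 0.
Hypothesis th0 : th i0 = 1.
Hypothesis act_th : forall i u, act u (th i) = chi i u * th i.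
Hypothesis chi_orthogonal : forall u, u != 1%g -> \sum_i (chi i u)^-1 = 0.
Hypothesis card_I : #|I| = #|gT|.

Lemma chi_neq0 i u : chi i u != 0.
Proof.
apply: contraNneq (th_neq0 i) => c0.
by rewrite -[th i]act1 -(mulVg u) actM act_th c0 mul0r rmorph0.
Qed.

Lemma chi1 i : chi i 1%g = 1.
Proof. by apply: (mulIf (th_neq0 i)); rewrite -act_th act1 mul1r. Qed.

Definition coordinate i f := average (f / th i).

(** After exchanging the sums over indices and group elements, [chi_orthogonal] leaves only the
    identity, with weight [#|I| = #|gT|]. *)
Lemma coordinate_expansion f : f = \sum_i coordinate i f * th i.
Proof.
pose s u := \sum_i (chi i u)^-1.
have -> : \sum_i coordinate i f * th i =
    #|gT|%:R^-1 * \sum_u act u f * s u.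
  rewrite /s; under [X in _ = _ * X]eq_bigr do rewrite mulr_sumr.
  rewrite exchange_big /= mulr_sumr; apply: eq_bigr => i _.
  rewrite /coordinate /average -mulrA; congr (_ * _); rewrite mulr_suml.
  apply: eq_bigr => u _; rewrite rmorphM fmorphV act_th invfM mulrA -mulrA.
  by rewrite mulVf // mulr1.
rewrite (bigD1 1%g) //= big1 => [|u u1]; last by rewrite /s chi_orthogonal ?mulr0.
rewrite addr0 act1 /s (eq_bigr (fun=> 1)) => [|i _]; last by rewrite chi1 invr1.
by rewrite sumr_const cardT -cardE card_I mulrC mulfK.
Qed.

Lemma coordinate_neq0 f : f != 0 -> exists i, coordinate i f != 0.
Proof.
move=> f0; apply: contrapT => coord0; case/eqP: f0.
rewrite [LHS]coordinate_expansion big1 // => i _.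
suff -> : coordinate i f = 0 by rewrite mul0r.
by apply/eqP; apply: contrapT => /negP ci; apply: coord0; exists i.
Qed.

(** These conditions make the elements with coordinates in [S] a ring stable under [act]; the third
    one asks for the structure constants of the multiplication. *)
Definition kummer_base (S : divringClosed E) :=
  [/\ forall a, a \in S -> invariant a, forall i u, chi i u \in S &
      forall i j k, average (th i * th j / th k) \in S].

Definition kummer_pred (S : divringClosed E) of kummer_base S : pred E :=
  fun f => [forall i, coordinate i f \in S].

(** * The stable field of the elements with coordinates in [S] *)

Section KummerExtension.

Variables (S : divringClosed E) (kS : kummer_base S).

Local Notation kummer := (kummer_pred kS).

Lemma kummerP f : reflect (forall i, coordinate i f \in S) (f \in kummer).
Proof. exact: forallP. Qed.

Lemma base_kummerM a f : a \in S -> f \in kummer -> a * f \in kummer.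
Proof.
have [SI _ _] := kS.
move=> Sa /kummerP Kf; apply/kummerP => i.
rewrite /coordinate -mulrA averageMl; last exact: SI.
exact: rpredM (Kf i).
Qed.

Lemma kummer1 : 1 \in kummer.
Proof.
have [_ _ St] := kS; apply/kummerP => i; rewrite /coordinate.
by have := St i0 i0 i; rewrite th0 mulr1.
Qed.

Lemma base_kummer : {subset S <= kummer}.
Proof. by move=> a Sa; rewrite -[a]mulr1 base_kummerM // kummer1. Qed.

Lemma kummerB f g : f \in kummer -> g \in kummer -> f - g \in kummer.
Proof.
move=> /kummerP Kf /kummerP Kg; apply/kummerP => i.
rewrite /coordinate mulrBl averageB.
by apply: rpredB; [apply: Kf|apply: Kg].
Qed.

Lemma kummerM f g : f \in kummer -> g \in kummer -> f * g \in kummer.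
Proof.
have [SI _ St] := kS.
move=> /kummerP Kf /kummerP Kg; apply/kummerP => k.
rewrite (coordinate_expansion f) (coordinate_expansion g) /coordinate.
rewrite mulr_suml mulr_suml average_sum; apply: rpred_sum => i _.
rewrite mulr_sumr mulr_suml average_sum; apply: rpred_sum => j _.
set a := average (f / _); set b := average (g / _).
have -> : a * th i * (b * th j) / th k = a * b * (th i * th j / th k).
  by rewrite mulrACA !mulrA.
rewrite averageMl; last by move=> u; rewrite rmorphM !average_inv.
by apply: rpredM; [apply: rpredM; [apply: Kf|apply: Kg]|apply: St].
Qed.

Lemma kummer_act u f : f \in kummer -> act u f \in kummer.
Proof.
have [SI Schi St] := kS.
move=> /kummerP Kf; apply/kummerP => i; rewrite /coordinate.
have -> : act u f / th i = chi i u * act u (f / th i).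
  by rewrite rmorphM fmorphV act_th invfM mulrCA mulVKf ?chi_neq0.
rewrite averageMl ?average_act; last exact/SI/Schi.
by apply: rpredM; [apply: Schi|apply: Kf].
Qed.

(** The coordinate of an invariant element along [th i0 = 1] is the element itself. *)
Lemma kummer_inv f : f \in kummer -> invariant f -> f \in S.
Proof.
move=> /kummerP/(_ i0) + fI; rewrite /coordinate th0 divr1.
by rewrite average_id.
Qed.

(** The norm of [f] is invariant and lies in the ring, hence in [S]; so [f^-1] is an element of [S]
    times the product of the other conjugates. *)
Lemma kummerV f : f \in kummer -> f^-1 \in kummer.
Proof.
move=> Kf; have [->|f0] := eqVneq f 0; first by rewrite invr0 -(subrr 1) kummerB ?kummer1.
pose g := \prod_(u | u != 1%g) act u f.
have Kg : g \in kummer.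
  rewrite /g; elim/big_ind: _ => [||u _]; [exact: kummer1|exact: kummerM|].
  exact: kummer_act.
pose nm := f * g.
have nmE : nm = \prod_u act u f by rewrite (bigD1 1%g) //= act1.
have nmI : invariant nm.
  move=> v; rewrite nmE rmorph_prod [RHS](reindex_inj (mulgI v)) /=.
  by apply: eq_bigr => u _; rewrite actM.
have Snm : nm \in S by apply: kummer_inv => //; apply: kummerM.
have nm0 : nm != 0.
  by rewrite nmE; apply/prodf_neq0 => u _; rewrite fmorph_eq0.
have -> : f^-1 = nm^-1 * g.
  apply: (mulfI f0); rewrite mulfV // mulrCA -/nm mulVf //.
by rewrite base_kummerM // rpredV.
Qed.

Lemma kummer_closed : divring_closed kummer.
Proof.
split=> [|f g|f g Kf Kg]; [exact: kummer1|exact: kummerB|].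
exact/kummerM/kummerV.
Qed.

HB.instance Definition _ :=
  GRing.isDivringClosed.Build E (kummer_pred kS) kummer_closed.

Definition kummer_field : divringClosed E :=
  GRing.DivringClosed.clone E (kummer_pred kS) _.

Lemma kummer_th i : th i \in kummer.
Proof.
have [_ _ St] := kS; apply/kummerP => j; rewrite /coordinate.
by have := St i i0 j; rewrite th0 mulr1.
Qed.

End KummerExtension.

(* Hilbert 90: a nonzero coordinate of [f] differs from [f] by an element of
   every stable subfield containing the cocycle [act u f / f]. *)
Lemma coordinate_cocycle (T : divringClosed E) i f :
  (forall j, th j \in T) -> (forall i u, chi i u \in T) ->
  (forall u, act u f / f \in T) -> f != 0 -> coordinate i f / f \in T.
Proof.
move=> Tth Tchi Tf f0; rewrite /coordinate /average -mulrA mulr_suml.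
apply: rpredM; first by rewrite rpredV rpred_nat.
apply: rpred_sum => u _; rewrite rmorphM fmorphV act_th mulrAC.
by apply: rpredM; rewrite ?Tf // rpredV rpredM.
Qed.

End Kummer.

(** * Cocycles of C_2 x C_2n *)

(** The exponent matrix has determinant [a * d - b * c = 1], and its inverse expresses [x] and [y]
    by the two monomials. *)
Lemma unimodular_mem (E : fieldType) (T : divringClosed E) (x y : E)
    (a b c d : nat) : x != 0 -> y != 0 -> (a * d = (b * c).+1)%N ->
  x ^+ a * y ^+ c \in T -> x ^+ b * y ^+ d \in T -> x \in T /\ y \in T.
Proof.
move=> x0 y0 adbc T1 T2; split.
  have -> : x = (x ^+ a * y ^+ c) ^+ d / (x ^+ b * y ^+ d) ^+ c.
    rewrite !exprMn -!exprM [(d * c)%N]mulnC adbc.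
    rewrite exprSr; apply: (canRL (mulfK _)); last by ring.
    by rewrite mulf_neq0 ?expf_neq0.
  by apply: rpred_div; apply: rpredX.
have -> : y = (x ^+ b * y ^+ d) ^+ a / (x ^+ a * y ^+ c) ^+ b.
  rewrite !exprMn -!exprM [(d * a)%N]mulnC adbc [(b * a)%N]mulnC [(c * b)%N]mulnC.
  rewrite exprSr; apply: (canRL (mulfK _)); last by ring.
  by rewrite mulf_neq0 ?expf_neq0.
by apply: rpred_div; apply: rpredX.
Qed.

Section CocycleAlgebra.

Variables (E : fieldType) (gT : finGroupType) (act : gT -> {rmorphism E -> E}).
Hypothesis act1 : forall f, act 1%g f = f.
Hypothesis actM : forall u v f, act (u * v)%g f = act u (act v f).
Hypothesis mulgCT : forall u v : gT, (u * v = v * u)%g.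

Variables (a b : gT) (n q : nat).
Hypothesis aa : (a * a = 1)%g.
Hypothesis b_order : (b ^+ (2 * n) = 1)%g.
Hypothesis ab_generate : forall u : gT, exists i j, u = (a ^+ i * b ^+ j)%g.
Hypothesis nq : (n * n = (q * 4).+1)%N.

Let beta := (b ^+ n)%g.

Lemma actC u v f : act u (act v f) = act v (act u f).
Proof. by rewrite -!actM mulgCT. Qed.

Lemma act_beta f : act beta (act beta f) = f.
Proof. by rewrite -actM /beta -expgD addnn -mul2n b_order act1. Qed.

Lemma act_a f : act a (act a f) = f.
Proof. by rewrite -actM aa act1. Qed.

(** [norm_c], [norm_b] and [norm_h] are the norms for the subgroups generated by [b ^+ 2], by [b],
    and by [a] and [beta]; [norm_c'] runs over the representatives 1, b, ..., b^(n-1) of the powers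
    of [b] modulo [beta]. *)
Definition norm_c f := \prod_(i < n) act (b ^+ (2 * i))%g f.
Definition norm_b f := \prod_(j < 2 * n) act (b ^+ j)%g f.
Definition norm_c' f := \prod_(i < n) act (b ^+ i)%g f.
Definition norm_h f := f * act a f * act beta (f * act a f).

Lemma norm_cM f g : norm_c (f * g) = norm_c f * norm_c g.
Proof. by rewrite -big_split; apply: eq_bigr => i _; rewrite rmorphM. Qed.

Lemma norm_bM f g : norm_b (f * g) = norm_b f * norm_b g.
Proof. by rewrite -big_split; apply: eq_bigr => i _; rewrite rmorphM. Qed.

Lemma norm_bV f : norm_b f^-1 = (norm_b f)^-1.
Proof. by rewrite -prodfV; apply: eq_bigr => i _; rewrite fmorphV. Qed.

Lemma norm_c'M f g : norm_c' (f * g) = norm_c' f * norm_c' g.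
Proof. by rewrite -big_split; apply: eq_bigr => i _; rewrite rmorphM. Qed.

Lemma norm_c'X f k : norm_c' (f ^+ k) = norm_c' f ^+ k.
Proof. by rewrite -prodrXl; apply: eq_bigr => i _; rewrite rmorphXn. Qed.

Lemma norm_hM f g : norm_h (f * g) = norm_h f * norm_h g.
Proof. by rewrite /norm_h !rmorphM; ring. Qed.

Lemma norm_hX f k : norm_h (f ^+ k) = norm_h f ^+ k.
Proof. by rewrite /norm_h !rmorphM !rmorphXn !exprMn. Qed.

Lemma norm_c_neq0 f : f != 0 -> norm_c f != 0.
Proof. by move=> f0; apply/prodf_neq0 => i _; rewrite fmorph_eq0. Qed.

Lemma norm_b_neq0 f : f != 0 -> norm_b f != 0.
Proof. by move=> f0; apply/prodf_neq0 => i _; rewrite fmorph_eq0. Qed.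

Lemma norm_c'_neq0 f : f != 0 -> norm_c' f != 0.
Proof. by move=> f0; apply/prodf_neq0 => i _; rewrite fmorph_eq0. Qed.

Lemma norm_h_neq0 f : f != 0 -> norm_h f != 0.
Proof. by move=> f0; rewrite /norm_h rmorphM !mulf_neq0 ?fmorph_eq0. Qed.

Lemma act_norm_b u f : act u (norm_b f) = norm_b (act u f).
Proof. by rewrite rmorph_prod; apply: eq_bigr => i _; rewrite actC. Qed.

Lemma act_norm_c u f : act u (norm_c f) = norm_c (act u f).
Proof. by rewrite rmorph_prod; apply: eq_bigr => i _; rewrite actC. Qed.

Lemma n_gt0 : (0 < n)%N.
Proof. by move: nq; case: (n). Qed.

Lemma n_odd : odd n.
Proof. by have /(congr1 odd) := nq; rewrite /= !oddM /= andbF andbb. Qed.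

Lemma norm_b_act_b f : norm_b (act b f) = norm_b f.
Proof.
have := n_gt0; rewrite -(ltn_pmul2l (m := 2)) // muln0 /norm_b.
move: b_order; case: (2 * n)%N => // m bm _.
rewrite big_ord_recr [RHS]big_ord_recl /= expg0 act1 mulrC -actM -expgSr bm act1.
by congr (_ * _); apply: eq_bigr => i _; rewrite -actM -expgSr.
Qed.

Lemma norm_c_act f : act (b ^+ 2)%g (norm_c f) = norm_c f.
Proof.
rewrite act_norm_c /norm_c; have := n_gt0.
move: b_order; case: (n) => // m bm _.
rewrite big_ord_recr [RHS]big_ord_recl /= muln0 expg0 act1 mulrC -actM -expgD.
rewrite -mulnSr bm act1.
by congr (_ * _); apply: eq_bigr => i _; rewrite -actM -expgD -mulnSr.
Qed.

(** As [n] is odd, [beta] is [b] times a power of [b ^+ 2], so it acts on [norm_c f] as [b] does;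
    even and odd powers of [b] together give [norm_b]. *)
Lemma norm_c_beta f : norm_c f * act beta (norm_c f) = norm_b f.
Proof.
have -> : act beta (norm_c f) = act b (norm_c f).
  rewrite /beta -(odd_double_half n) n_odd add1n expgS actM; congr (act b _).
  elim: n./2 => [|m IHm]; first by rewrite expg0 act1.
  by rewrite doubleS -addn2 expgD actM norm_c_act.
rewrite rmorph_prod -big_split /norm_b mulnC.
elim: n => [|m IHm]; first by rewrite !big_ord0.
rewrite mulSn add2n !big_ord_recr /= -IHm -mulrA; congr (_ * _).
by rewrite mulnC; congr (_ * _); rewrite -actM -expgS.
Qed.

(** * Cycles built from the edges [al] and [be], and their twists *)

Section Elements.

Variables al be : E.
Hypotheses (al0 : al != 0) (be0 : be != 0).

(** With [al] the edge from 1 to [a] and [be] the edge from 1 to [b], [cocU] compares the two ways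
    from 1 to [a * b] around a square; [cocA] and [cocB] are the loops at 1 along [a] and along
    [b]. *)
Definition cocU := al * act a be / (be * act b al).
Definition cocA := al * act a al.
Definition cocB := norm_b be.
Definition cocC := cocA * act beta cocA.

Local Notation U := cocU.
Local Notation A := cocA.
Local Notation B := cocB.

Lemma cocU_neq0 : U != 0.
Proof. by rewrite /U !mulf_neq0 ?invr_neq0 ?mulf_neq0 ?fmorph_eq0. Qed.

Lemma cocA_neq0 : A != 0.
Proof. by rewrite /A mulf_neq0 ?fmorph_eq0. Qed.

Lemma cocB_neq0 : B != 0.
Proof. exact: norm_b_neq0. Qed.

Lemma cocC_neq0 : cocC != 0.
Proof. by rewrite mulf_neq0 ?fmorph_eq0 ?cocA_neq0. Qed.

Lemma act_a_cocA : act a A = A.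
Proof. by rewrite rmorphM act_a mulrC. Qed.

Lemma cocU_a : U * act a U = A / act b A.
Proof.
rewrite /U /A fmorph_div !rmorphM act_a [act a (act b al)]actC.
by field; rewrite !fmorph_eq0 al0 be0.
Qed.

Lemma act_b_cocA : act b A = A / (U * act a U).
Proof.
by rewrite cocU_a invf_div mulrCA mulfV ?mulr1 // cocA_neq0.
Qed.

Lemma act_b_cocB : act b B = B.
Proof. by rewrite act_norm_b norm_b_act_b. Qed.

Lemma act_bX_cocB j : act (b ^+ j)%g B = B.
Proof.
by elim: j => [|j IHj]; rewrite ?expg0 ?act1 // expgS actM IHj act_b_cocB.
Qed.

(** The factors [al] and [act b al] have the same norm and cancel. *)
Lemma norm_b_cocU : norm_b U = act a B / B.
Proof.
rewrite /U norm_bM norm_bV !norm_bM norm_b_act_b -act_norm_b.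
by rewrite /cocB; field; rewrite !norm_b_neq0.
Qed.

Lemma act_cocC : act a cocC = cocC /\ act beta cocC = cocC.
Proof.
split; first by rewrite rmorphM [act a (act _ _)]actC act_a_cocA.
by rewrite rmorphM act_beta mulrC.
Qed.

Lemma norm_h_cocU : norm_h U = cocC / act b cocC.
Proof.
rewrite /norm_h cocU_a fmorph_div mulf_div; congr (_ / _).
by rewrite [RHS]rmorphM [act beta (act b _)]actC.
Qed.

Variables kap tau : E.
Hypotheses (kap0 : kap != 0) (tau0 : tau != 0).
Hypothesis kap_c : act (b ^+ 2)%g kap = kap.
Hypothesis kap_h : forall u, act u (norm_h kap) = norm_h kap.
Hypotheses (tau_a : act a tau = tau) (tau_beta : act beta tau = tau).

(** The exponents exploit [n * n - 4 * q = 1]: multiplying [cocW] by [norm_c (U * kap) ^+ n] leaves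
    just [kap], up to a power of [norm_h kap]. *)
Definition cocW := (norm_c U ^+ n * (kap ^+ 4 / norm_h kap) ^+ q)^-1.
Definition cocB1 := (kap * act beta kap) ^+ (2 * q) / B ^+ n.
(** The factor [norm_h U ^+ q] raises the exponent of [norm_h U] in the norm of [cocX] to
    [1 + 4 * q = n * n]. *)
Definition cocX := U * kap * norm_h U ^+ q * tau.
(** [cocE] and, up to a power of [norm_c' tau], [cocJ] are the second monomials of the two
    unimodular systems solved in [cocycle_recover]. *)
Definition cocE := norm_h kap ^+ q * norm_c' tau ^+ n.
Definition cocJ := norm_h U ^+ (q * (n * n).+1) * (tau ^+ n / norm_c' tau) ^+ n.

Local Notation W := cocW.
Local Notation B1 := cocB1.
Local Notation nu := (norm_h kap).
Local Notation rho := (norm_h U).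

Lemma nu_neq0 : nu != 0. Proof. exact: norm_h_neq0. Qed.
Lemma rho_neq0 : rho != 0. Proof. exact/norm_h_neq0/cocU_neq0. Qed.

Lemma cocW_neq0 : W != 0.
Proof.
rewrite invr_neq0 // mulf_neq0 ?expf_neq0 ?norm_c_neq0 ?cocU_neq0 //.
by rewrite mulf_neq0 ?expf_neq0 // invr_neq0 // nu_neq0.
Qed.

Lemma cocB1_neq0 : B1 != 0.
Proof.
by rewrite mulf_neq0 ?invr_neq0 ?expf_neq0 ?cocB_neq0 // mulf_neq0 ?fmorph_eq0.
Qed.

Lemma act_beta_cocB1 : act beta B1 = B1.
Proof.
rewrite /B1 fmorph_div !rmorphXn rmorphM act_beta act_bX_cocB.
by rewrite [_ * kap]mulrC.
Qed.

(** Here [norm_c] becomes [norm_b], with [norm_b U = act a B / B], and the powers of [kap] combine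
    into the square of the quotient of [kap * act beta kap] by its conjugate under [a]. *)
Lemma cocW_beta : W * act beta W = act a B1 / B1.
Proof.
rewrite /W fmorphV rmorphM !rmorphXn -invfM mulrACA -!exprMn.
rewrite norm_c_beta norm_b_cocU fmorph_div rmorphXn kap_h.
set P := kap * act beta kap.
have -> : kap ^+ 4 / nu * (act beta kap ^+ 4 / nu) = (P / act a P) ^+ 2.
  rewrite /norm_h /P !rmorphM [act beta (act a _)]actC.
  by field; rewrite !fmorph_eq0 kap0.
have P0 : P != 0 by rewrite mulf_neq0 ?fmorph_eq0.
rewrite /B1 -/P fmorph_div !rmorphXn -exprM !expr_div_n.
by field; rewrite !expf_neq0 ?fmorph_eq0 ?cocB_neq0 ?P0.
Qed.

Lemma norm_c_kap : norm_c kap = kap ^+ n.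
Proof.
rewrite /norm_c (eq_bigr (fun=> kap)) ?prodr_const ?card_ord // => i _.
elim: (nat_of_ord i) => [|j IHj]; first by rewrite muln0 expg0 act1.
by rewrite mulnSr expgD actM kap_c.
Qed.

Lemma act_rho : act a rho = rho /\ act beta rho = rho.
Proof.
have [Ca Cb] := act_cocC.
split; first by rewrite norm_h_cocU fmorph_div [act a (act b _)]actC Ca.
by rewrite norm_h_cocU fmorph_div [act beta (act b _)]actC Cb.
Qed.

Lemma norm_h_fixed f : act a f = f -> act beta f = f -> norm_h f = f ^+ 4.
Proof. by move=> fa fb; rewrite /norm_h rmorphM fa fb; ring. Qed.

Lemma norm_h_cocX : norm_h cocX = rho ^+ (n * n) * tau ^+ 4 * nu.
Proof.
have [ra rb] := act_rho.
rewrite /cocX (norm_hM _ tau) (norm_hM _ (rho ^+ q)) (norm_hM U kap) norm_hX.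
rewrite (norm_h_fixed ra rb) (norm_h_fixed tau_a tau_beta).
by rewrite -exprM [(4 * q)%N]mulnC nq [rho ^+ (_ * _).+1]exprS; ring.
Qed.

(** [rho] is [cocC / act b cocC], so the product telescopes to [cocC / act beta cocC], and [beta]
    fixes [cocC]. *)
Lemma norm_c'_rho : norm_c' rho = 1.
Proof.
have [_ Cb] := act_cocC.
rewrite /norm_c' norm_h_cocU.
have -> : \prod_(i < n) act (b ^+ i)%g (cocC / act b cocC) =
    cocC / act beta cocC.
  rewrite /beta; elim: n => [|m IHm].
    by rewrite big_ord0 expg0 act1 mulfV ?cocC_neq0.
  rewrite big_ord_recr /= IHm fmorph_div -actM -expgSr mulrA divfK //.
  by rewrite fmorph_eq0 cocC_neq0.
by rewrite Cb mulfV ?cocC_neq0.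
Qed.

Lemma norm_c'_norm_h_cocX :
  norm_c' (norm_h cocX) = nu ^+ n * norm_c' tau ^+ 4.
Proof.
rewrite norm_h_cocX (norm_c'M _ nu) (norm_c'M (rho ^+ _)) !norm_c'X.
rewrite norm_c'_rho expr1n mul1r mulrC.
congr (_ * _); rewrite /norm_c' (eq_bigr (fun=> nu)) ?prodr_const ?card_ord //.
Qed.

Section StableSubfield.

Variable T : divringClosed E.
Hypothesis T_act : forall u f, f \in T -> act u f \in T.

Lemma norm_h_stable f : f \in T -> norm_h f \in T.
Proof. by move=> Tf; rewrite /norm_h !(rpredM, T_act). Qed.

Lemma norm_c_stable f : f \in T -> norm_c f \in T.
Proof. by move=> Tf; apply: rpred_prod => i _; apply: T_act. Qed.

Lemma norm_c'_stable f : f \in T -> norm_c' f \in T.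
Proof. by move=> Tf; apply: rpred_prod => i _; apply: T_act. Qed.

Lemma norm_b_stable f : f \in T -> norm_b f \in T.
Proof. by move=> Tf; apply: rpred_prod => i _; apply: T_act. Qed.

(* The exponents form two unimodular 2x2 matrices: (n, 4; q, n) for
   (nu, norm_c' tau) and (n^2, 4; q (n^2 + 1), n^2) for (rho, tau). *)
Lemma cocycle_recover :
  cocW \in T -> cocX \in T -> cocE \in T -> cocJ \in T ->
  [/\ U \in T, kap \in T & tau \in T].
Proof.
move=> TW TX TE TJ.
have Txi := norm_h_stable TX.
have nt0 := norm_c'_neq0 tau0.
have [] := @unimodular_mem _ T nu (norm_c' tau) n q 4 n nu_neq0 nt0 nq.
- by rewrite -norm_c'_norm_h_cocX norm_c'_stable.
- exact: TE.
move=> Tnu Tnt.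
have [] := @unimodular_mem _ T rho tau (n * n) (q * (n * n).+1) 4 (n * n)
  rho_neq0 tau0.
- by rewrite nq; nia.
- suff -> : rho ^+ (n * n) * tau ^+ 4 = norm_h cocX / nu by apply: rpred_div.
  by rewrite norm_h_cocX mulfK ?nu_neq0.
- suff -> : rho ^+ (q * (n * n).+1) * tau ^+ (n * n) =
      cocJ * norm_c' tau ^+ n by apply: rpredM => //; apply: rpredX.
  by rewrite /cocJ expr_div_n -exprM -mulrA divfK ?expf_neq0.
move=> Trho Ttau.
have Tmu : U * kap \in T.
  have -> : U * kap = cocX / (rho ^+ q * tau).
    by rewrite /cocX -(mulrA (U * kap)) mulfK // mulf_neq0 ?expf_neq0 ?rho_neq0.
  by apply: rpred_div => //; apply: rpredM => //; apply: rpredX.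
have Tkap : kap \in T.
  suff -> : kap = W * norm_c (U * kap) ^+ n / nu ^+ q.
    apply: rpred_div; last exact: rpredX.
    by apply: rpredM => //; apply/rpredX/norm_c_stable.
  have key (c k v : E) : c != 0 -> k != 0 -> v != 0 ->
      k = (c ^+ n * (k ^+ 4 / v) ^+ q)^-1 * (c * k ^+ n) ^+ n / v ^+ q.
    move=> c0 k0 v0; rewrite [(c * _) ^+ n]exprMn -[(k ^+ n) ^+ n]exprM nq.
    rewrite [k ^+ (_ * _).+1]exprSr.
    rewrite expr_div_n -exprM [(4 * q)%N]mulnC.
    by field; rewrite !expf_neq0.
  rewrite norm_cM norm_c_kap; apply: key => //; last exact: nu_neq0.
  exact/norm_c_neq0/cocU_neq0.
split=> //; suff -> : U = U * kap / kap by apply: rpred_div.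
by rewrite mulfK.
Qed.

(** The cocycle rule expresses the value at [v * v'] by those at [v] and [v'], so the generators
    suffice. *)
Lemma cocycle_stable f : f != 0 ->
  act a f / f \in T -> act b f / f \in T -> forall u, act u f / f \in T.
Proof.
move=> f0 Ta Tb u; have [i [j ->]] := ab_generate u.
have step v v' : act v f / f \in T -> act v' f / f \in T ->
    act (v * v')%g f / f \in T.
  move=> Tv Tv'; suff -> : act (v * v')%g f / f = act v (act v' f / f) * (act v f / f).
    by rewrite rpredM ?T_act.
  by rewrite fmorph_div actM mulrA divfK // fmorph_eq0.
have one : act 1%g f / f \in T by rewrite act1 mulfV ?rpred1.
apply: (step); first by elim: i => [|i IHi]; rewrite ?expg0 // expgS step.
by elim: j => [|j IHj]; rewrite ?expg0 // expgS step.
Qed.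

Lemma cocA_cocycle : U \in T -> forall u, act u A / A \in T.
Proof.
move=> TU; apply: cocycle_stable; first exact: cocA_neq0.
  by rewrite act_a_cocA mulfV ?rpred1 ?cocA_neq0.
rewrite act_b_cocA mulrAC mulfV ?cocA_neq0 // mul1r rpredV.
by rewrite rpredM ?T_act.
Qed.

Lemma cocB_cocycle : U \in T -> forall u, act u B / B \in T.
Proof.
move=> TU; apply: cocycle_stable; first exact: cocB_neq0.
  by rewrite -norm_b_cocU norm_b_stable.
by rewrite act_b_cocB mulfV ?rpred1 ?cocB_neq0.
Qed.

End StableSubfield.

End Elements.

End CocycleAlgebra.

(** * The norm equation over the Klein four group *)

Section KleinFour.

Variables (E : fieldType) (fa fb : {rmorphism E -> E}) (s r W p : E).
Hypotheses (faK : forall f, fa (fa f) = f) (fbK : forall f, fb (fb f) = f).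
Hypothesis fabC : forall f, fa (fb f) = fb (fa f).
Hypotheses (fa_s : fa s = - s) (fb_s : fb s = s).
Hypotheses (fa_r : fa r = r) (fb_r : fb r = - r).
Hypotheses (s0 : s != 0) (r0 : r != 0) (two0 : 2%:R != 0 :> E).
Hypotheses (W0 : W != 0) (p_neq0 : p != 0) (fb_p : fb p = p).
Hypothesis W_norm : W * fb W = p / fa p.

Definition klQ := p / W.
Local Notation Q := klQ.

(** Coordinates of [klQ] along 1, s, r, rs over the field fixed by [fa] and [fb], by averaging with
    signs; likewise [klp0] and [klp1] for [p] along 1, s. *)
Definition klx := (Q + fa Q + fb Q + fa (fb Q)) / 4%:R.
Definition kly := (Q - fa Q + fb Q - fa (fb Q)) / (4%:R * s).
Definition klz := (Q + fa Q - fb Q - fa (fb Q)) / (4%:R * r).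
Definition klw := (Q - fa Q - fb Q + fa (fb Q)) / (4%:R * (r * s)).
Definition klp0 := (p + fa p) / 2%:R.
Definition klp1 := (p - fa p) / (2%:R * s).

Let four0 : 4%:R != 0 :> E.
Proof. by rewrite (natrM E 2 2) mulf_neq0. Qed.

Lemma klQE : Q = klx + kly * s + klz * r + klw * (r * s).
Proof.
rewrite /klx /kly /klz /klw; field; by rewrite s0 r0 four0.
Qed.

Lemma klpE : p = klp0 + klp1 * s.
Proof. by rewrite /klp0 /klp1; field; rewrite s0 two0. Qed.

Let fa4 : fa 4%:R = 4%:R. Proof. exact: rmorph_nat. Qed.
Let fb4 : fb 4%:R = 4%:R. Proof. exact: rmorph_nat. Qed.

Lemma kl_fa : [/\ fa klx = klx, fa kly = kly, fa klz = klz & fa klw = klw].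
Proof.
rewrite /klx /kly /klz /klw; move: klQ => Q'; split;
  rewrite fmorph_div ?[fa (_ * _)]rmorphM ?[fa (_ * _)]rmorphM fa4 ?fa_s ?fa_r
    !(rmorphB, rmorphD, rmorphN) /= !faK;
  by field; rewrite ?oppr_eq0 ?s0 ?r0 ?four0.
Qed.

Lemma kl_fb : [/\ fb klx = klx, fb kly = kly, fb klz = klz & fb klw = klw].
Proof.
rewrite /klx /kly /klz /klw; move: klQ => Q'; split;
  rewrite fmorph_div ?[fb (_ * _)]rmorphM ?[fb (_ * _)]rmorphM fb4 ?fb_s ?fb_r
    !(rmorphB, rmorphD, rmorphN) /= -!fabC !fbK;
  by field; rewrite ?oppr_eq0 ?s0 ?r0 ?four0.
Qed.

Lemma klp_fa : fa klp0 = klp0 /\ fa klp1 = klp1.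
Proof.
rewrite /klp0 /klp1; split; rewrite fmorph_div ?[fa (_ * _)]rmorphM rmorph_nat
  ?fa_s !(rmorphB, rmorphD) faK; by field; rewrite ?oppr_eq0 ?s0 ?two0.
Qed.

Lemma klp_fb : fb klp0 = klp0 /\ fb klp1 = klp1.
Proof.
rewrite /klp0 /klp1; split; rewrite fmorph_div ?[fb (_ * _)]rmorphM rmorph_nat
  ?fb_s !(rmorphB, rmorphD) -fabC fb_p //.
Qed.

(** Meant for [g] the action of [b ^+ 2], which together with [a] and [beta] generates the group. *)
Lemma kl_fix (g : {rmorphism E -> E}) :
  (forall f, g (fa f) = fa (g f)) -> (forall f, g (fb f) = fb (g f)) ->
  g s = s -> g r = r -> g W = W -> g p = p ->
  [/\ g klx = klx, g kly = kly, g klz = klz & g klw = klw] /\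
  g klp0 = klp0 /\ g klp1 = klp1.
Proof.
move=> gfa gfb gs gr gW gp.
have gQ : g klQ = klQ by rewrite /klQ fmorph_div gW gp.
have g4 m : g m%:R = m%:R by apply: rmorph_nat.
rewrite /klx /kly /klz /klw /klp0 /klp1; move: klQ gQ => Q' gQ.
split; [split|split];
  rewrite fmorph_div ?[g (_ * _)]rmorphM ?[g (_ * _)]rmorphM g4 ?gs ?gr
    !(rmorphB, rmorphD, rmorphN) /= ?gfa ?gfb ?gQ ?gp; congr (_ / _);
  by rewrite ?gfa ?gfb ?gQ ?gp.
Qed.

Let fap0 : fa p != 0. Proof. by rewrite fmorph_eq0. Qed.
Let fbW0 : fb W != 0. Proof. by rewrite fmorph_eq0. Qed.
Let faW0 : fa W != 0. Proof. by rewrite fmorph_eq0. Qed.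

Lemma klQ_norm : Q * fb Q = p * fa p.
Proof.
rewrite /Q fmorph_div fb_p mulf_div W_norm.
by field; rewrite fap0 p_neq0.
Qed.

Lemma kl_equations : klx * kly = r ^+ 2 * (klz * klw) /\
  s ^+ 2 * (kly ^+ 2 - r ^+ 2 * klw ^+ 2 + klp1 ^+ 2) =
  klp0 ^+ 2 - klx ^+ 2 + r ^+ 2 * klz ^+ 2.
Proof.
move: kl_fa kl_fb klp_fa klQE klpE klQ_norm.
move: klQ klx kly klz klw klp0 klp1 => Q' x y z w u v.
move=> [ax ay az aw] [bx by_ bz bw] [au av] QE pE.
have -> : fb Q' = x + y * s - z * r - w * (r * s).
  rewrite QE !rmorphD !rmorphM bx by_ bz bw fb_s fb_r /=.
  by rewrite !(mulrN, mulNr).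
have -> : fa p = u - v * s by rewrite pE rmorphD rmorphM au av fa_s mulrN.
rewrite QE pE => eq1.
have := congr1 fa eq1; rewrite !(rmorphD, rmorphM, rmorphN) ax ay az aw au av.
rewrite /= fa_s fa_r => eq2.
move/eqP: eq1; rewrite -subr_eq0 => /eqP eq1.
move/eqP: eq2; rewrite -subr_eq0 => /eqP eq2.
split; apply/eqP; rewrite -subr_eq0.
  have two_s0 : 4%:R * s != 0 by rewrite mulf_neq0.
  rewrite -(mulrI_eq0 _ (mulfI two_s0)) -[X in _ == X]subr0.
  by rewrite -[X in _ == X - _]eq1 -eq2; apply/eqP; ring.
rewrite -(mulrI_eq0 _ (mulfI two0)) -[X in _ == X]addr0.
by rewrite -[X in _ == X + _]eq1 -eq2; apply/eqP; ring.
Qed.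

(** Up to nonzero factors and the norm relations, each quantity is a product of two differences, and
    the vanishing of a difference forces one of the excluded coincidences for [W]. *)
Lemma kl_neq0 : fa W != W -> (W * fa W) ^+ 2 != 1 -> (fb W * fa W) ^+ 2 != 1 ->
  klz * klw != 0 /\ kly ^+ 2 - r ^+ 2 * klw ^+ 2 + klp1 ^+ 2 != 0.
Proof.
move=> WW WaW bWaW.
have Q0 : Q != 0 by rewrite mulf_neq0 ?invr_neq0.
have fbpE : p = W * fb W * fa p by rewrite W_norm divfK.
have Q12 : Q = fb W * fa W * fa Q.
  rewrite /Q fmorph_div {1}fbpE; by field; rewrite W0 faW0.
have Q32 : fb Q = W * fa W * fa Q.
  rewrite /Q !fmorph_div fb_p {1}fbpE; by field; rewrite fbW0 faW0.
have Q13 : Q * fb Q = fa Q * fa (fb Q).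
  by rewrite -rmorphM klQ_norm rmorphM faK mulrC.
have faQ0 : fa Q != 0 by rewrite fmorph_eq0.
split.
  apply/eqP => zw0.
  have : (Q ^+ 2 - fa Q ^+ 2) * (fa Q ^+ 2 - fb Q ^+ 2) = 0.
    transitivity (fa Q ^+ 2 * (16%:R * (r ^+ 2 * s) * (klz * klw)) +
        (fa Q * fa (fb Q) - Q * fb Q) * (fa Q * fa (fb Q) + Q * fb Q)
        + 2%:R * fa Q ^+ 2 * (Q * fb Q - fa Q * fa (fb Q))).
      by rewrite /klz /klw; field; rewrite s0 r0 four0.
    by rewrite zw0 Q13 subrr !mul0r !mulr0 !addr0.
  move/eqP; rewrite mulf_eq0 !subr_eq0 => /orP[] /eqP QQ.
    case/eqP: bWaW; apply: (mulIf (expf_neq0 2 faQ0)).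
    by rewrite -exprMn -Q12 mul1r.
  case/eqP: WaW; apply: (mulIf (expf_neq0 2 faQ0)).
  by rewrite -exprMn -Q32 mul1r.
apply/eqP => D0.
have : (p * fa Q - fa p * Q) * (p * Q - fa p * fa Q) = 0.
  transitivity (Q * fa Q * (4%:R * s ^+ 2 *
      (kly ^+ 2 - r ^+ 2 * klw ^+ 2 + klp1 ^+ 2)) +
      Q ^+ 2 * (fa Q * fa (fb Q) - p * fa p) +
      fa Q ^+ 2 * (Q * fb Q - p * fa p)
      + Q * fa Q * (2%:R * p * fa p - Q * fb Q - fa Q * fa (fb Q))).
    by rewrite /kly /klw /klp1; field; rewrite s0 r0 four0 two0.
  by rewrite D0 -Q13 klQ_norm; ring.
have Wn4 : W * fb W * (fa W * fa (fb W)) = 1.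
  by rewrite -[fa W * _]rmorphM W_norm fmorph_div faK; field; rewrite p_neq0 fap0.
move/eqP; rewrite mulf_eq0 !subr_eq0 => /orP[] /eqP.
  rewrite {1}fbpE [X in _ = _ * X]Q12 => H; case/eqP: WW.
  have /mulfI : fb W * fa p * fa Q != 0 by rewrite !mulf_neq0.
  by apply; transitivity (fa p * (fb W * fa W * fa Q)); [ring|rewrite -H; ring].
rewrite {1}fbpE {1}Q12 => H.
have {}H : W * fb W * (fb W * fa W) = 1.
  have /mulIf : fa p * fa Q != 0 by rewrite mulf_neq0.
  by apply; rewrite mul1r -[RHS]H; ring.
have bW : fb W = fa (fb W).
  have /mulfI : W * fb W * fa W != 0 by rewrite !mulf_neq0.
  by apply; rewrite -[RHS]mulrA Wn4 -H; ring.
by case/eqP: WW; rewrite -[W in RHS]fbK [in RHS]bW -fabC fbK.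
Qed.

(** The first equation is linear in [r ^+ 2], and the second one then in [s ^+ 2]. *)
Lemma klein_recover (T : divringClosed E) : klz * klw != 0 ->
  kly ^+ 2 - r ^+ 2 * klw ^+ 2 + klp1 ^+ 2 != 0 ->
  [/\ klx \in T, kly \in T, klz \in T & klw \in T] ->
  klp0 \in T -> klp1 \in T -> r ^+ 2 \in T /\ s ^+ 2 \in T.
Proof.
move=> zw0 D0 [Tx Ty Tz Tw] Tp0 Tp1; have [e1 e2] := kl_equations.
have Tr : r ^+ 2 \in T.
  by rewrite -[r ^+ 2](mulfK zw0) -e1; apply: rpred_div; apply: rpredM.
split=> //; rewrite -[s ^+ 2](mulfK D0) e2.
have Tsq c : c \in T -> c ^+ 2 \in T by move=> Tc; apply: rpredX.
have Trsq c : c \in T -> r ^+ 2 * c ^+ 2 \in T.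
  by move=> Tc; apply: rpredM => //; apply: Tsq.
apply: rpred_div; apply: rpredD; [| |apply: rpredB|]; try exact: Trsq; try exact: Tsq.
by apply: rpredB; apply: Tsq.
Qed.

Lemma klein_mem (T : divringClosed E) :
  [/\ klx \in T, kly \in T, klz \in T & klw \in T] ->
  klp0 \in T -> klp1 \in T -> s \in T -> r \in T -> p \in T /\ W \in T.
Proof.
move=> [Tx Ty Tz Tw] Tp0 Tp1 Ts Tr.
have Tp : p \in T by rewrite klpE; apply: rpredD => //; apply: rpredM.
have TQ : Q \in T.
  rewrite klQE; apply: rpredD; last by do 2!apply: rpredM => //.
  by apply: rpredD; [apply: rpredD => //|]; apply: rpredM.
split=> //; suff -> : W = p / Q by apply: rpred_div.
by rewrite /Q invf_div mulrCA mulfV ?mulr1.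
Qed.

End KleinFour.

(** * The Kummer characters s, r, t *)

Section KummerCharacters.

Variables (E : fieldType) (gT : finGroupType) (act : gT -> {rmorphism E -> E}).
Hypothesis act1 : forall f, act 1%g f = f.
Hypothesis actM : forall u v f, act (u * v)%g f = act u (act v f).

Variables (a b : gT) (n : nat).
Hypothesis aa : (a * a = 1)%g.
Hypothesis b_order : (b ^+ (2 * n) = 1)%g.
Hypothesis ab_generate : forall u : gT, exists i j, u = (a ^+ i * b ^+ j)%g.
Hypothesis odd_n : odd n.
Hypothesis card_gT : #|gT| = (4 * n)%N.
Hypothesis card_neq0 : #|gT|%:R != 0 :> E.

Variables s r t w : E.
Hypotheses (s0 : s != 0) (r0 : r != 0) (t0 : t != 0).
Hypotheses (a_s : act a s = - s) (b_s : act b s = s).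
Hypotheses (a_r : act a r = r) (b_r : act b r = - r).
Hypotheses (a_t : act a t = t) (b_t : act b t = w * t).
Hypotheses (w_prim : n.-primitive_root w) (w_inv : invariant act w).

Lemma odd_gt0n : (0 < n)%N. Proof. exact: odd_gt0. Qed.

Definition kum_index := ('I_2 * 'I_2 * 'I_n)%type.
Definition kum_index0 : kum_index := (ord0, ord0, Ordinal odd_gt0n).
Definition kum_th (i : kum_index) := s ^+ i.1.1 * r ^+ i.1.2 * t ^+ i.2.
Definition kum_chi (i : kum_index) u := act u (kum_th i) / kum_th i.

Lemma kum_th_neq0 i : kum_th i != 0.
Proof. by rewrite /kum_th !mulf_neq0 ?expf_neq0. Qed.

Lemma kum_th0 : kum_th kum_index0 = 1.
Proof. by rewrite /kum_th /= !expr0 !mulr1. Qed.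

Lemma act_kum_th i u : act u (kum_th i) = kum_chi i u * kum_th i.
Proof. by rewrite divfK ?kum_th_neq0. Qed.

Lemma kum_card : #|{: kum_index}| = #|gT|.
Proof. by rewrite !card_prod !card_ord card_gT. Qed.

Lemma kum_two_neq0 : 2%:R != 0 :> E.
Proof.
apply: contraNneq card_neq0 => two0.
by rewrite card_gT natrM -[4%N]/(2 * 2)%N natrM two0 !mul0r.
Qed.

Lemma act_str i j : let u := (a ^+ i * b ^+ j)%g in
  [/\ act u s = (-1) ^+ i * s, act u r = (-1) ^+ j * r & act u t = w ^+ j * t].
Proof.
move=> u; rewrite /u {u}; elim: i => [|i [IHs IHr IHt]]; last first.
  split; rewrite expgS -mulgA actM ?IHs ?IHr ?IHt rmorphM rmorphXn.
  - by rewrite rmorphN1 a_s exprSr !mulrN mulr1 mulNr.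
  - by rewrite rmorphN1 a_r.
  - by rewrite w_inv a_t.
elim: j => [|j [IHs IHr IHt]].
  by rewrite !expg0 mulg1 !act1 !expr0 !mul1r.
have e : (a ^+ 0 * b ^+ j.+1 = b * (a ^+ 0 * b ^+ j))%g.
  by rewrite !expg0 !mul1g expgS.
split; rewrite e actM ?IHs ?IHr ?IHt rmorphM rmorphXn.
- by rewrite rmorphN1 b_s.
- by rewrite rmorphN1 b_r exprSr !mulrN mulr1 mulNr.
- by rewrite w_inv b_t exprSr mulrA.
Qed.

Lemma act_monomial i j A B C : let u := (a ^+ i * b ^+ j)%g in
  act u (s ^+ A * r ^+ B * t ^+ C) =
  (-1) ^+ (i * A) * (-1) ^+ (j * B) * w ^+ (j * C) * (s ^+ A * r ^+ B * t ^+ C).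
Proof.
move=> u; have [us ur ut] := act_str i j.
rewrite !rmorphM !rmorphXn us ur ut !exprMn -!exprM; ring.
Qed.

Lemma kum_chiE i j (k : kum_index) : kum_chi k (a ^+ i * b ^+ j)%g =
  (-1) ^+ (i * k.1.1) * (-1) ^+ (j * k.1.2) * w ^+ (j * k.2).
Proof. by rewrite /kum_chi act_monomial mulfK ?kum_th_neq0. Qed.

Lemma odd_sum_expN1 i : odd i -> \sum_(k < 2) (((-1) ^+ (i * k))^-1 : E) = 0.
Proof.
move=> oi; have Ni : (-1) ^+ i = -1 :> E by rewrite -signr_odd oi expr1.
by rewrite !big_ord_recl big_ord0 muln0 muln1 Ni expr0 invrN1 invr1 addr0 subrr.
Qed.

(** The sum is a product of three geometric sums. If none vanishes, [i] and [j] are even and [n]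
    divides [j]; as [n] is odd, [2 * n] divides [j] and the element is trivial. *)
Lemma kum_chi_orthogonal u : u != 1%g -> \sum_k (kum_chi k u)^-1 = 0.
Proof.
have [i [j ->]] := ab_generate u => ij1.
have -> : \sum_k (kum_chi k (a ^+ i * b ^+ j)%g)^-1 =
    (\sum_(k < 2) ((-1) ^+ (i * k))^-1) * (\sum_(k < 2) ((-1) ^+ (j * k))^-1)
    * (\sum_(k < n) (w ^+ (j * k))^-1).
  rewrite big_distrlr /= pair_bigA /= big_distrlr /= pair_bigA /=.
  by apply: eq_bigr => k _; rewrite kum_chiE !invfM.
have [oi|ei] := boolP (odd i); first by rewrite odd_sum_expN1 // !mul0r.
have [oj|ej] := boolP (odd j).
  by rewrite (odd_sum_expN1 oj) mulr0 mul0r.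
have [wj|wj] := eqVneq (w ^+ j) 1.
  case/eqP: ij1; have -> : (a ^+ i = 1)%g.
    by rewrite -(even_halfK ei) -mul2n expgM expgS expg1 aa expg1n.
  have /dvdnP [l ->] : (2 * n %| j)%N.
    rewrite Gauss_dvd ?coprime2n // dvdn2 ej /=.
    by rewrite (prim_order_dvd w_prim) wj eqxx.
  by rewrite mulnC expgM b_order expg1n mulg1.
suff -> : \sum_(k < n) (w ^+ (j * k))^-1 = 0 by rewrite mulr0.
have wj' : (w ^+ j)^-1 - 1 != 0 by rewrite subr_eq0 invr_eq1.
apply: (mulfI wj'); rewrite mulr0.
under eq_bigr do rewrite exprM -exprVn.
rewrite -subrX1 exprVn -exprM mulnC exprM (prim_expr_order w_prim).
by rewrite expr1n invr1 subrr.
Qed.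

Local Notation average := (average act).

(** A monomial on which [a], [b ^+ n] or [b] acts by a scalar other than 1 averages to 0; any other
    is a product of powers of [s ^+ 2], [r ^+ 2], [t ^+ n], hence its own average. *)
Lemma kum_average (S : divringClosed E) A B C :
  s ^+ 2 \in S -> r ^+ 2 \in S -> t ^+ n \in S ->
  (forall f, f \in S -> invariant act f) ->
  average (s ^+ A * r ^+ B * t ^+ C) \in S.
Proof.
move=> Ss Sr St Sinv; set m := _ * _.
have N1 : (-1 : E) != 1.
  by rewrite -subr_eq0 -opprD oppr_eq0 -(natrD _ 1 1) kum_two_neq0.
have N1inv : invariant act (-1) by move=> u; rewrite rmorphN1.
have [oA|eA] := boolP (odd A).
  rewrite (@average_eigen _ _ _ actM (-1) a) ?rpred0 //.
  have := act_monomial 1 0 A B C; rewrite expg1 expg0 mulg1 mul1n !mul0n !expr0.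
  by rewrite !mulr1 -signr_odd oA expr1.
have [oB|eB] := boolP (odd B).
  rewrite (@average_eigen _ _ _ actM (-1) (b ^+ n)%g) ?rpred0 //.
  have := act_monomial 0 n A B C; rewrite expg0 mul1g mul0n expr0.
  rewrite mul1r -signr_odd oddM odd_n oB expr1 exprM (prim_expr_order w_prim).
  by rewrite expr1n mulr1.
have [wC|wC] := eqVneq (w ^+ C) 1; last first.
  rewrite (@average_eigen _ _ _ actM (w ^+ C) b) ?rpred0 //.
    have := act_monomial 0 1 A B C; rewrite expg0 mul1g expg1 mul0n expr0 !mul1n.
    by rewrite mul1r -signr_odd (negbTE eB) expr0 mul1r.
  by move=> u; rewrite rmorphXn w_inv.
have Sm : m \in S.
  rewrite /m; have /dvdnP [l ->] : (n %| C)%N by rewrite (prim_order_dvd w_prim) wC.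
  rewrite -(even_halfK eA) -(even_halfK eB) -!mul2n [(l * n)%N]mulnC !exprM.
  by apply: rpredM; [apply: rpredM|]; apply: rpredX.
by rewrite average_id //; apply: Sinv.
Qed.

Lemma kum_base (S : divringClosed E) :
  (forall f, f \in S -> invariant act f) -> w \in S ->
  s ^+ 2 \in S -> r ^+ 2 \in S -> t ^+ n \in S ->
  kummer_base act kum_th kum_chi S.
Proof.
move=> Sinv Sw Ss Sr St; split=> // [i u|i j k].
  have [l [m ->]] := ab_generate u; rewrite kum_chiE.
  apply: rpredM; last exact: rpredX.
  by apply: rpredM; apply: rpredX; rewrite rpredN1.
(* [c] trades the denominator [kum_th k] for a monomial with nonnegative exponents, to which
   [kum_average] applies. *)
pose c := (s ^+ 2) ^+ k.1.1 * (r ^+ 2) ^+ k.1.2 * (t ^+ n) ^+ k.2.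
have Sc : c \in S by apply: rpredM; [apply: rpredM|]; apply: rpredX.
have -> : kum_th i * kum_th j / kum_th k =
    c^-1 * (s ^+ (i.1.1 + j.1.1 + k.1.1) * r ^+ (i.1.2 + j.1.2 + k.1.2) *
            t ^+ (i.2 + j.2 + n.-1 * k.2)).
  have tn : t ^+ n = t ^+ n.-1 * t by rewrite -exprSr prednK // odd_gt0n.
  rewrite /c /kum_th tn !exprMn !exprD [t ^+ (_ * k.2)]exprM.
  by field; rewrite !expf_neq0.
rewrite averageMl; last by apply/Sinv; rewrite rpredV.
by apply: rpredM; [rewrite rpredV | apply: kum_average].
Qed.

Lemma kum_coordinate0 f (k : kum_index) : act a f = f -> act (b ^+ n)%g f = f ->
  k.1 != (ord0, ord0) -> coordinate act kum_th k f = 0.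
Proof.
move=> fa fb; rewrite /coordinate.
have N1 : (-1 : E) != 1.
  by rewrite -subr_eq0 -opprD oppr_eq0 -(natrD _ 1 1) kum_two_neq0.
have N1inv : invariant act (-1) by move=> u; rewrite rmorphN1.
have ord2 (i : 'I_2) : i != ord0 -> i = 1 :> nat by case: i => -[|[|]].
case: k => -[i j] l; rewrite -pair_eqE /= negb_and => /orP[/ord2 i1|/ord2 j1].
  apply: (@average_eigen _ _ _ actM (-1) a) => //.
  have := act_monomial 1 0 i j l; rewrite expg1 expg0 mulg1 mul1n !mul0n !expr0.
  rewrite !mulr1 i1 expr1 fmorph_div fa /kum_th /= i1 => ->.
  by rewrite mulN1r invrN mulrN mulN1r.
apply: (@average_eigen _ _ _ actM (-1) (b ^+ n)%g) => //.
have := act_monomial 0 n i j l; rewrite expg0 mul1g mul0n expr0.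
rewrite mul1r j1 muln1 -signr_odd odd_n expr1 exprM (prim_expr_order w_prim).
rewrite expr1n mulr1 fmorph_div fb /kum_th /= j1 => ->.
by rewrite mulN1r invrN mulrN mulN1r.
Qed.

(** For distinct indices some group element multiplies the quotient by an invariant scalar other
    than 1. *)
Lemma coordinate_kum_th (i j : kum_index) :
  coordinate act kum_th i (kum_th j) = (i == j)%:R.
Proof.
have [->|ij] := eqVneq i j.
  rewrite /coordinate mulfV ?kum_th_neq0 // average_id //.
  by move=> u; rewrite rmorph1.
pose c u := kum_chi j u / kum_chi i u.
have ract u : act u (kum_th j / kum_th i) = c u * (kum_th j / kum_th i).
  by rewrite fmorph_div !act_kum_th mulf_div.
have cE l m : c (a ^+ l * b ^+ m)%g =
    ((-1) ^+ (l * j.1.1) * (-1) ^+ (m * j.1.2) * w ^+ (m * j.2)) /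
    ((-1) ^+ (l * i.1.1) * (-1) ^+ (m * i.1.2) * w ^+ (m * i.2)).
  by rewrite /c !kum_chiE.
have w0 : w != 0.
  by apply: contra_eq_neq (prim_expr_order w_prim) => ->;
    rewrite expr0n (gtn_eqF odd_gt0n) eq_sym oner_neq0.
have cI u : invariant act (c u).
  have [l [m ->]] := ab_generate u; rewrite cE => v.
  by rewrite fmorph_div !rmorphM !rmorphXn !rmorphN1 !w_inv.
suff [u cu] : exists u, c u != 1 by apply: average_eigen (ract u) (cI u) cu.
have N1 : (-1 : E) != 1.
  by rewrite -subr_eq0 -opprD oppr_eq0 -(natrD _ 1 1) kum_two_neq0.
have expN1 (k l : 'I_2) : k != l -> (-1 : E) ^+ k / (-1) ^+ l != 1.
  case: k l => -[|[|//]] ? [] [|[|//]] ? //= _;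
  by rewrite ?expr0 ?expr1 ?invrN1 ?invr1 ?mul1r ?mulr1.
have [ij1|ij1] := eqVneq i.1.1 j.1.1; last first.
  exists (a ^+ 1 * b ^+ 0)%g; rewrite cE !mul1n !mul0n !expr0 !mulr1.
  by apply: expN1; rewrite eq_sym.
have [ij2|ij2] := eqVneq i.1.2 j.1.2; last first.
  exists (a ^+ 0 * b ^+ n)%g; rewrite cE !mul0n !expr0 !mul1r.
  rewrite ![w ^+ (n * _)]exprM (prim_expr_order w_prim) !expr1n !mulr1.
  rewrite ![(-1) ^+ (n * _)]exprM -[(-1) ^+ n]signr_odd odd_n expr1.
  by apply: expN1; rewrite eq_sym.
exists (a ^+ 0 * b ^+ 1)%g; rewrite cE !mul0n !expr0 !mul1r !mul1n ij2.
rewrite -mulf_div mulfV ?expf_neq0 ?oppr_eq0 ?oner_eq0 // mul1r.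
apply: contra ij => /eqP/(congr1 (fun f => f * w ^+ i.2)).
rewrite divfK ?expf_neq0 // mul1r => /eqP; rewrite (eq_prim_root_expr w_prim).
rewrite !modn_small // => ij3; move: ij1 ij2 ij3.
by case: i {cE cI ract c} => -[? ?] ?; case: j => -[? ?] ? /= -> -> /eqP/val_inj ->.
Qed.

End KummerCharacters.

(** * Scalars of the generic crossed product *)

Section CenterScalar.

Variables (F : fieldType) (gT : finGroupType) (k : nat).

Local Notation K := (gcp_field F gT k).
Local Notation rk := (@enum_rank gT).

Lemma gcp_center_scalar (A : gcp_center F gT k) : exists b c,
  [/\ c != 0, gcp_R c%:M, gcp_R b%:M & val A = (b / c)%:M :> 'M[K]_#|gT|].
Proof.
have ZA := asboolW (gcp_center_valP A).
exact: (center_scalar (@gcp_R1 F gT k) (@gcp_R_central_scalar F gT k)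
  (gcp_dim_gt0 gT) ZA).
Qed.

(** Central matrices are scalar, so one diagonal entry embeds the center into [K]. *)
Definition gcp_scalar (A : gcp_center F gT k) : K := (val A) (rk 1%g) (rk 1%g).

Lemma gcp_scalarE A : val A = (gcp_scalar A)%:M.
Proof.
have [b [c [_ _ _ AE]]] := gcp_center_scalar A.
by rewrite /gcp_scalar AE !mxE eqxx mulr1n.
Qed.

Lemma gcp_scalar_zmod_morphism : zmod_morphism gcp_scalar.
Proof. by move=> A B; rewrite /gcp_scalar rmorphB !mxE. Qed.

Lemma gcp_scalar_monoid_morphism : monoid_morphism gcp_scalar.
Proof.
split; first by rewrite /gcp_scalar rmorph1 mxE eqxx.
move=> A B; rewrite {1}/gcp_scalar rmorphM.
have -> : val A * val B = (val A *m val B : 'M_#|gT|) by [].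
by rewrite (gcp_scalarE A) (gcp_scalarE B) -scalar_mxM mxE eqxx mulr1n.
Qed.

HB.instance Definition _ := GRing.isZmodMorphism.Build (gcp_center F gT k) K
  gcp_scalar gcp_scalar_zmod_morphism.
HB.instance Definition _ := GRing.isMonoidMorphism.Build (gcp_center F gT k) K
  gcp_scalar gcp_scalar_monoid_morphism.

Lemma gcp_scalar_const c :
  gcp_scalar (gcp_center_const gT k c) = gcp_const gT k c.
Proof. by rewrite /gcp_scalar /= mxE eqxx mulr1n. Qed.

Variables (E : fieldType) (j : {rmorphism K -> E}).
Variable act : gT -> {rmorphism E -> E}.
Hypothesis act1 : forall f, act 1%g f = f.
Hypothesis actM : forall u v f, act (u * v)%g f = act u (act v f).

Definition edge i h g : E := j (gcp_var F i h g).

Hypothesis act_edge : forall u i h g,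
  act u (edge i h g) = edge i (u * h)%g (u * g)%g.
Hypothesis act_const : forall u c,
  act u (j (gcp_const gT k c)) = j (gcp_const gT k c).

Lemma edge_neq0 i h g : edge i h g != 0.
Proof. by rewrite fmorph_eq0 gcp_var_neq0. Qed.

Lemma gcp_R_equivariant A u h g : gcp_R A ->
  j (A (rk (u * h)%g) (rk (u * g)%g)) = act u (j (A (rk h) (rk g))).
Proof.
move=> RA; elim: RA h g => {A} [c|v i|A B _ IHA _ IHB|A B _ IHA _ IHB] h g.
- rewrite !mxE !(inj_eq enum_rank_inj) (inj_eq (mulgI u)).
  by case: eqP => _; rewrite ?mulr1n ?mulr0n ?act_const ?rmorph0.
- rewrite !gcp_XE -mulgA (inj_eq (mulgI u)).
  by case: eqP => _; [apply/esym/act_edge|rewrite !rmorph0].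
- by rewrite !mxE !rmorphD IHA IHB.
- rewrite !mxE !rmorph_sum /=.
  rewrite (reindex_inj (inj_comp (inj_comp enum_rank_inj (mulgI u)) enum_val_inj)) /=.
  apply: eq_bigr => l _; rewrite !rmorphM /= IHA IHB.
  by rewrite enum_valK.
Qed.

(* [p] trivializes the grading: conjugation by [diag p] moves the entries of
   [R] into [S]. *)
Lemma gcp_R_entries (S : divringClosed E) (p : gT -> E) A h g :
  (forall g, p g != 0) -> (forall c, j (gcp_const gT k c) \in S) ->
  (forall i h g, edge i h g * p h / p g \in S) ->
  gcp_R A -> j (A (rk h) (rk g)) * p h / p g \in S.
Proof.
move=> p0 SC Sx RA; elim: RA h g => {A} [c|v i|A B _ IHA _ IHB|A B _ IHA _ IHB] h g.
- rewrite mxE (inj_eq enum_rank_inj); case: eqP => [->|_].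
    by rewrite mulr1n mulfK.
  by rewrite mulr0n rmorph0 !mul0r rpred0.
- rewrite gcp_XE; case: eqP => [->|_]; first exact: Sx.
  by rewrite rmorph0 !mul0r rpred0.
- by rewrite mxE rmorphD !mulrDl rpredD.
- rewrite mxE rmorph_sum !mulr_suml; apply: rpred_sum => l _.
  rewrite rmorphM -(enum_valK l); set u := enum_val l.
  have -> : j (A (rk h) (rk u)) * j (B (rk u) (rk g)) * p h / p g =
     (j (A (rk h) (rk u)) * p h / p u) * (j (B (rk u) (rk g)) * p u / p g).
    by field; rewrite !p0.
  by apply: rpredM; [apply: IHA|apply: IHB].
Qed.

Lemma gcp_scalar_in (S : divringClosed E) (p : gT -> E) (A : gcp_center F gT k) :
  (forall g, p g != 0) -> (forall c, j (gcp_const gT k c) \in S) ->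
  (forall i h g, edge i h g * p h / p g \in S) ->
  j (gcp_scalar A) \in S.
Proof.
move=> p0 SC Sx; have [b [c [_ Rc Rb AE]]] := gcp_center_scalar A.
rewrite /gcp_scalar AE mxE eqxx mulr1n fmorph_div.
have entry (d : K) : gcp_R d%:M -> j d \in S.
  move=> Rd; have := gcp_R_entries 1%g 1%g p0 SC Sx Rd.
  by rewrite mxE eqxx mulr1n mulfK.
by apply: rpred_div; apply: entry.
Qed.

Lemma gcp_scalar_invariant A : invariant act (j (gcp_scalar A)).
Proof.
move=> u; have [b [c [_ Rc Rb AE]]] := gcp_center_scalar A.
rewrite /gcp_scalar AE mxE eqxx mulr1n fmorph_div.
have entry (d : K) : gcp_R d%:M -> act u (j d) = j d.
  move=> Rd; have := gcp_R_equivariant u 1%g 1%g Rd.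
  by rewrite !mxE !eqxx !mulr1n => <-.
by rewrite fmorph_div !entry.
Qed.

(** [f] is the coefficient in row 1 of an element of [gcp_D] of degree [g] for the grading by the
    group; equivariance dictates the other rows. *)
Definition homogeneous (g : gT) (f : E) := exists2 A, gcp_D A &
  forall h h', j (A (rk h) (rk h')) = if h' == (h * g)%g then act h f else 0.

Lemma homogeneousM g g' f f' : homogeneous g f -> homogeneous g' f' ->
  homogeneous (g * g')%g (f * act g f').
Proof.
move=> [A DA AE] [B DB BE]; exists (A *m B).
  exact: (central_localizationM (@gcp_R_mul F gT k) (@gcp_R_central_scalar F gT k)
    (gcp_dim_gt0 gT) DA DB).
move=> h h'; rewrite mxE rmorph_sum (bigD1 (rk (h * g)%g)) //= rmorphM AE BE eqxx.
rewrite big1 ?addr0 => [|l]; last first.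
  rewrite -(enum_valK l) (inj_eq enum_rank_inj) rmorphM AE => /negbTE ->.
  by rewrite mul0r.
by rewrite mulgA; case: eqP => _; rewrite ?mulr0 // rmorphM actM.
Qed.

Lemma homogeneousB g f f' : homogeneous g f -> homogeneous g f' ->
  homogeneous g (f - f').
Proof.
move=> [A DA AE] [B DB BE]; exists (A - B).
  exact: (central_localizationB (@gcp_RB F gT k) (@gcp_R_mul F gT k)
    (@gcp_R_central_scalar F gT k) (gcp_dim_gt0 gT) DA DB).
by move=> h h'; rewrite !mxE rmorphB AE BE; case: eqP; rewrite ?subr0 // rmorphB.
Qed.

Lemma homogeneousR g f A : gcp_R A ->
  (forall h h', j (A (rk h) (rk h')) = if h' == (h * g)%g then act h f else 0) ->
  homogeneous g f.
Proof.
move=> RA AE; exists A => //.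
exact: (sub_central_localization (@gcp_R1 F gT k) (@gcp_R_central_scalar F gT k)
  (gcp_dim_gt0 gT) RA).
Qed.

Lemma homogeneous_edge i g : homogeneous g (edge i 1%g g).
Proof.
apply: (homogeneousR (@gcp_R_X F gT k g i)) => h h'.
rewrite gcp_XE; case: eqP => [->|_]; last exact: rmorph0.
by rewrite act_edge mulg1.
Qed.

Lemma homogeneous_const c : homogeneous 1%g (j (gcp_const gT k c)).
Proof.
apply: (homogeneousR (@gcp_R_const F gT k c)) => h h'.
rewrite mxE mulg1 (inj_eq enum_rank_inj) eq_sym; case: eqP => _.
  by rewrite mulr1n act_const.
by rewrite mulr0n rmorph0.
Qed.

Lemma homogeneous1 : homogeneous 1%g 1.
Proof.
by have := homogeneous_const 1; rewrite /gcp_const !rmorph1.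
Qed.

Lemma homogeneous_scalar f : homogeneous 1%g f -> invariant act f ->
  exists A : gcp_center F gT k, j (gcp_scalar A) = f.
Proof.
move=> [A DA AE] fI; pose c := A (rk 1%g) (rk 1%g).
have Ac : A = c%:M.
  apply/matrixP => h h'; rewrite -(enum_valK h) -(enum_valK h') !mxE.
  apply: (fmorph_inj j); rewrite AE mulg1 (inj_eq enum_rank_inj) eq_sym fI.
  case: eqP => _; last by rewrite mulr0n rmorph0.
  by rewrite mulr1n AE mul1g eqxx fI.
have ZA : gcp_ZD A.
  by apply/asboolP; split=> // B _; rewrite Ac scalar_mxC.
by exists (GcpCenter ZA); rewrite /gcp_scalar /= AE mul1g eqxx fI.
Qed.

(** An invariant of degree 1 comes from the center, which is a field. *)
Lemma homogeneous_invV f : homogeneous 1%g f -> invariant act f ->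
  homogeneous 1%g f^-1.
Proof.
move=> Hf fI; have [A AE] := homogeneous_scalar Hf fI.
have [DB _] := asboolW (gcp_center_valP A^-1).
exists (val A^-1) => // h h'.
rewrite gcp_scalarE fmorphV !mxE mulg1 (inj_eq enum_rank_inj) eq_sym.
case: eqP => _; last by rewrite mulr0n rmorph0.
by rewrite mulr1n fmorphV AE fmorphV fI.
Qed.

Variable i0 : 'I_k.

Lemma homogeneous1M f f' : homogeneous 1%g f -> homogeneous 1%g f' ->
  homogeneous 1%g (f * f').
Proof. by move=> /homogeneousM H /H; rewrite mulg1 act1. Qed.

Lemma homogeneous_prod (I : finType) (P : pred I) (f : I -> E) :
  (forall i, P i -> homogeneous 1%g (f i)) ->
  homogeneous 1%g (\prod_(i | P i) f i).
Proof.
by move=> Hf; elim/big_ind: _ => //; [apply: homogeneous1|apply: homogeneous1M].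
Qed.

Let loop v := edge i0 1%g v * edge i0 v 1%g.

Let homogeneous_loop f v : homogeneous 1%g f ->
  homogeneous 1%g (loop v * act v f).
Proof.
move=> Hf; have := homogeneousM (homogeneousM (homogeneous_edge i0 v) Hf)
  (homogeneous_edge i0 v^-1%g).
by rewrite mulg1 mulgV act_edge mulg1 mulgV mulrAC.
Qed.

Let homogeneous_loop1 v : homogeneous 1%g (loop v).
Proof. by have := homogeneous_loop v homogeneous1; rewrite rmorph1 mulr1. Qed.

Let all_loops := \prod_v loop v.

Let loop_neq0 v : loop v != 0.
Proof. by rewrite mulf_neq0 ?edge_neq0. Qed.

(* The closed walk through all the loops at [1] passes through every vertex,
   so its translates are again closed walks through [1]. *)
Let homogeneous_act_all_loops v : homogeneous 1%g (act v all_loops).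
Proof.
rewrite /all_loops (bigD1 v^-1%g) //= rmorphM.
have -> : act v (loop v^-1%g) = loop v.
  by rewrite /loop rmorphM !act_edge !mulg1 mulgV mulrC.
by apply: homogeneous_loop; apply: homogeneous_prod.
Qed.

Let norm_inv f : invariant act (\prod_v act v f).
Proof.
move=> u; rewrite rmorph_prod [RHS](reindex_inj (mulgI u)) /=.
by apply: eq_bigr => v _; rewrite actM.
Qed.

(** [f^-1] is the inverse of the norm of [f], which comes from the center, times the remaining
    translates of [f]. *)
Let homogeneous_V f : (forall v, homogeneous 1%g (act v f)) ->
  homogeneous 1%g f^-1.
Proof.
move=> Hf; have [->|f0] := eqVneq f 0.
  by rewrite invr0 -(subrr 1); exact: homogeneousB homogeneous1 homogeneous1.
have fE : \prod_v act v f = f * \prod_(v | v != 1%g) act v f.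
  by rewrite (bigD1 1%g) //= act1.
have -> : f^-1 = (\prod_v act v f)^-1 * \prod_(v | v != 1%g) act v f.
  rewrite fE invfM -mulrA mulVf ?mulr1 //; apply/prodf_neq0 => v _.
  by rewrite fmorph_eq0.
apply: homogeneous1M; last exact: homogeneous_prod.
by apply: homogeneous_invV (norm_inv f); apply: homogeneous_prod.
Qed.

(** Walking to [v], applying [f] there and walking back gives [loop v * act v f]; the factor
    [loop v] is removed by means of [all_loops], which can be inverted because all its translates
    have degree 1. *)
Lemma homogeneous_act f v : homogeneous 1%g f -> homogeneous 1%g (act v f).
Proof.
move=> Hf; have -> : act v f = (loop v * act v f) *
    (all_loops^-1 * \prod_(u | u != v) loop u).
  rewrite /all_loops (bigD1 v) //= invfM -[_ / _ * _]mulrA mulVf ?mulr1; last first.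
    by apply/prodf_neq0 => u _; apply: loop_neq0.
  by rewrite mulrAC mulfV ?mul1r.
apply: homogeneous1M; first exact: homogeneous_loop.
by apply: homogeneous1M; [apply: homogeneous_V|apply: homogeneous_prod].
Qed.

Definition degree1_pred : pred E := fun f => `[< homogeneous 1%g f >].

Lemma degree1_closed : divring_closed degree1_pred.
Proof.
split=> [|f g /asboolP Hf /asboolP Hg|f g /asboolP Hf /asboolP Hg]; apply/asboolP.
- exact: homogeneous1.
- exact: homogeneousB.
- apply: homogeneous1M => //; apply: homogeneous_V => v.
  exact: homogeneous_act.
Qed.

End CenterScalar.

(** * Path products *)

Section Paths.

Variables (E : fieldType) (gT : finGroupType) (act : gT -> {rmorphism E -> E}).
Hypothesis act1 : forall f, act 1%g f = f.
Hypothesis actM : forall u v f, act (u * v)%g f = act u (act v f).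
Hypothesis mulgCT : forall u v : gT, (u * v = v * u)%g.

Variables (a b : gT) (n : nat).
Hypothesis aa : (a * a = 1)%g.
Hypothesis b_order : (b ^+ (2 * n) = 1)%g.

Variables al be : E.
Hypotheses (al0 : al != 0) (be0 : be != 0).

Local Notation U := (cocU act a b al be).
Local Notation A := (cocA act a al).
Local Notation B := (cocB act b n be).

(* The edges met when walking 1, b, ..., b^y, b^y a^x. *)
Definition path (x : bool) y : E :=
  (\prod_(l < y) act (b ^+ l)%g be) * (if x then act (b ^+ y)%g al else 1).

Lemma path_neq0 x y : path x y != 0.
Proof.
rewrite mulf_neq0 //; last by case: x; rewrite ?oner_eq0 ?fmorph_eq0.
by apply/prodf_neq0 => l _; rewrite fmorph_eq0.
Qed.

Section StableSubfield.

Variable T : divringClosed E.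
Hypothesis T_act : forall u f, f \in T -> act u f \in T.
Hypotheses (TU : U \in T) (TA : A \in T) (TB : B \in T).

(** For [x] true the two walks differ by a translate of the square [U]; for [x] false they
    coincide. *)
Lemma path_be (x : bool) y :
  act (a ^+ x * b ^+ y)%g be * path x y / path x y.+1 \in T.
Proof.
have P0 : \prod_(l < y) act (b ^+ l)%g be != 0.
  by apply/prodf_neq0 => l _; rewrite fmorph_eq0.
rewrite /path big_ord_recr /=; move: P0; set P := \prod_(l < y) _ => P0.
case: x; rewrite /= ?expg0 ?expg1 ?mul1g.
  suff -> : act (a * b ^+ y)%g be * (P * act (b ^+ y)%g al) /
      (P * act (b ^+ y)%g be * act (b ^+ y.+1)%g al) = act (b ^+ y)%g U.
    exact: T_act.
  rewrite /cocU fmorph_div !rmorphM mulgCT expgSr !actM.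
  by field; rewrite !fmorph_eq0 P0 al0 be0.
by rewrite !mulr1 [act _ be * P]mulrC mulfV ?rpred1 // mulf_neq0 ?fmorph_eq0.
Qed.

Lemma path_al (x : bool) y :
  act (a ^+ x * b ^+ y)%g al * path x y / path (~~ x) y \in T.
Proof.
have P0 : \prod_(l < y) act (b ^+ l)%g be != 0.
  by apply/prodf_neq0 => l _; rewrite fmorph_eq0.
rewrite /path; move: P0; set P := \prod_(l < y) _ => P0.
case: x; rewrite /= ?expg0 ?expg1 ?mul1g.
  suff -> : act (a * b ^+ y)%g al * (P * act (b ^+ y)%g al) / (P * 1) =
      act (b ^+ y)%g A by exact: T_act.
  by rewrite /cocA rmorphM mulgCT !actM; field.
by rewrite mulr1 [act _ al * P]mulrC mulfV ?rpred1 // mulf_neq0 ?fmorph_eq0.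
Qed.

Lemma path_period x y : path x (y + 2 * n) / path x y \in T.
Proof.
suff -> : path x (y + 2 * n) = B * path x y by rewrite mulfK ?path_neq0.
have -> : path x (y + 2 * n) = (\prod_(l < y + 2 * n) act (b ^+ l)%g be) *
    (if x then act (b ^+ y)%g al else 1).
  by rewrite /path expgD b_order mulg1.
rewrite mulrA; congr (_ * _); elim: y => [|y IHy].
  by rewrite big_ord0 mulr1.
by rewrite addSn !big_ord_recr /= IHy mulrA expgD b_order mulg1.
Qed.

(** Modulo [T], path products multiply like the group elements, up to translation: append the edges
    along [b] one at a time by [path_be], then the final edge along [a] by [path_al]. *)
Lemma path_cocycle (x x' : bool) y y' :
  act (a ^+ x * b ^+ y)%g (path x' y') * path x y / path (x (+) x') (y + y') \in T.
Proof.
have step : act (a ^+ x * b ^+ y)%g (path false y') * path x y / path x (y + y') \in T.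
  elim: y' => [|y' IHy].
    by rewrite /path big_ord0 mulr1 rmorph1 mul1r addn0 mulfV ?rpred1 // path_neq0.
  have e : act (a ^+ x * b ^+ y)%g (path false y'.+1) =
      act (a ^+ x * b ^+ y)%g (path false y') * act (a ^+ x * b ^+ (y + y'))%g be.
    by rewrite /path big_ord_recr /= !mulr1 rmorphM -actM -mulgA -expgD.
  apply: etrans (rpredM IHy (path_be x (y + y'))); rewrite addnS e.
  by apply: (congr1 (fun f => f \in T)); field; rewrite !path_neq0.
case: x'; last by rewrite addbF.
have e : path true y' = path false y' * act (b ^+ y')%g al.
  by rewrite /path mulr1.
apply: etrans (rpredM step (path_al x (y + y'))).
rewrite addbT e rmorphM -actM -mulgA -expgD.
by apply: (congr1 (fun f => f \in T)); field; rewrite !path_neq0.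
Qed.

End StableSubfield.

Lemma path_graded (hom : gT -> E -> Prop) : hom 1%g 1 ->
  (forall g g' f f', hom g f -> hom g' f' -> hom (g * g')%g (f * act g f')) ->
  hom a al -> hom b be ->
  forall x y, hom (a ^+ (x : bool) * b ^+ y)%g (path x y).
Proof.
move=> h1 hM ha hb x y.
have hy : hom (b ^+ y)%g (\prod_(l < y) act (b ^+ l)%g be).
  elim: y => [|y IHy]; first by rewrite expg0 big_ord0.
  by rewrite big_ord_recr /= expgSr; apply: hM.
case: x; rewrite /path ?expg0 ?mul1g ?mulr1 //.
by rewrite expg1 mulgCT; apply: hM.
Qed.

(** * Genericity of [W], by an endomorphism doubling one edge *)

Section Nonvanishing.

Variable lam : {rmorphism E -> E}.
Hypothesis lam_al : forall u, lam (act u al) = act u al *+ (u == 1%g).+1.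
Hypothesis lam_be : forall u, lam (act u be) = act u be.
Hypothesis b_even : forall i, (0 < i < n)%N -> (b ^+ (2 * i) != 1)%g.
Hypothesis b_odd : forall i, (b ^+ (2 * i).+1 != 1)%g.
Hypothesis ab_neq1 : forall j, (a * b ^+ j != 1)%g.
Hypothesis n_pos : (0 < n)%N.

Lemma lam_cocU u : (u * b != 1)%g ->
  lam (act u U) = act u U *+ (u == 1%g).+1.
Proof.
move=> ub; rewrite /cocU !fmorph_div !rmorphM -!actM !lam_al !lam_be (negbTE ub).
by rewrite mulr1n mulrnAl mulrnAl.
Qed.

(** Translates of [al] by even powers of [b] stand in the numerator and those by odd powers in the
    denominator, so [al] itself occurs exactly once. *)
Lemma lam_norm_c : lam (norm_c act b n U) = norm_c act b n U *+ 2.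
Proof.
rewrite /norm_c rmorph_prod; case: n n_pos b_even => // m _ be'.
rewrite !big_ord_recl muln0 expg0 lam_cocU ?eqxx; last first.
  by have := b_odd 0; rewrite muln0 expg1 mul1g.
rewrite mulrnAl; congr (_ * _ *+ _); apply: eq_bigr => i _.
have bi := be' _ (ltn_ord (lift ord0 i) : (0 < lift ord0 i < m.+1)%N).
by rewrite lam_cocU -?expgSr ?b_odd // (negbTE bi).
Qed.

Lemma lam_act_norm_c :
  lam (act a (norm_c act b n U)) = act a (norm_c act b n U).
Proof.
rewrite /norm_c !rmorph_prod; apply: eq_bigr => i _.
by rewrite -!actM lam_cocU ?(negbTE (ab_neq1 _)) // -mulgA -expgSr ab_neq1.
Qed.

Lemma lam_cocB u : lam (act u B) = act u B.
Proof.
by rewrite /cocB /norm_b !rmorph_prod; apply: eq_bigr => i _; rewrite -actM lam_be.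
Qed.

Variables (kap : E) (q : nat).
Hypothesis kap0 : kap != 0.
Hypothesis nq : (n * n = (q * 4).+1)%N.
Hypothesis kap_c : act (b ^+ 2)%g kap = kap.
Hypothesis kap_h : forall u, act u (norm_h act a b n kap) = norm_h act a b n kap.
Hypothesis lam_kap : forall u, lam (act u kap) = act u kap.
Hypothesis two_exp : forall m, (0 < m)%N -> 2%:R ^+ m != 1 :> E.

Local Notation W := (cocW act a b n q al be kap).
Local Notation beta := (b ^+ n)%g.

Lemma two_exp_neq0 : 2%:R ^+ n != 0 :> E.
Proof.
apply/eqP => e; have lt0 : (0 < n + n)%N by rewrite addn_gt0 n_pos.
have lt1 : (0 < n)%N := n_pos.
have two0 : 2%:R = 0 :> E by apply/eqP; move/eqP: e; rewrite expf_eq0 => /andP[].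
have : (act 1%g al) *+ 2 = 0 by rewrite -mulr_natr two0 mulr0.
have := lam_al 1%g; rewrite eqxx => <- /eqP.
by rewrite !fmorph_eq0 (negbTE al0).
Qed.

Lemma lam_norm_h : lam (norm_h act a b n kap) = norm_h act a b n kap.
Proof.
by rewrite /norm_h !rmorphM -?actM !lam_kap -[kap in lam kap]act1 lam_kap act1.
Qed.

Lemma lam_kap1 : lam kap = kap.
Proof. by have := lam_kap 1%g; rewrite act1. Qed.

Lemma lam_cocW : lam W = W / 2%:R ^+ n.
Proof.
rewrite /cocW fmorphV rmorphM !rmorphXn fmorph_div rmorphXn lam_norm_c.
rewrite lam_norm_h lam_kap1 -invfM; congr (_^-1).
by rewrite -mulr_natr exprMn mulrAC.
Qed.

Lemma lam_act_cocW : lam (act a W) = act a W.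
Proof.
rewrite /cocW !fmorphV !rmorphM !rmorphXn !fmorph_div !rmorphXn lam_act_norm_c.
by rewrite kap_h lam_norm_h lam_kap.
Qed.

(** By [cocW_beta], [act beta W] is [W^-1] times an expression in translates of [be] and [kap],
    which [lam] fixes. *)
Lemma lam_beta_cocW : lam (act beta W) = act beta W * 2%:R ^+ n.
Proof.
have W0 : W != 0 by apply: cocW_neq0.
have := cocW_beta act1 actM mulgCT b_order nq al0 be0 kap0 kap_h.
move=> /(canRL (mulKf W0)) e; rewrite e rmorphM fmorphV lam_cocW.
have lamB1 u : lam (act u (cocB1 act b n q be kap)) = act u (cocB1 act b n q be kap).
  rewrite /cocB1 !fmorph_div !rmorphXn !rmorphM -actM !lam_kap lam_cocB.
  by [].
have lamB1' := lamB1 1%g; rewrite act1 in lamB1'.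
rewrite fmorph_div lamB1 lamB1'; field.
by rewrite W0 two_exp_neq0 cocB1_neq0.
Qed.

(** [lam] multiplies [W], [act a W] and [act beta W] by 2^(-n), 1 and 2^n, which is incompatible
    with each of the three equalities. *)
Lemma cocW_generic : [/\ act a W != W, (W * act a W) ^+ 2 != 1 &
  (act beta W * act a W) ^+ 2 != 1].
Proof.
have W0 : W != 0 by apply: cocW_neq0.
have c0 := two_exp_neq0.
have cN1 := two_exp n_pos.
have c2N1 : (2%:R ^+ n) ^+ 2 != 1 :> E by rewrite -exprM two_exp // muln_gt0 n_pos.
have aW0 : act a W != 0 by rewrite fmorph_eq0.
have bW0 : act beta W != 0 by rewrite fmorph_eq0.
split; apply/eqP.
- move=> e; case/eqP: cN1; apply: (mulfI W0); rewrite mulr1.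
  have := congr1 lam e; rewrite lam_act_cocW lam_cocW {1}e => We.
  by rewrite [in LHS]We divfK.
- move=> e; case/eqP: c2N1; have := congr1 lam e; rewrite rmorph1 rmorphXn rmorphM.
  rewrite lam_act_cocW lam_cocW mulrAC exprMn e mul1r => /eqP.
  by rewrite exprVn invr_eq1 => /eqP.
- move=> e; case/eqP: c2N1; have := congr1 lam e; rewrite rmorph1 rmorphXn rmorphM.
  by rewrite lam_act_cocW lam_beta_cocW mulrAC exprMn e mul1r.
Qed.

End Nonvanishing.

End Paths.

(** * The two generating families *)

(** The variables of [E], by kind, against the Klein, [X], sigma and diagonal generators together
    with the [pot g] for nontrivial g. *)
Lemma generators_count k n : (0 < k)%N -> (0 < n)%N ->
  (k * (4 * n * (4 * n)) + (3 + (2 * 2 + n)) =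
   8 + (4 * n + (n + (k * (4 * n) - 2) * (4 * n))) + (4 * n).-1)%N.
Proof.
move=> k0 n0; have big : (2 * (4 * n) <= k * (4 * n) * (4 * n))%N.
  by rewrite leq_mul2r; apply/orP; right; nia.
by rewrite mulnBl mulnA; move: (k * _ * _)%N big => N; lia.
Qed.

Section Assembly.

Variables (F E : fieldType) (cst : {rmorphism F -> E}) (gT : finGroupType).
Variable act : gT -> {rmorphism E -> E}.
Hypothesis act1 : forall f, act 1%g f = f.
Hypothesis actM : forall u v f, act (u * v)%g f = act u (act v f).
Hypothesis act_cst : forall u c, act u (cst c) = cst c.
Hypothesis mulgCT : forall u v : gT, (u * v = v * u)%g.

Variables (a b : gT) (n : nat) (ea : gT -> bool) (eb : gT -> nat).
Hypothesis odd_n : odd n.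
Hypothesis aa : (a * a = 1)%g.
Hypothesis b_exp_eq1 : forall j, ((b ^+ j)%g == 1%g) = (2 * n %| j)%N.
Hypothesis ab_neq1 : forall j, (a * b ^+ j != 1)%g.
Hypothesis ab_expE : forall u, u = (a ^+ ea u * b ^+ eb u)%g.
Hypothesis eb_lt : forall u, (eb u < 2 * n)%N.
Hypothesis card_gT : #|gT| = (4 * n)%N.
Hypothesis natE : forall m, (m%:R == 0 :> E) = (m == 0)%N.

Variables (k : nat) (i0 : 'I_k).

(* The entries x_{h,g}^(i), then the eigenvectors s, r, t, the coordinates of
   kappa along the s^i r^j and those of tau along the t^l. *)
Definition gvars : finType :=
  ('I_k * (gT * gT) + ('I_3 + ('I_2 * 'I_2 + 'I_n)))%type.

Variable var : gvars -> E.
Hypothesis var_neq0 : forall v, var v != 0.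
Variable lam : gvars -> {rmorphism E -> E}.
Hypothesis lam_cst : forall v c, lam v (cst c) = cst c.
Hypothesis lam_var : forall v, lam v (var v) = var v *+ 2.
Hypothesis lam_var_neq : forall v u, u != v -> lam v (var u) = var u.

Local Notation ed i h g := (var (inl (i, (h, g)))).
Local Notation s := (var (inr (inl (@Ordinal 3 0 isT)))).
Local Notation r := (var (inr (inl (@Ordinal 3 1 isT)))).
Local Notation t := (var (inr (inl (@Ordinal 3 2 isT)))).
Local Notation fv m := (var (inr (inr (inl m)))).
Local Notation ev l := (var (inr (inr (inr l)))).

Hypothesis act_ed : forall u i h g, act u (ed i h g) = ed i (u * h)%g (u * g)%g.
Hypothesis act_extra : forall u x, act u (var (inr (inr x))) = var (inr (inr x)).
Variable w : F.
Hypothesis w_prim : n.-primitive_root w.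
Hypotheses (a_s : act a s = - s) (b_s : act b s = s).
Hypotheses (a_r : act a r = r) (b_r : act b r = - r).
Hypotheses (a_t : act a t = t) (b_t : act b t = cst w * t).

Variable jK : {rmorphism gcp_field F gT k -> E}.
Hypothesis jK_cst : forall c, jK (gcp_const gT k c) = cst c.
Hypothesis jK_var : forall i h g, jK (gcp_var F i h g) = ed i h g.
Hypothesis lam_jK : forall x f, lam (inr x) (jK f) = jK f.

Local Notation n_gt0 := (odd_gt0 odd_n).
Local Notation beta := (b ^+ n)%g.
Local Notation al := (ed i0 1%g a).
Local Notation be := (ed i0 1%g b).
Local Notation q := (n * n %/ 4)%N.

Let b_order : (b ^+ (2 * n) = 1)%g.
Proof. by apply/eqP; rewrite b_exp_eq1. Qed.

Let ab_inj (x x' : bool) y y' : (a ^+ x * b ^+ y = a ^+ x' * b ^+ y')%g ->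
  x = x' /\ (y = y' %[mod 2 * n])%N.
Proof.
move=> e1; have bN m : (b ^+ m * b ^+ ((2 * n).-1 * m) = 1)%g.
  rewrite -expgD -mulSn prednK ?muln_gt0 ?n_gt0 //.
  by apply/eqP; rewrite b_exp_eq1 dvdn_mulr.
have aN m : a <> (b ^+ m)%g.
  by move=> am; have := ab_neq1 ((2 * n).-1 * m); rewrite am bN eqxx.
have xx : x = x'.
  have aE z z' : (a * b ^+ z = b ^+ z')%g -> False.
    move=> az; apply: (aN (z' + (2 * n).-1 * z)%N).
    by rewrite expgD -az -mulgA bN mulg1.
  move: e1; case: x x' => -[] //; rewrite expg0 expg1 mul1g;
    [by move/aE|by move/esym/aE].
split=> //; move: e1; rewrite xx => /mulgI.
wlog yy : y y' / (y <= y')%N => [H|] e1.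
  by have [/H|/ltnW/H H1] := leqP y y'; [apply | apply/esym/H1].
apply/eqP; rewrite eq_sym eqn_mod_dvd // -b_exp_eq1.
by apply/eqP/(mulIg (b ^+ y)%g); rewrite -expgD subnK // mul1g.
Qed.

Let ab_generate u : exists i j, u = (a ^+ i * b ^+ j)%g.
Proof. by exists (ea u), (eb u); apply: ab_expE. Qed.

Let nq : (n * n = (q * 4).+1)%N.
Proof.
have -> : (n * n)%N = ((n./2 * n./2 + n./2) * 4 + 1)%N.
  rewrite -[n in LHS]odd_double_half odd_n -muln2; nia.
by rewrite divnMDl // addn0 addn1.
Qed.

Let card_neq0 : #|gT|%:R != 0 :> E.
Proof. by rewrite natE card_gT muln_eq0 /= -lt0n n_gt0. Qed.

Let two0 : 2%:R != 0 :> E. Proof. by rewrite natE. Qed.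

Let cw_prim : n.-primitive_root (cst w).
Proof. by rewrite fmorph_primitive_root. Qed.

Let cw_inv : invariant act (cst w). Proof. by move=> u; apply: act_cst. Qed.

Local Notation th := (@kum_th E n s r t).
Local Notation chi := (@kum_chi E gT act n s r t).
Local Notation coord := (coordinate act th).
Local Notation average := (average act).
Local Notation kindex := (kum_index n).

Let th_neq0 i : th i != 0.
Proof. exact: kum_th_neq0. Qed.

Let act_th i u : act u (th i) = chi i u * th i.
Proof. exact: act_kum_th. Qed.

Let th0 : th (kum_index0 odd_n) = 1.
Proof. exact: kum_th0. Qed.

Let chi_orthogonal u : u != 1%g -> \sum_i (chi i u)^-1 = 0.
Proof.
exact: (kum_chi_orthogonal act1 actM aa b_order ab_generate odd_n
  (var_neq0 _) (var_neq0 _) (var_neq0 _) a_s b_s a_r b_r a_t b_t cw_prim cw_inv).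
Qed.

Let card_I : #|{: kindex}| = #|gT|.
Proof. exact: kum_card. Qed.

Let expansion f : f = \sum_i coord i f * th i.
Proof.
exact: (coordinate_expansion act1 card_neq0 th_neq0 act_th chi_orthogonal card_I).
Qed.

Let act_mono i j A B C : act (a ^+ i * b ^+ j)%g (s ^+ A * r ^+ B * t ^+ C) =
  (-1) ^+ (i * A) * (-1) ^+ (j * B) * cst w ^+ (j * C) * (s ^+ A * r ^+ B * t ^+ C).
Proof. exact: (act_monomial act1 actM a_s b_s a_r b_r a_t b_t cw_inv). Qed.

Definition gkap : E := \sum_(m : 'I_2 * 'I_2) fv m * (s ^+ m.1 * r ^+ m.2).
Definition gtau : E := \sum_(l < n) ev l * t ^+ l.

(** Doubling the variable [x j0] adds the nonzero term [var (x j0) * f j0] to the sum, which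
    therefore cannot vanish. *)
Let scaling_sum_neq0 (J : finType) (x : J -> gvars) (f : J -> E) j0 :
  injective x -> f j0 != 0 -> (forall j, lam (x j0) (f j) = f j) ->
  \sum_j var (x j) * f j != 0.
Proof.
move=> xI f0 lamf; apply/eqP => e.
have := congr1 (lam (x j0)) e; rewrite rmorph0 rmorph_sum.
rewrite (bigD1 j0) //= rmorphM lamf lam_var (eq_bigr (fun j => var (x j) * f j)).
  rewrite mulrnAl mulr2n -addrA.
  have -> : var (x j0) * f j0 + \sum_(j | j != j0) var (x j) * f j = 0.
    by rewrite -[RHS]e [RHS](bigD1 j0).
  by move/eqP; rewrite addr0 mulf_eq0 (negbTE f0) (negbTE (var_neq0 _)).
by move=> j jj0; rewrite rmorphM lamf lam_var_neq // (inj_eq xI).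
Qed.

Let kap0 : gkap != 0.
Proof.
apply: (@scaling_sum_neq0 _ (fun m => inr (inr (inl m))) _ (ord0, ord0)).
- by move=> x y [].
- by rewrite mulf_neq0 ?expf_neq0 ?var_neq0.
- by move=> m; rewrite rmorphM !rmorphXn !lam_var_neq.
Qed.

Let tau0 : gtau != 0.
Proof.
apply: (@scaling_sum_neq0 _ (fun l => inr (inr (inr l))) _ (Ordinal n_gt0)).
- by move=> x y [].
- by rewrite expf_neq0 ?var_neq0.
- by move=> m; rewrite rmorphXn !lam_var_neq.
Qed.

Let act_kap i j : act (a ^+ i * b ^+ j)%g gkap =
  \sum_(m : 'I_2 * 'I_2) fv m *
     ((-1) ^+ (i * m.1) * (-1) ^+ (j * m.2) * (s ^+ m.1 * r ^+ m.2)).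
Proof.
rewrite rmorph_sum; apply: eq_bigr => m _; rewrite rmorphM act_extra.
congr (_ * _); have := act_mono i j m.1 m.2 0.
by rewrite expr0 !mulr1 muln0 expr0 mulr1.
Qed.

Let kap_ext i j j' : odd j = odd j' ->
  act (a ^+ i * b ^+ j)%g gkap = act (a ^+ i * b ^+ j')%g gkap.
Proof.
move=> jj; rewrite !act_kap; apply: eq_bigr => m _; congr (_ * (_ * _ * _)).
by rewrite -signr_odd oddM jj -oddM signr_odd.
Qed.

Let kap_c : act (b ^+ 2)%g gkap = gkap.
Proof.
have := @kap_ext 0 2 0 (erefl _).
by rewrite !expg0 !mul1g act1.
Qed.

Let kap_b : act b gkap = act beta gkap.
Proof.
have := @kap_ext 0 1 n; rewrite odd_n !expg0 !mul1g expg1.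
by apply.
Qed.

Let actCC u v f : act u (act v f) = act v (act u f).
Proof. exact: actC. Qed.

Let kap_h u : act u (norm_h act a b n gkap) = norm_h act a b n gkap.
Proof.
have ha : act a (norm_h act a b n gkap) = norm_h act a b n gkap.
  rewrite /norm_h !rmorphM (act_a act1 actM aa) [act a (act beta gkap)]actCC.
  rewrite [act a (act beta (act a gkap))]actCC (act_a act1 actM aa); ring.
have hb : act b (norm_h act a b n gkap) = norm_h act a b n gkap.
  rewrite /norm_h !rmorphM ![act b (act _ _)]actCC kap_b.
  rewrite [act a (act beta gkap)]actCC !(act_beta act1 actM b_order); ring.
rewrite (ab_expE u) actM.
have -> : act (b ^+ eb u)%g (norm_h act a b n gkap) = norm_h act a b n gkap.
  by elim: (eb u) => [|j IHj]; rewrite ?expg0 ?act1 // expgS actM IHj hb.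
by case: (ea u); rewrite ?expg0 ?expg1 ?act1.
Qed.

Let tau_a : act a gtau = gtau.
Proof.
rewrite rmorph_sum; apply: eq_bigr => l _.
by rewrite rmorphM act_extra rmorphXn a_t.
Qed.

Let tau_beta : act beta gtau = gtau.
Proof.
rewrite rmorph_sum; apply: eq_bigr => l _; rewrite rmorphM act_extra.
congr (_ * _); have := act_mono 0 n 0 0 l.
rewrite expg0 mul1g !expr0 !mul1r !muln0 !expr0 !mul1r => ->.
by rewrite exprM (prim_expr_order cw_prim) expr1n mul1r.
Qed.

Let al0 : al != 0. Proof. exact: var_neq0. Qed.
Let be0 : be != 0. Proof. exact: var_neq0. Qed.

Local Notation U := (cocU act a b al be).
Local Notation A := (cocA act a al).
Local Notation B := (cocB act b n be).
Local Notation W := (cocW act a b n q al be gkap).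
Local Notation B1 := (cocB1 act b n q be gkap).
Local Notation X := (cocX act a b n q al be gkap gtau).
Local Notation e := (cocE act a b n q gkap gtau).
Local Notation J := (cocJ act a b n q al be gtau).

Let b_even i : (0 < i < n)%N -> (b ^+ (2 * i) != 1)%g.
Proof.
move=> /andP[i0' ni]; rewrite b_exp_eq1 dvdn_pmul2l //.
by rewrite gtnNdvd.
Qed.

Let b_odd i : (b ^+ (2 * i).+1 != 1)%g.
Proof.
rewrite b_exp_eq1; apply/negP => /(dvdn_trans (dvdn_mulr n (dvdnn 2))).
by rewrite dvdn2 /= oddM.
Qed.

Let gen_W : [/\ act a W != W, (W * act a W) ^+ 2 != 1 &
  (act beta W * act a W) ^+ 2 != 1].
Proof.
pose v0 : gvars := inl (i0, (1%g, a)).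
have b1 : b != 1%g by have := b_odd 0; rewrite muln0 expg1.
have a1 : a != 1%g by have := ab_neq1 0; rewrite expg0 mulg1.
have ab : a != b.
  apply/eqP => eab; have := ab_neq1 1; rewrite expg1 -eab aa eqxx.
  by [].
have v0E h g : (inl (i0, (h, g)) == v0 :> gvars) = (h == 1%g) && (g == a).
  by rewrite -[LHS]/((i0, (h, g)) == (i0, (1%g, a))) !xpair_eqE eqxx.
apply: (@cocW_generic _ _ _ act1 actM mulgCT _ _ _ b_order _ _ al0 be0 (lam v0)) => //;
  try exact: n_gt0.
- move=> u; rewrite act_ed mulg1; have [->|u1] := eqVneq u 1%g.
    by rewrite mul1g lam_var.
  by rewrite lam_var_neq ?mulr1n // v0E (negbTE u1).
- move=> u; rewrite act_ed mulg1 lam_var_neq // v0E negb_and.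
  by have [->|//] := eqVneq u 1%g; rewrite mul1g eq_sym ab.
- move=> u; rewrite [u]ab_expE act_kap rmorph_sum; apply: eq_bigr => m _.
  by rewrite !rmorphM !rmorphXn !rmorphN1 !lam_var_neq.
- move=> m m0; rewrite -natrX -subr_eq0 -[X in _ - X]/(1%:R) -natrB ?expn_gt0 // natE.
  by rewrite subn_eq0 -ltnNge -{1}(expn0 2) ltn_exp2l.
Qed.

Let invariant_pred : pred E := fun f => `[< invariant act f >].

Let invariant_closed : divring_closed invariant_pred.
Proof.
split=> [|f g /asboolP fI /asboolP gI|f g /asboolP fI /asboolP gI];
  apply/asboolP => u; first exact: rmorph1.
- by rewrite rmorphB fI gI.
- by rewrite fmorph_div fI gI.
Qed.

HB.instance Definition _ :=
  GRing.isDivringClosed.Build E invariant_pred invariant_closed.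

Let inv_field : divringClosed E := GRing.DivringClosed.clone E invariant_pred _.

Let inv_fieldP f : reflect (invariant act f) (f \in inv_field).
Proof. exact: asboolP. Qed.

(** As [n] is odd, [b] is [beta] times a power of [b ^+ 2], so the three elements generate the
    group. *)
Let inv_gen f : act a f = f -> act beta f = f -> act (b ^+ 2)%g f = f ->
  invariant act f.
Proof.
move=> fa fb fc.
have fbb : act b f = f.
  have -> : b = (beta * (b ^+ 2) ^+ (n.+1)./2)%g.
    rewrite -expgM mul2n even_halfK /= ?odd_n // -expgD addnS addnn -mul2n.
    by rewrite expgS b_order mulg1.
  rewrite actM; elim: (_./2) => [|j IHj]; first by rewrite expg0 act1.
  by rewrite expgSr actM fc.
move=> u; rewrite (ab_expE u) actM.
have -> : act (b ^+ eb u)%g f = f.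
  by elim: (eb u) => [|j IHj]; rewrite ?expg0 ?act1 // expgS actM IHj fbb.
by case: (ea u); rewrite ?expg0 ?expg1 ?act1.
Qed.

Let act_s2 : act (b ^+ 2)%g s = s.
Proof. by rewrite expgS expg1 actM !b_s. Qed.

Let act_r2 : act (b ^+ 2)%g r = r.
Proof. by rewrite expgS expg1 actM !b_r rmorphN b_r opprK. Qed.

Let b_n_r i j : act (a ^+ i * b ^+ j)%g r = (-1) ^+ j * r.
Proof.
have := act_mono i j 0 1 0; rewrite !expr0 !muln0 !expr0 !mul1r !mulr1 expr1.
by rewrite muln1.
Qed.

Let b_n_s i j : act (a ^+ i * b ^+ j)%g s = (-1) ^+ i * s.
Proof.
have := act_mono i j 1 0 0; rewrite !expr0 !muln0 !expr0 !mulr1 expr1.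
by rewrite muln1.
Qed.

Let b_n_t i j : act (a ^+ i * b ^+ j)%g t = cst w ^+ j * t.
Proof.
have := act_mono i j 0 0 1; rewrite !expr0 !muln0 !expr0 !mul1r expr1.
by rewrite muln1.
Qed.

Let beta_s : act beta s = s.
Proof. by have := b_n_s 0 n; rewrite expg0 mul1g expr0 mul1r. Qed.

Let beta_r : act beta r = - r.
Proof.
have := b_n_r 0 n.
by rewrite expg0 mul1g -signr_odd odd_n expr1 mulN1r.
Qed.

Let W0 : W != 0.
Proof. by apply: cocW_neq0. Qed.

Let act_W2 : act (b ^+ 2)%g W = W.
Proof.
rewrite /cocW fmorphV rmorphM !rmorphXn fmorph_div rmorphXn kap_c kap_h.
by rewrite (norm_c_act act1 actM mulgCT b_order nq).
Qed.

(** * The family [gens], in the role of z *)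

Section Choices.

Variables (iA iB : kindex) (l0 : 'I_n).
Hypotheses (cA : coord iA A != 0) (cB : coord iB B != 0).

(** Invariant stand-ins for [A] and [B]: by [coordinate_cocycle], a nonzero coordinate differs from
    the element by a factor in the stable field. *)
Definition gA' := coord iA A.
Definition gB' := coord iB B.
Local Notation A' := gA'.
Local Notation B' := gB'.

Let invA' : invariant act A'. Proof. exact: average_inv. Qed.
Let invB' : invariant act B'. Proof. exact: average_inv. Qed.

(** Of the [n.+1] factors [B'], [n] compensate the [B ^+ n] in the denominator of [B1] and the last
    one makes [B'] recoverable from [p]; being invariant, they drop out of [p / act a p]. *)
Definition gp := act a B1 * B' ^+ n.+1.
Local Notation p := gp.

Let B10 : B1 != 0. Proof. exact: cocB1_neq0. Qed.

Let p0 : p != 0.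
Proof. by rewrite mulf_neq0 ?fmorph_eq0 // expf_neq0. Qed.

Let act_B12 : act (b ^+ 2)%g B1 = B1.
Proof.
rewrite /cocB1 fmorph_div !rmorphXn rmorphM kap_c actCC kap_c.
by rewrite (act_bX_cocB act1 actM mulgCT b_order nq).
Qed.

Let beta_p : act beta p = p.
Proof.
rewrite rmorphM rmorphXn invB' actCC.
by rewrite (act_beta_cocB1 act1 actM mulgCT b_order nq).
Qed.

Let act_p2 : act (b ^+ 2)%g p = p.
Proof. by rewrite rmorphM rmorphXn invB' actCC act_B12. Qed.

Let W_norm : W * act beta W = p / act a p.
Proof.
rewrite (cocW_beta act1 actM mulgCT b_order nq al0 be0 kap0 kap_h).
have -> : act a p = B1 * B' ^+ n.+1.
  by rewrite (rmorphM (act a) (act a B1)) rmorphXn invB' (act_a act1 actM aa).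
by rewrite /gp -mulf_div mulfV ?mulr1 // expf_neq0.
Qed.

Local Notation fa := (act a).
Local Notation fb := (act beta).
Local Notation kx := (klx fa fb W p).
Local Notation ky := (kly fa fb s W p).
Local Notation kz := (klz fa fb r W p).
Local Notation kw := (klw fa fb s r W p).
Local Notation kp0 := (klp0 fa p).
Local Notation kp1 := (klp1 fa s p).

Let faK : forall f, fa (fa f) = f. Proof. exact: act_a. Qed.
Let fbK : forall f, fb (fb f) = f. Proof. exact: act_beta. Qed.
Let fabC : forall f, fa (fb f) = fb (fa f). Proof. by move=> f; apply: actCC. Qed.
Let s0 : s != 0. Proof. exact: var_neq0. Qed.
Let r0 : r != 0. Proof. exact: var_neq0. Qed.
Let t0 : t != 0. Proof. exact: var_neq0. Qed.

Let klein_inv : [/\ invariant act kx, invariant act ky, invariant act kz &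
  invariant act kw] /\ invariant act kp0 /\ invariant act kp1.
Proof.
have [a1 a2 a3 a4] := kl_fa fb W p faK a_s a_r s0 r0 two0.
have [b1 b2 b3 b4] := kl_fb W p fbK fabC beta_s beta_r s0 r0 two0.
have [a5 a6] := klp_fa p faK a_s s0 two0.
have [b5 b6] := klp_fb fabC beta_s beta_p.
have [[c1 c2 c3 c4] [c5 c6]] := @kl_fix _ fa fb s r W p (act (b ^+ 2)%g)
  (actCC _ _) (actCC _ _) act_s2 act_r2 act_W2 act_p2.
by split; [split|split]; apply: inv_gen.
Qed.

Let klein_neq0 : kz * kw != 0 /\ ky ^+ 2 - r ^+ 2 * kw ^+ 2 + kp1 ^+ 2 != 0.
Proof.
have [g1 g2 g3] := gen_W.
exact: (kl_neq0 faK fbK fabC s0 r0 two0 W0 p0 beta_p W_norm g1 g2 g3).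
Qed.

Definition tindex (l : 'I_n) : kindex := (ord0, ord0, l).

(** An explicit solution f of [f / act b f = J]: [cocC] yields the power of [norm_h U], and the
    double product yields [tau ^+ n / norm_c' tau] by telescoping. *)
Definition gsigma0 := cocC act a b n al ^+ (q * (n * n).+1) *
  (\prod_(i < n) \prod_(l < i) act (b ^+ l)%g gtau) ^+ n.

Lemma gsigma0_neq0 : gsigma0 != 0.
Proof.
rewrite mulf_neq0 ?expf_neq0 ?cocC_neq0 //; apply/prodf_neq0 => i _.
by apply/prodf_neq0 => l _; rewrite fmorph_eq0.
Qed.

Lemma gsigma0_fixed : act a gsigma0 = gsigma0 /\ act beta gsigma0 = gsigma0.
Proof.
have [ca cb] := act_cocC act1 actM mulgCT aa b_order al.
split; rewrite rmorphM !rmorphXn rmorph_prod ?ca ?cb; congr (_ * _ ^+ _);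
  apply: eq_bigr => i _; rewrite rmorph_prod; apply: eq_bigr => l _;
  by rewrite actCC ?tau_a ?tau_beta.
Qed.

Let sigma0_J : gsigma0 / act b gsigma0 = J.
Proof.
rewrite /gsigma0 /cocJ (norm_h_cocU act1 actM mulgCT b n aa al0 be0).
rewrite rmorphM !rmorphXn invfM mulrACA -!expr_div_n; congr (_ * _ ^+ _).
rewrite rmorph_prod -prodf_div /norm_c'.
have -> : gtau ^+ n = \prod_(i < n) gtau by rewrite prodr_const card_ord.
rewrite -prodf_div; apply: eq_bigr => i _; rewrite rmorph_prod.
elim: (nat_of_ord i) => [|m IHm].
  by rewrite !big_ord0 expg0 act1 invr1 mulr1 mulfV.
rewrite !big_ord_recr /= -actM -expgS.
have m0 : act (b ^+ m)%g gtau != 0 by rewrite fmorph_eq0.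
by rewrite invfM mulrACA IHm mulrA divfK.
Qed.

Hypothesis cS : coord (tindex l0) gsigma0 != 0.

(** The invariant factor leaves the quotient by the conjugate under [b] equal to [J] and makes the
    coordinate at [l0] equal to [e], so the coordinates of [gsigma] encode both. *)
Definition gsigma := e / coord (tindex l0) gsigma0 * gsigma0.

Let e_inv : invariant act e.
Proof.
move=> u; rewrite /cocE rmorphM !rmorphXn kap_h; congr (_ * _ ^+ _).
have ntb : act b (norm_c' act b n gtau) = norm_c' act b n gtau.
  rewrite rmorph_prod /norm_c'; have := tau_beta.
  have := n_gt0; case: (n) => // m _ tb.
  rewrite [LHS]big_ord_recr [RHS]big_ord_recl /= expg0 act1 mulrC -actM -expgS tb.
  by congr (_ * _); apply: eq_bigr => i _; rewrite -actM -expgS.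
have nta : act a (norm_c' act b n gtau) = norm_c' act b n gtau.
  by rewrite rmorph_prod; apply: eq_bigr => i _; rewrite actCC tau_a.
rewrite (ab_expE u) actM.
have -> : act (b ^+ eb u)%g (norm_c' act b n gtau) = norm_c' act b n gtau.
  by elim: (eb u) => [|j IHj]; rewrite ?expg0 ?act1 // expgS actM IHj ntb.
by case: (ea u); rewrite ?expg0 ?expg1 ?act1.
Qed.

Let sigma_scale_inv : invariant act (e / coord (tindex l0) gsigma0).
Proof. by move=> u; rewrite fmorph_div e_inv average_inv. Qed.

Let sigma_scale_neq0 : e / coord (tindex l0) gsigma0 != 0.
Proof.
rewrite mulf_neq0 ?invr_neq0 // mulf_neq0 ?expf_neq0 ?norm_h_neq0 //.
by rewrite norm_c'_neq0.
Qed.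

Let sigma_coord : coord (tindex l0) gsigma = e.
Proof.
rewrite {1}/coordinate /gsigma -(mulrA (e / _)) averageMl //.
exact: divfK.
Qed.

Let sigma_coord0 i : i.1 != (ord0, ord0) -> coord i gsigma = 0.
Proof.
have [sa sb] := gsigma0_fixed.
apply: (kum_coordinate0 act1 actM odd_n card_gT card_neq0 a_s b_s a_r b_r a_t b_t
  cw_prim cw_inv).
- by rewrite rmorphM sigma_scale_inv sa.
- by rewrite rmorphM sigma_scale_inv sb.
Qed.

Let sigma_J : gsigma / act b gsigma = J.
Proof.
rewrite -sigma0_J rmorphM sigma_scale_inv invfM mulrACA mulfV ?mul1r //.
Qed.

Definition pot g : E := path act b al be (ea g) (eb g).
Definition gdiag (c : 'I_k * gT) : E := ed c.1 1%g c.2 / pot c.2.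
(** The two omitted pairs are the edges [al] and [be], where [gdiag] is 1. *)
Definition diag_index : {set 'I_k * gT} :=
  [set c | c \notin [:: (i0, a); (i0, b)]].

Definition klein_gens := [:: kx; ky; kz; kw; kp0; kp1; t ^+ n; A'].
Definition X_gens := [seq coord i X | i <- enum {: kindex}].
Definition sigma_gens := [seq coord (tindex l) gsigma | l <- enum 'I_n].
Definition diag_gens :=
  [seq coord i (gdiag c) | c <- enum diag_index, i <- enum {: kindex}].
Definition gens := klein_gens ++ X_gens ++ sigma_gens ++ diag_gens.

Let pot_neq0 g : pot g != 0. Proof. exact: path_neq0. Qed.

(** * Stable fields large enough to contain the generators *)

Section GeneratorsIn.

Variable T : divringClosed E.
Hypothesis T_act : forall u f, f \in T -> act u f \in T.
Hypothesis T_str : [/\ s \in T, r \in T & t \in T].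
Hypothesis T_ext : gkap \in T /\ gtau \in T.
Hypothesis T_coc : [/\ U \in T, A \in T & B \in T].
Hypothesis T_diag : forall c, gdiag c \in T.

Let T_th i : th i \in T.
Proof.
have [Ts Tr Tt] := T_str.
by apply: rpredM; [apply: rpredM|]; apply: rpredX.
Qed.

Let T_coord i f : f \in T -> coord i f \in T.
Proof.
move=> Tf; apply: rpredM; first by rewrite rpredV rpred_nat.
by apply: rpred_sum => u _; apply: T_act; apply: rpred_div.
Qed.

Let T_norm_h f : f \in T -> norm_h act a b n f \in T.
Proof. exact: norm_h_stable. Qed.

Let T_W : W \in T.
Proof.
have [TU _ _] := T_coc; have [Tk _] := T_ext.
rewrite rpredV; apply: rpredM; apply: rpredX; first exact: norm_c_stable.
by apply: rpred_div; [apply: rpredX|apply: T_norm_h].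
Qed.

Let T_p : p \in T.
Proof.
have [_ TA TB] := T_coc; have [Tk _] := T_ext.
apply: rpredM; last by apply/rpredX/T_coord.
apply: T_act; apply: rpred_div; apply: rpredX => //.
by apply: rpredM => //; apply: T_act.
Qed.

Let T_e : e \in T.
Proof.
have [Tk Tt] := T_ext.
by apply: rpredM; apply: rpredX; [apply: T_norm_h|apply: norm_c'_stable].
Qed.

Let T_X : X \in T.
Proof.
have [TU _ _] := T_coc; have [Tk Tt] := T_ext.
apply: rpredM => //; apply: rpredM; first exact: rpredM.
by apply/rpredX/T_norm_h.
Qed.

Let T_sigma : gsigma \in T.
Proof.
have [_ TA _] := T_coc; have [Tk Tt] := T_ext.
have Tsigma0 : gsigma0 \in T.
  apply: rpredM; apply: rpredX.
    by apply: rpredM => //; apply: T_act.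
  by apply: rpred_prod => i _; apply: rpred_prod => l _; apply: T_act.
by apply: rpredM => //; apply: rpred_div => //; apply: T_coord.
Qed.

Lemma gens_in : {subset gens <= T}.
Proof.
have [Ts Tr Tt] := T_str.
have Tn m : m%:R \in T by apply: rpred_nat.
have TQ : klQ W p \in T by apply: rpred_div.
have TaQ := T_act a TQ; have TbQ := T_act beta TQ; have TabQ := T_act a TbQ.
have Tap := T_act a T_p.
move=> z; rewrite !mem_cat => /or4P[].
- rewrite !inE => /or4P[/eqP->|/eqP->|/eqP->|/or4P[/eqP->|/eqP->|/eqP->|/orP[]/eqP->]].
  + by apply: rpred_div => //; do 3![apply: rpredD => //].
  + by apply: rpred_div; last apply: rpredM;
      first by apply: rpredB => //; apply: rpredD => //; apply: rpredB.
  + by apply: rpred_div; last apply: rpredM;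
      first by apply: rpredB => //; apply: rpredB => //; apply: rpredD.
  + apply: rpred_div; last by do 2![apply: rpredM => //].
    by apply: rpredD => //; do 2![apply: rpredB => //].
  + by apply: rpred_div => //; apply: rpredD.
  + by apply: rpred_div; [apply: rpredB|apply: rpredM].
  + exact: rpredX.
  + by apply: T_coord; case: T_coc.
- by case/mapP => i _ ->; apply: T_coord.
- by case/mapP => l _ ->; apply: T_coord.
- by case/allpairsP => -[c i] [_ _ ->]; apply: T_coord.
Qed.

End GeneratorsIn.

Lemma gens_invariant z : z \in gens -> invariant act z.
Proof.
have [[? ? ? ?] [? ?]] := klein_inv.
have tn_inv : invariant act (t ^+ n).
  move=> u; rewrite (ab_expE u) rmorphXn b_n_t exprMn -exprM mulnC exprM.
  by rewrite (prim_expr_order cw_prim) expr1n mul1r.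
rewrite !mem_cat => /or4P[].
- by rewrite !inE => /or4P[/eqP->|/eqP->|/eqP->|/or4P[/eqP->|/eqP->|/eqP->|/orP[]/eqP->]].
- by case/mapP => i _ ->; apply: average_inv.
- by case/mapP => l _ ->; apply: average_inv.
- by case/allpairsP => -[c i] [_ _ ->]; apply: average_inv.
Qed.

(** * Recovering the stable field from the generators *)

Section Recover.

Variable S : divringClosed E.
Hypothesis S_inv : forall f, f \in S -> invariant act f.
Hypothesis S_cst : forall c, cst c \in S.
Hypothesis S_gens : {subset gens <= S}.

Let klein_in : [/\ kx \in S, ky \in S, kz \in S & kw \in S] /\
  [/\ kp0 \in S, kp1 \in S, t ^+ n \in S & A' \in S].
Proof.
have kS f : f \in klein_gens -> f \in S by move=> kf; rewrite S_gens // mem_cat kf.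
by split; split; apply: kS; rewrite !inE eqxx ?orbT.
Qed.

Let S_r2s2 : r ^+ 2 \in S /\ s ^+ 2 \in S.
Proof.
have [kin [p0in p1in _ _]] := klein_in; have [n1 n2] := klein_neq0.
exact: (klein_recover faK fbK fabC a_s beta_s a_r beta_r s0 r0 two0 p0 beta_p
  W_norm n1 n2 kin p0in p1in).
Qed.

Lemma gens_kummer_base : kummer_base act th chi S.
Proof.
have [Sr Ss] := S_r2s2; have [_ [_ _ St _]] := klein_in.
exact: (kum_base act1 actM ab_generate odd_n card_gT card_neq0 s0 r0 t0 a_s b_s
  a_r b_r a_t b_t cw_prim cw_inv S_inv (S_cst w) Ss Sr St).
Qed.

Local Notation T := (kummer_field act1 actM card_neq0 th_neq0 th0 act_th
  chi_orthogonal card_I gens_kummer_base).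

Let T_S : {subset S <= T}. Proof. exact: (base_kummer th0 gens_kummer_base). Qed.

Let T_act u f : f \in T -> act u f \in T.
Proof. exact: (kummer_act act1 actM th_neq0 act_th). Qed.

Let T_coord f : (forall i, coord i f \in S) -> f \in T.
Proof. by move=> Sf; apply/kummerP. Qed.

Let T_th i : th i \in T. Proof. exact: (kummer_th th0 gens_kummer_base). Qed.

Let T_str : [/\ s \in T, r \in T & t \in T].
Proof.
split.
- have := T_th (@Ordinal 2 1 isT, ord0, Ordinal n_gt0).
  by rewrite /kum_th /= !expr0 !mulr1.
- have := T_th (ord0, @Ordinal 2 1 isT, Ordinal n_gt0).
  by rewrite /kum_th /= !expr0 mulr1 mul1r.
(* For [n = 1] no index gives [t] itself, but then [t] is the generator [t ^+ n]. *)
- have [n1|n1] := ltnP 1 n.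
    by have := T_th (ord0, ord0, Ordinal n1); rewrite /kum_th /= !expr0 !mul1r.
  have [_ [_ _ Stn _]] := klein_in; apply: T_S.
  have n_eq1 : n = 1%N by apply/eqP; rewrite eqn_leq n1 n_gt0.
  by rewrite (etrans (congr1 (fun m => t ^+ m) n_eq1) (expr1 t)) in Stn.
Qed.

Let T_Wp : p \in T /\ W \in T.
Proof.
have [[kx' ky' kz' kw'] [p0in p1in _ _]] := klein_in; have [Ts Tr _] := T_str.
apply: (klein_mem (fa := fa) (fb := fb) s0 r0 two0 p0) => //; try exact: T_S.
by split; apply: T_S.
Qed.

Let T_X : X \in T.
Proof.
apply: T_coord => i; apply: S_gens; rewrite !mem_cat; apply/or4P/Or42.
by apply/mapP; exists i => //; rewrite mem_enum.
Qed.

Let S_sigma l : coord (tindex l) gsigma \in S.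
Proof.
apply: S_gens; rewrite !mem_cat; apply/or4P/Or43.
by apply/mapP; exists l => //; rewrite mem_enum.
Qed.

Let T_sigma : gsigma \in T.
Proof.
apply: T_coord => -[ij l]; have [->|ij0] := eqVneq ij (ord0, ord0).
  exact: S_sigma.
by rewrite sigma_coord0 ?rpred0.
Qed.

(** [e] is a coordinate of [gsigma] and [J] its quotient by a conjugate; with [W] and [X] this is
    the input of [cocycle_recover]. *)
Lemma recover_coc : [/\ U \in T, gkap \in T & gtau \in T].
Proof.
have [_ TW] := T_Wp.
apply: (cocycle_recover act1 actM mulgCT aa b_order nq al0 be0 kap0 tau0 kap_c
  kap_h tau_a tau_beta T_act TW T_X).
  by apply: T_S; rewrite -sigma_coord S_sigma.
by rewrite -sigma_J; apply: rpred_div => //; apply: T_act.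
Qed.

Let T_chi i u : chi i u \in T.
Proof. by have [_ Schi _] := gens_kummer_base; apply: T_S. Qed.

Let A0 : A != 0. Proof. exact: cocA_neq0. Qed.
Let B0 : B != 0. Proof. exact: cocB_neq0. Qed.

Let T_A : A \in T.
Proof.
have [TU _ _] := recover_coc; have [_ [_ _ _ SA']] := klein_in.
have Tq : A' / A \in T.
  apply: (coordinate_cocycle act_th iA T_th T_chi) => // u.
  exact: (cocA_cocycle act1 actM mulgCT aa ab_generate al0 be0 T_act TU u).
have -> : A = A' / (A' / A) by rewrite invf_div mulrCA mulfV ?mulr1.
by apply: rpred_div => //; apply: T_S.
Qed.

Let T_B : B \in T.
Proof.
have [TU Tk _] := recover_coc; have [Tp _] := T_Wp.
have Tq : B' / B \in T.
  apply: (coordinate_cocycle act_th iB T_th T_chi) => // u.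
  exact: (cocB_cocycle act1 actM mulgCT b_order ab_generate nq al0 be0 T_act TU u).
(* [B1 * B' ^+ n] involves [B] only through [B' / B], so it lies in [T], and dividing [p] by its
   conjugate isolates [B']. *)
have TB1 : act a (B1 * B' ^+ n) \in T.
  apply: T_act; have -> : B1 * B' ^+ n =
      (gkap * act beta gkap) ^+ (2 * q) * (B' / B) ^+ n.
    by rewrite /cocB1 expr_div_n mulrAC mulrA.
  by apply: rpredM; apply: rpredX => //; apply: rpredM => //; apply: T_act.
have TB' : B' \in T.
  have -> : B' = p / act a (B1 * B' ^+ n).
    rewrite rmorphM rmorphXn invB' /gp exprSr mulrA mulrAC mulfV ?mul1r //.
    by rewrite mulf_neq0 ?fmorph_eq0 ?expf_neq0.
  exact: rpred_div.
have -> : B = B' / (B' / B) by rewrite invf_div mulrCA mulfV ?mulr1.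
exact: rpred_div.
Qed.

Let ea_ab : [/\ ea a = true, eb a = 0%N, ea b = false & eb b = 1%N].
Proof.
have inj (x x' : bool) y y' : (y < 2 * n)%N -> (y' < 2 * n)%N ->
    (a ^+ x * b ^+ y = a ^+ x' * b ^+ y')%g -> x = x' /\ y = y'.
  by move=> y2 y2' /ab_inj []; rewrite !modn_small.
have lt1 : (1 < 2 * n)%N by rewrite mul2n -addnn -addn1 leq_add // n_gt0.
have e1 : (a ^+ ea a * b ^+ eb a = a ^+ true * b ^+ 0)%g.
  by rewrite -ab_expE expg0 mulg1 expg1.
have e2 : (a ^+ ea b * b ^+ eb b = a ^+ false * b ^+ 1)%g.
  by rewrite -ab_expE expg0 mul1g expg1.
have [-> ->] := inj _ _ _ _ (eb_lt _) (ltnW lt1) e1.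
by have [-> ->] := inj _ _ _ _ (eb_lt _) lt1 e2.
Qed.

Let T_diag c : gdiag c \in T.
Proof.
have [ea1 ea2 eb1 eb2] := ea_ab.
have [cD|] := boolP (c \in diag_index).
  apply: T_coord => i; apply: S_gens; rewrite !mem_cat; apply/or4P/Or44.
  by apply/allpairsP; exists (c, i); rewrite !mem_enum.
rewrite inE negbK !inE => /orP[] /eqP ->; rewrite /gdiag /pot /path /=.
  rewrite ea1 ea2 big_ord0 expg0 act1 mul1r mulfV //; exact: (rpred1 T).
rewrite eb1 eb2 big_ord_recl big_ord0 expg0 act1 !mulr1 mulfV //.
exact: (rpred1 T).
Qed.

(** The edge is the translate by [h] of an edge at 1, which [gdiag] gives; the leftover path
    products are handled by [path_cocycle] and [path_period]. *)
Lemma recover_edge i h g : ed i h g * pot h / pot g \in T.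
Proof.
have [TU _ _] := recover_coc.
pose g' := (h^-1 * g)%g.
have gE : g = (h * g')%g by rewrite mulKVg.
have -> : ed i h g * pot h / pot g =
    act h (gdiag (i, g')) * (act h (pot g') * pot h / pot g).
  rewrite /gdiag fmorph_div act_ed mulg1 -gE; field.
  by rewrite fmorph_eq0 !pot_neq0.
apply: rpredM; first exact/T_act/T_diag.
have := path_cocycle actM mulgCT al0 be0 T_act TU T_A (ea h) (ea g') (eb h) (eb g').
rewrite -ab_expE -/(pot g') -/(pot h) => T1.
suff T2 : path act b al be (ea h (+) ea g') (eb h + eb g') / pot g \in T.
  have := rpredM T1 T2; rewrite mulrA divfK //.
  exact: path_neq0.
have gE2 : g = (a ^+ (ea h (+) ea g') * b ^+ (eb h + eb g'))%g.
  rewrite [LHS]gE {1}(ab_expE h) {1}(ab_expE g') -mulgA [(b ^+ eb h * _)%g]mulgCT.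
  rewrite -!mulgA -expgD mulgA addnC; congr (_ * _)%g.
  by case: (ea h) (ea g') => -[]; rewrite /= ?expg0 ?expg1 ?mul1g ?mulg1 ?aa.
have [-> eg] := ab_inj (etrans (esym gE2) (ab_expE g)).
(* The exponents of [b] agree only modulo [2 * n]; each full turn contributes a factor [B]. *)
have -> : (eb h + eb g' = eb g + (eb h + eb g') %/ (2 * n) * (2 * n))%N.
  by rewrite {1}(divn_eq (eb h + eb g') (2 * n)) addnC eg modn_small.
elim: (_ %/ _)%N => [|l IHl]; first by rewrite mul0n addn0 mulfV ?rpred1 // path_neq0.
have := rpredM (path_period b_order al0 be0 T_B (ea g) (eb g + l * (2 * n))) IHl.
by rewrite mulrA divfK ?path_neq0 // -addnA -mulSnr.
Qed.

Let S_of_T f : f \in T -> invariant act f -> f \in S.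
Proof. exact: (kummer_inv card_neq0 th0). Qed.

Lemma recover_str : [/\ s \in T, r \in T & t \in T]. Proof. exact: T_str. Qed.

Lemma recover_act u f : f \in T -> act u f \in T. Proof. exact: T_act. Qed.

Lemma recover_inv f : f \in T -> invariant act f -> f \in S.
Proof. exact: S_of_T. Qed.

Lemma recover_base : {subset S <= T}. Proof. exact: T_S. Qed.

Let coord_comb (J : finType) (x : J -> E) (idx : J -> kindex) j :
  (forall j, invariant act (x j)) -> injective idx ->
  coord (idx j) (\sum_j' x j' * th (idx j')) = x j.
Proof.
move=> xI idxI; rewrite /coordinate mulr_suml average_sum.
have E1 j' : average (x j' * th (idx j') / th (idx j)) = x j' * (j == j')%:R.
  rewrite -mulrA averageMl //; congr (_ * _).
  rewrite -[RHS]/((j == j')%:R) -(inj_eq idxI).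
  exact: (coordinate_kum_th act1 actM ab_generate odd_n card_gT card_neq0 s0 r0 t0
    a_s b_s a_r b_r a_t b_t cw_prim cw_inv).
rewrite (eq_bigr _ (fun j' _ => E1 j')) (bigD1 j) //= eqxx mulr1 big1 ?addr0 //.
by move=> j' jj'; rewrite eq_sym (negbTE jj') mulr0.
Qed.

(** These variables are the coordinates of [gkap] and [gtau]. *)
Lemma recover_extra x : var (inr (inr x)) \in S.
Proof.
have [_ /kummerP Tk /kummerP Tt] := recover_coc.
have extra_inv y : invariant act (var (inr (inr y))) by move=> u; apply: act_extra.
case: x => [m|l].
  have <- : coord (m, Ordinal n_gt0) gkap = fv m; last exact: Tk.
  have -> : gkap = \sum_m' fv m' * th (m', Ordinal n_gt0).
    by apply: eq_bigr => m' _; rewrite /kum_th expr0 mulr1.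
  apply: (@coord_comb _ (fun m => fv m) (fun m => (m, Ordinal n_gt0))) => //.
  by move=> m1 m2 [].
have <- : coord (tindex l) gtau = ev l; last exact: Tt.
have -> : gtau = \sum_l' ev l' * th (tindex l').
  by apply: eq_bigr => l' _; rewrite /kum_th !expr0 !mul1r.
apply: (@coord_comb _ (fun l => ev l) tindex) => //.
by move=> l1 l2 [].
Qed.

End Recover.

(** * The family [base_gens], in the role of y, and the equality of the two fields *)

Definition jL : {rmorphism gcp_center F gT k -> E} := jK \o @gcp_scalar F gT k.

Let act_edge u i h g : act u (edge jK i h g) = edge jK i (u * h)%g (u * g)%g.
Proof. by rewrite /edge !jK_var act_ed. Qed.

Let act_jK_cst u c : act u (jK (gcp_const gT k c)) = jK (gcp_const gT k c).
Proof. by rewrite jK_cst act_cst. Qed.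

Let degree1 : pred E := degree1_pred jK act.

HB.instance Definition _ := GRing.isDivringClosed.Build E degree1
  (degree1_closed act1 actM act_edge act_jK_cst i0).

Let Delta : divringClosed E := GRing.DivringClosed.clone E degree1 _.

Let DeltaP f : reflect (homogeneous jK act 1%g f) (f \in Delta).
Proof. exact: asboolP. Qed.

Let Delta_act u f : f \in Delta -> act u f \in Delta.
Proof.
move=> /DeltaP Hf; apply/DeltaP.
exact: (homogeneous_act act1 actM act_edge act_jK_cst i0).
Qed.

Let Delta_cst c : cst c \in Delta.
Proof. by apply/DeltaP; rewrite -jK_cst; apply: homogeneous_const. Qed.

Let hom_ed i g : homogeneous jK act g (ed i 1%g g).
Proof. by rewrite -jK_var; apply: homogeneous_edge. Qed.

Let Delta_ed : ed i0 1%g 1%g \in Delta.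
Proof. exact/DeltaP/hom_ed. Qed.

(** Multiplying numerator and denominator by the edge from [g] back to 1 gives two elements of
    degree 1. *)
Let Delta_div g f f' : homogeneous jK act g f -> homogeneous jK act g f' ->
  f / f' \in Delta.
Proof.
move=> Hf Hf'; pose c := act g (ed i0 1%g g^-1%g).
have c0 : c != 0 by rewrite fmorph_eq0.
have hc h : homogeneous jK act g h -> h * c \in Delta.
  by move=> Hh; apply/DeltaP; rewrite -(mulgV g); apply: homogeneousM.
have -> : f / f' = (f * c) / (f' * c) by rewrite -mulf_div mulfV // mulr1.
by apply: rpred_div; apply: hc.
Qed.

Let hom_path x y : homogeneous jK act (a ^+ (x : bool) * b ^+ y)%g
  (path act b al be x y).
Proof.
apply: (path_graded mulgCT) => //.
- exact: homogeneous1.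
- by move=> g g' f f'; apply: homogeneousM.
Qed.

Let Delta_diag c : gdiag c \in Delta.
Proof.
apply: (@Delta_div c.2) => //.
by have := hom_path (ea c.2) (eb c.2); rewrite -ab_expE.
Qed.

Let Delta_coc : [/\ U \in Delta, A \in Delta & B \in Delta].
Proof.
split.
- apply: (@Delta_div (a * b)%g); first exact: homogeneousM.
  by rewrite mulgCT; apply: homogeneousM.
- by apply/DeltaP; have := homogeneousM actM (hom_ed i0 a) (hom_ed i0 a); rewrite aa.
- apply/DeltaP; have := hom_path false (2 * n).
  by rewrite /path /= mulr1 b_order mulg1 expg0.
Qed.

Let jL_fimage f : f \in Delta -> invariant act f -> f \in fimage jL.
Proof.
move=> /DeltaP Hf fI; apply/fimageP.
by have [c <-] := homogeneous_scalar Hf fI; exists c.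
Qed.

Let jL_cst c : jL (gcp_center_const gT k c) = cst c.
Proof. by rewrite /jL /= gcp_scalar_const jK_cst. Qed.

Let jL_inv c : invariant act (jL c).
Proof. exact: gcp_scalar_invariant. Qed.

Local Notation str m := (var (inr (inl m))).

Let str_order (m : 'I_3) := nth n [:: 2; 2]%N m.

Let act_str_order u m : exists c,
  act u (str m) = cst c * str m /\ c ^+ str_order m = 1.
Proof.
have N1 j : ((-1) ^+ j) ^+ 2 = 1 :> F by rewrite -exprM mulnC exprM sqrrN !expr1n.
rewrite (ab_expE u); case: m => -[|[|[|//]]] m3.
- exists ((-1) ^+ ea u); rewrite N1 (bool_irrelevance m3 isT).
  by rewrite rmorphXn rmorphN1 -(b_n_s _ (eb u)).
- exists ((-1) ^+ eb u); rewrite N1 (bool_irrelevance m3 isT).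
  by rewrite rmorphXn rmorphN1 -(b_n_r (ea u)).
- exists (w ^+ eb u); rewrite (bool_irrelevance m3 isT) rmorphXn -(b_n_t (ea u)).
  by rewrite -exprM mulnC exprM (prim_expr_order w_prim) expr1n.
Qed.

(** [cvar m * str m] is the projection of a loop variable to the character of [str m]: a
    semi-invariant of degree 1, with its [str_order m]-th power in the center. The quotient [cvar m]
    is invariant. *)
Definition cvar m : E := average (ed i0 1%g 1%g / str m).

Let cvar_inv m : invariant act (cvar m). Proof. exact: average_inv. Qed.

Let cvar_neq0 m : cvar m != 0.
Proof.
rewrite mulf_neq0 ?invr_neq0 //.
under eq_bigr do rewrite fmorph_div act_ed mulg1.
apply: (@scaling_sum_neq0 _ (fun u => inl (i0, (u, u))) _ 1%g).
- by move=> u v [].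
- by rewrite invr_neq0 // fmorph_eq0.
- move=> u; rewrite fmorphV; have [c [-> _]] := act_str_order u m.
  by rewrite rmorphM lam_cst lam_var_neq.
Qed.

Let cvar_str m (T : divringClosed E) : (forall c, cst c \in T) ->
  (forall u, act u (ed i0 1%g 1%g) \in T) -> cvar m * str m \in T.
Proof.
move=> Tc Te; rewrite /cvar /average -mulrA mulr_suml.
apply: rpredM; first by rewrite rpredV rpred_nat.
apply: rpred_sum => u _; rewrite fmorph_div.
have [c [-> _]] := act_str_order u m.
by rewrite invfM -mulrA divfK // rpred_div.
Qed.

Let Delta_cvar m : cvar m * str m \in Delta.
Proof. by apply: cvar_str => // u; apply: Delta_act. Qed.

Let cvar_str_order m : (cvar m * str m) ^+ str_order m \in fimage jL.
Proof.
apply: jL_fimage; first exact: rpredX.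
move=> u; rewrite rmorphXn rmorphM cvar_inv.
have [c [-> c1]] := act_str_order u m.
by rewrite mulrCA exprMn -rmorphXn c1 rmorph1 mul1r.
Qed.

Definition base_gens := [seq cvar m | m <- enum 'I_3] ++
  [seq var (inr (inr x)) | x <- enum {: 'I_2 * 'I_2 + 'I_n}].

Local Notation S1 := (adjoin (fimage jL) base_gens).
Local Notation S2 :=
  (adjoin (fimage (jL \o @gcp_center_const F gT k)) gens).

Let S1_cvar m : cvar m \in S1.
Proof. by apply: adjoin_mem; rewrite mem_cat map_f ?mem_enum. Qed.

Let S1_extra x : var (inr (inr x)) \in S1.
Proof.
by apply: adjoin_mem; rewrite mem_cat; apply/orP; right;
  apply/mapP; exists x; rewrite ?mem_enum.
Qed.

Let S1_jL c : jL c \in S1. Proof. exact/adjoin_base/fimage_id. Qed.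

Let S1_cst c : cst c \in S1. Proof. by rewrite -jL_cst. Qed.

Let S1_inv f : f \in S1 -> invariant act f.
Proof.
move=> Sf; apply/inv_fieldP; move: f Sf; apply: adjoin_min => f.
  by case/fimageP => c ->; apply/inv_fieldP.
rewrite mem_cat => /orP[] /mapP [x _ ->]; apply/inv_fieldP => u; first exact: cvar_inv.
exact: act_extra.
Qed.

Let S1_str m : str m ^+ str_order m \in S1.
Proof.
have -> : str m ^+ str_order m =
    (cvar m * str m) ^+ str_order m / cvar m ^+ str_order m.
  by rewrite exprMn mulrC mulKf // expf_neq0.
by apply: rpred_div; [apply/adjoin_base/cvar_str_order|apply/rpredX].
Qed.

Let S1_base : kummer_base act th chi S1.
Proof.
exact: (kum_base act1 actM ab_generate odd_n card_gT card_neq0 s0 r0 t0 a_s b_s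
  a_r b_r a_t b_t cw_prim cw_inv S1_inv (S1_cst w) (S1_str (@Ordinal 3 0 isT))
  (S1_str (@Ordinal 3 1 isT)) (S1_str (@Ordinal 3 2 isT))).
Qed.

Local Notation T1 := (kummer_field act1 actM card_neq0 th_neq0 th0 act_th
  chi_orthogonal card_I S1_base).

Let T1_S1 : {subset S1 <= T1}. Proof. exact: (base_kummer th0 S1_base). Qed.

(** Replacing s, r, t by their multiples in [Delta] turns a coordinate into an element of [S1] times
    an invariant of degree 1, that is, an element of the center. *)
Let T1_Delta f : f \in Delta -> f \in T1.
Proof.
move=> Df; apply/kummerP => -[[i j] l].
pose cs := cvar (@Ordinal 3 0 isT); pose cr := cvar (@Ordinal 3 1 isT).
pose ct := cvar (@Ordinal 3 2 isT).
pose c := cs ^+ i * cr ^+ j * ct ^+ l.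
pose d := (cs * s) ^+ i * (cr * r) ^+ j * (ct * t) ^+ l.
have -> : coord (i, j, l) f = c * average (f / d).
  rewrite -averageMl; last by move=> u; rewrite !rmorphM !rmorphXn !cvar_inv.
  congr average; rewrite /c /d /kum_th /=.
  have cs0 : cs != 0 := cvar_neq0 _; have cr0 : cr != 0 := cvar_neq0 _.
  have ct0 : ct != 0 := cvar_neq0 _.
  move: cs cr ct cs0 cr0 ct0 {c d} => cs cr ct cs0 cr0 ct0.
  move: s r t s0 r0 t0 => s' r' t' s0' r0' t0'.
  by rewrite !exprMn; field; do ![apply/andP; split]; apply: expf_neq0.
apply: (@rpredM _ S1).
  by apply: (@rpredM _ S1); [apply: (@rpredM _ S1)|];
    apply: (@rpredX _ S1); apply: S1_cvar.
apply/adjoin_base/jL_fimage; last exact: average_inv.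
apply: (@rpredM _ Delta); first by rewrite rpredV rpred_nat.
apply: (@rpred_sum _ Delta) => u _; apply/Delta_act/(@rpred_div _ Delta) => //.
by apply: (@rpredM _ Delta); [apply: (@rpredM _ Delta)|];
  apply: (@rpredX _ Delta); apply: Delta_cvar.
Qed.

Let S1_gens : {subset gens <= S1}.
Proof.
have T1_str m : str m \in T1.
  have -> : str m = cvar m * str m / cvar m by rewrite mulrC mulKf.
  by apply: (@rpred_div _ T1); [apply: T1_Delta|apply: T1_S1].
have T1_act u f : f \in T1 -> act u f \in T1.
  exact: (kummer_act act1 actM th_neq0 act_th).
have [DU DA DB] := Delta_coc.
move=> z zg; apply: (kummer_inv card_neq0 th0 (kS := S1_base)); last first.
  exact: gens_invariant.
apply: (gens_in (T := T1)) zg => //.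
- split; first by apply: rpred_sum => m _; apply: rpredM; [exact/T1_S1|];
    apply: rpredM; apply: rpredX.
  by apply: rpred_sum => l _; apply: rpredM; [exact/T1_S1|apply: rpredX].
- by split; apply: T1_Delta.
- by move=> c; apply: T1_Delta.
Qed.

Let S2_cst c : cst c \in S2.
Proof. by apply/adjoin_base/fimageP; exists c; exact/esym/jL_cst. Qed.

Let S2_gens : {subset gens <= S2}. Proof. exact: adjoin_mem. Qed.

Let S2_inv f : f \in S2 -> invariant act f.
Proof.
move=> Sf; apply/inv_fieldP; move: f Sf; apply: adjoin_min => f.
  by case/fimageP => c ->; apply/inv_fieldP => u; exact: jL_inv.
by move=> fg; apply/inv_fieldP; apply: gens_invariant.
Qed.

Local Notation T2 := (kummer_field act1 actM card_neq0 th_neq0 th0 act_th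
  chi_orthogonal card_I (gens_kummer_base S2_inv S2_cst S2_gens)).

Let T2_edge i h g : ed i h g * pot h / pot g \in T2.
Proof. exact: recover_edge. Qed.

Let T2_str m : str m \in T2.
Proof.
have [Ts Tr Tt] := recover_str S2_inv S2_cst S2_gens.
case: m => -[|[|[|//]]] m3; rewrite (bool_irrelevance m3 isT) //.
Qed.

Let T2_S2 : {subset S2 <= T2}.
Proof. exact: (recover_base S2_inv S2_cst S2_gens). Qed.

(** For the inclusion of [S1], its generators are found in the stable field [T2] and descend to [S2]
    because they are invariant; for the center, [pot] trivializes the grading. *)
Lemma adjoin_gens : S2 =i S1.
Proof.
move=> f; apply/idP/idP; move: f.
  apply: adjoin_min; last exact: S1_gens.
  by move=> _ /fimageP [c ->]; exact: S1_jL.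
apply: adjoin_min => f.
  case/fimageP => c ->; apply: (recover_inv (S_inv := S2_inv)
    (S_cst := S2_cst) (S_gens := S2_gens)); last exact: jL_inv.
  apply: (gcp_scalar_in (p := pot)) => // [d|i h g].
    by rewrite jK_cst; apply: T2_S2.
  by rewrite /edge jK_var; apply: T2_edge.
rewrite mem_cat => /orP[] /mapP [x _ ->]; last first.
  exact: (recover_extra S2_inv S2_cst S2_gens).
apply: (recover_inv (S_inv := S2_inv) (S_cst := S2_cst) (S_gens := S2_gens));
  last exact: cvar_inv.
apply: (@rpredM _ T2); first by rewrite rpredV rpred_nat.
apply: (@rpred_sum _ T2) => u _.
have T2_act := @recover_act _ S2_inv S2_cst S2_gens u.
apply: T2_act; apply: (@rpred_div _ T2); last exact: T2_str.
by have := T2_edge i0 1%g 1%g; rewrite mulfK.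
Qed.

(** * Algebraic independence of the two families *)

Let charE : [pchar E] =i pred0.
Proof. by apply/pcharf0P => m; apply: natE. Qed.

(** Independence holds already over [gcp_field], over which these elements generate the equally many
    remaining variables of [E]. *)
Lemma base_gens_independent :
  algebraically_independent jL (fun i : 'I_(size base_gens) => base_gens`_i).
Proof.
apply: algebraically_independent_comp.
pose x := [seq var (inr v) | v <- enum {: 'I_3 + ('I_2 * 'I_2 + 'I_n)}].
apply: (independent_generators_mpoly (x := x) (z' := [::])).
- apply: independent_scaling => // i ix.
  pose v0 : 'I_3 + ('I_2 * 'I_2 + 'I_n) := inl ord0.
  move: ix; rewrite /x; have := enum_uniq {: 'I_3 + ('I_2 * 'I_2 + 'I_n)}.
  move: (enum _) => e ue; rewrite size_map => ie.
  rewrite (nth_map v0) //; split=> //; exists (lam (inr (nth v0 e i))); split.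
  + by move=> _ /fimageP [c ->]; apply: lam_jK.
  + move=> j ji; have je := ltn_trans ji ie.
    rewrite (nth_map v0 _ _ je) lam_var_neq //.
    by apply: contraTneq ji => -[/eqP]; rewrite nth_uniq // => /eqP->; rewrite ltnn.
  + exact: lam_var.
- rewrite cats0 size_cat 3!size_map -!cardE !card_sum !card_prod !card_ord.
  by rewrite addnC.
- move=> _ /mapP [v _ ->]; apply: algebraic_base; rewrite cats0.
  case: v => [m|y]; last first.
    by apply: adjoin_mem; rewrite mem_cat; apply/orP; right;
      apply/mapP; exists y; rewrite ?mem_enum.
  have -> : str m = cvar m * str m / cvar m by rewrite mulrC mulKf.
  apply: rpred_div; last by apply: adjoin_mem; rewrite mem_cat map_f ?mem_enum.
  apply: adjoin_base; apply: cvar_str => [c|u].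
    by apply/fimageP; exists (gcp_const gT k c); rewrite jK_cst.
  by rewrite act_ed; apply/fimageP; exists (gcp_var F i0 (u * 1)%g (u * 1)%g);
    rewrite jK_var.
Qed.

Let diag_index_card : #|diag_index| = (k * (4 * n) - 2)%N.
Proof.
have -> : diag_index = ~: [set (i0, a); (i0, b)].
  by apply/setP => c; rewrite !inE.
rewrite cardsCs setCK cards2 card_prod card_ord card_gT.
suff -> : (i0, a) != (i0, b) by [].
rewrite xpair_eqE eqxx /=; apply/eqP => eab; have := ab_neq1 1.
by rewrite expg1 -eab aa eqxx.
Qed.

Lemma gens_independent :
  algebraically_independent (jL \o @gcp_center_const F gT k)
    (fun i : 'I_(size gens) => gens`_i).
Proof.
pose x := [seq var v | v <- enum gvars].
pose z' := [seq pot g | g <- enum [set~ (1%g : gT)]].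
apply: (independent_generators_mpoly (x := x) (z' := z')).
- apply: independent_scaling => // i ix.
  pose v0 : gvars := inr (inl ord0).
  move: ix; rewrite /x; have := enum_uniq gvars.
  move: (enum _) => e ue; rewrite size_map => ie.
  rewrite (nth_map v0) //; split=> //; exists (lam (nth v0 e i)); split.
  + move=> _ /fimageP [c ->].
    exact: etrans (congr1 _ (jL_cst c)) (etrans (lam_cst _ c) (esym (jL_cst c))).
  + move=> j ji; have je := ltn_trans ji ie.
    by rewrite (nth_map v0 _ _ je) lam_var_neq // nth_uniq // ltn_eqF.
  + exact: lam_var.
- have -> : size x = #|{: gvars}| by rewrite /x size_map -cardE.
  have zE : size z' = (4 * n).-1 by rewrite /z' size_map -cardE cardsC1 card_gT.
  have XE : size X_gens = (4 * n)%N by rewrite /X_gens size_map -cardE card_I card_gT.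
  have sE : size sigma_gens = n by rewrite /sigma_gens size_map -cardE card_ord.
  have dE : size diag_gens = ((k * (4 * n) - 2) * (4 * n))%N.
    by rewrite /diag_gens size_allpairs -!cardE diag_index_card card_I card_gT.
  rewrite !size_cat XE sE dE zE !card_sum !card_prod !card_ord card_gT /=.
  by apply: generators_count n_gt0; apply: leq_trans (ltn_ord i0).
- move=> _ /mapP [v _ ->].
  (* [T] contains s, r, t as roots of elements of the field, hence all of [T2]; an edge is an
     element of [T2] times [pot g / pot h]. *)
  pose T := algebraic_closure
    (adjoin (fimage (jL \o @gcp_center_const F gT k)) (gens ++ z')).
  have TS2 f : f \in S2 -> f \in T.
    move=> Sf; apply/asboolP/algebraic_base; move: f Sf; apply: adjoin_min => f.
      exact: adjoin_base.
    by move=> fg; apply: adjoin_mem; rewrite mem_cat fg.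
  have root_in f m : (0 < m)%N -> f ^+ m \in T -> f \in T.
    move=> m0 /asboolP Tf; apply/asboolP; apply: (algebraic_trans (T := T)).
      by move=> c /asboolP.
    exists ('X^m - (f ^+ m)%:P); split.
    + by rewrite -size_poly_eq0 size_XnsubC.
    + by rewrite rpredB ?polyOverXn // polyOverC; apply/asboolP.
    + by rewrite rootE !hornerE subrr.
  have Tstr m : str m \in T.
    apply: (root_in _ (str_order m)); last first.
      by apply: TS2; rewrite adjoin_gens.
    by case: m => -[|[|[|//]]] ?; rewrite /str_order //= n_gt0.
  have TT2 f : f \in T2 -> f \in T.
    move=> /kummerP Tf; rewrite (expansion f); apply: rpred_sum => i _.
    apply: rpredM; first exact/TS2/Tf.
    by apply: rpredM; [apply: rpredM|]; apply: rpredX.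
  have Tpot g : pot g \in T.
    have [->|g1] := eqVneq g 1%g.
      suff -> : pot 1%g = 1 by exact: (rpred1 T).
      rewrite /pot; have [-> e1] : ea 1%g = false /\ (eb 1%g = 0 %[mod 2 * n])%N.
        by apply: ab_inj; rewrite -ab_expE expg0 mulg1.
      have -> : eb 1%g = 0%N by move: e1; rewrite mod0n modn_small.
      by rewrite /path big_ord0 mulr1.
    apply/asboolP/algebraic_base/adjoin_mem; rewrite mem_cat; apply/orP; right.
    by apply/mapP; exists g; rewrite ?mem_enum ?in_setC1.
  suff : var v \in T by move/asboolP.
  case: v => [[i [h g]]|[m|y]] //.
    have -> : ed i h g = ed i h g * pot h / pot g * pot g / pot h.
      by rewrite divfK // mulfK.
    by apply: rpred_div => //; apply: rpredM => //; apply: TT2.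
  by apply: TS2; rewrite adjoin_gens.
Qed.

Lemma stably_rational_of_choices :
  stably_rational (@gcp_center_const F gT k).
Proof.
exact: (stably_rational_criterion base_gens_independent gens_independent
  adjoin_gens).
Qed.

End Choices.

Lemma stably_rational_center : stably_rational (@gcp_center_const F gT k).
Proof.
have nz f : f != 0 -> exists i, coord i f != 0.
  exact: (coordinate_neq0 act1 card_neq0 th_neq0 act_th chi_orthogonal card_I).
have [iA cA] := nz A (cocA_neq0 _ _ al0).
have [iB cB] := nz B (cocB_neq0 _ _ _ be0).
have [[ij l] cS] := nz _ gsigma0_neq0.
(* [gsigma0] is fixed by [a] and [beta], so its nonzero coordinates lie along powers of t. *)
have ij0 : ij = (ord0, ord0).
  apply/eqP; apply: contraTT cS => ij0; rewrite negbK.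
  have [sa sb] := gsigma0_fixed.
  apply/eqP; exact: (kum_coordinate0 act1 actM odd_n card_gT card_neq0 a_s b_s
    a_r b_r a_t b_t cw_prim cw_inv sa sb (k := (ij, l)) ij0).
rewrite ij0 in cS.
exact: (stably_rational_of_choices cA cB cS).
Qed.

End Assembly.

(** * The regular action on the variables *)

Section RegularAction.

Variables (F : fieldType) (gT : finGroupType) (n k : nat).
Variable psi : 'I_3 -> gT -> F.
Hypothesis psi1 : forall m, psi m 1%g = 1.
Hypothesis psiM : forall m u v, psi m (u * v)%g = psi m u * psi m v.

Local Notation vars := (gvars gT n k).
Local Notation E := (ratfun F vars).
Local Notation cst := (ratfun_const F vars).
Local Notation var := (@ratfun_var F vars).

Definition gweight (u : gT) (v : vars) : F :=
  if v is inr (inl m) then psi m u else 1.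

Definition gshift (u : gT) (v : vars) : vars :=
  match v with
  | inl (i, (h, g)) => inl (i, (u * h, u * g)%g)
  | inr x => inr x
  end.

Lemma gweight_neq0 u v : gweight u v != 0.
Proof.
case: v => [|[m|]] /= *; rewrite ?oner_eq0 //.
apply/eqP => m0; have := oner_neq0 F.
by rewrite -(psi1 m) -(mulgV u) psiM m0 mul0r eqxx.
Qed.

Lemma gshift_inj u : injective (gshift u).
Proof.
apply: (can_inj (g := gshift u^-1%g)) => -[[i [h g]]|//] /=.
by rewrite !mulKg.
Qed.

Definition gact u : {rmorphism E -> E} :=
  mono_morph (gweight_neq0 u) (@gshift_inj u).

Lemma gact_cst u c : gact u (cst c) = cst c.
Proof. exact: mono_morph_const. Qed.

Lemma gact_var u v : gact u (var v) = cst (gweight u v) * var (gshift u v).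
Proof. exact: mono_morph_var. Qed.

Lemma gact1 f : gact 1%g f = f.
Proof.
apply: (ratfun_ext (f := gact 1%g) (g := idfun)) => [c|v]; first exact: gact_cst.
rewrite gact_var; have -> : gweight 1%g v = 1 by case: v => [|[]].
rewrite rmorph1 mul1r; congr var.
by case: v => [[i [h g]]|//] /=; rewrite !mul1g.
Qed.

Lemma gactM u v f : gact (u * v)%g f = gact u (gact v f).
Proof.
apply: (ratfun_ext (f := gact (u * v)%g) (g := gact u \o gact v)) => [c|x] /=.
  by rewrite !gact_cst.
rewrite !gact_var rmorphM /= gact_cst gact_var mulrA -rmorphM /=.
have -> : gweight u (gshift v x) = gweight u x by case: x => [[? []]|].
have -> : gweight (u * v)%g x = gweight v x * gweight u x.
  by case: x => [|[]] //= *; rewrite ?mulr1 // psiM mulrC.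
by congr (_ * var _); case: x => [[i [h g]]|//] /=; rewrite !mulgA.
Qed.

Lemma gcp_embedding_exists : {j : {rmorphism gcp_field F gT k -> E} |
  (forall c, j (gcp_const gT k c) = cst c) /\
  (forall i h g, j (gcp_var F i h g) = var (inl (i, (h, g))))}.
Proof.
have inl_inj : injective (inl : 'I_k * (gT * gT) -> vars) by move=> x y [].
exists (mono_morph (c := fun=> 1) (fun=> oner_neq0 F) inl_inj).
split=> [c|i h g]; first exact: mono_morph_const.
by rewrite [LHS]mono_morph_var rmorph1 mul1r.
Qed.

Hypothesis charF : [pchar F] =i pred0.
Hypothesis mulgCT : forall u v : gT, (u * v = v * u)%g.
Variables (a b : gT) (ea : gT -> bool) (eb : gT -> nat).
Hypothesis odd_n : odd n.
Hypothesis aa : (a * a = 1)%g.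
Hypothesis b_exp_eq1 : forall j, ((b ^+ j)%g == 1%g) = (2 * n %| j)%N.
Hypothesis ab_neq1 : forall j, (a * b ^+ j != 1)%g.
Hypothesis ab_expE : forall u, u = (a ^+ ea u * b ^+ eb u)%g.
Hypothesis eb_lt : forall u, (eb u < 2 * n)%N.
Hypothesis card_gT : #|gT| = (4 * n)%N.
Variable w : F.
Hypothesis w_prim : n.-primitive_root w.
Hypothesis k_gt0 : (0 < k)%N.
Hypothesis psi_a : forall m : 'I_3, psi m a = nth 1 [:: -1; 1; 1] m.
Hypothesis psi_b : forall m : 'I_3, psi m b = nth 1 [:: 1; -1; w] m.

Lemma stably_rational_of_characters :
  stably_rational (@gcp_center_const F gT k).
Proof.
have [jK [jK_cst jK_var]] := gcp_embedding_exists.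
have two_neq0 : 2%:R != 0 :> F by move/pcharf0P: charF => ->.
have natE m : (m%:R == 0 :> E) = (m == 0)%N.
  have -> : m%:R = cst m%:R :> E by rewrite rmorph_nat.
  by rewrite fmorph_eq0; move/pcharf0P: charF => ->.
apply: (@stably_rational_center F E cst gT gact gact1 gactM gact_cst mulgCT
  a b n ea eb odd_n aa b_exp_eq1 ab_neq1 ab_expE eb_lt card_gT natE k
  (Ordinal k_gt0) var (@ratfun_var_neq0 F vars) (fun v => scaling v two_neq0)
  _ _ _ _ _ w w_prim _ _ _ _ _ _ jK jK_cst jK_var).
- by move=> v c; apply: scaling_const.
- by move=> v; apply: scaling_var.
- by move=> v u; apply: scaling_var_neq.
- by move=> u i h g; rewrite gact_var rmorph1 mul1r.
- by move=> u x; rewrite gact_var rmorph1 mul1r.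
- by rewrite gact_var [gweight _ _]psi_a rmorphN1 mulN1r.
- by rewrite gact_var [gweight _ _]psi_b rmorph1 mul1r.
- by rewrite gact_var [gweight _ _]psi_a rmorph1 mul1r.
- by rewrite gact_var [gweight _ _]psi_b rmorphN1 mulN1r.
- by rewrite gact_var [gweight _ _]psi_a rmorph1 mul1r.
- by rewrite gact_var [gweight _ _]psi_b.
(* Reading [gcp_field] as a [ratfun] reduces the claim to constants and variables. *)
move=> x; apply: (ratfun_ext (V := ('I_k * (gT * gT))%type)
    (f := scaling (inr x : vars) two_neq0 \o jK) (g := jK)) => [c|[i [h g]]].
  by rewrite [LHS]/= jK_cst scaling_const.
by rewrite [LHS]/= jK_var scaling_var_neq.
Qed.

End RegularAction.

(** * The group C_2 x C_2n in coordinates *)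

Section GroupC2C2n.

Variables (n : nat) (hn : odd n).

Local Notation gT := ('Z_2 * 'Z_(2 * n))%type.

Definition gena : gT := (1, 0).
Definition genb : gT := (0, 1).

Lemma gt1_2n : (1 < 2 * n)%N. Proof. by case: n hn => // m _; lia. Qed.

(** The type ['Z_m] has [(Zp_trunc m).+2] elements, which is [m] only when [m > 1]. *)
Lemma Zp_2n : (Zp_trunc (2 * n)).+2 = (2 * n)%N.
Proof. by rewrite Zp_cast // gt1_2n. Qed.

Lemma expg_fst (u : gT) j : (u ^+ j)%g.1 = u.1 *+ j.
Proof. by elim: j => // j IHj; rewrite expgS mulrS -IHj. Qed.

Lemma expg_snd (u : gT) j : (u ^+ j)%g.2 = u.2 *+ j.
Proof. by elim: j => // j IHj; rewrite expgS mulrS -IHj. Qed.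

Lemma mulg_C2C2n (u v : gT) : (u * v = v * u)%g.
Proof. by apply: injective_projections; apply: addrC. Qed.

Lemma gena2 : (gena * gena = 1)%g.
Proof. by apply: injective_projections; apply: val_inj. Qed.

Lemma genb_expE j : (genb ^+ j)%g = (0, j%:R).
Proof.
by apply: injective_projections; rewrite ?expg_fst ?expg_snd //= mul0rn.
Qed.

Lemma genb_exp_eq1 j : ((genb ^+ j)%g == 1%g) = (2 * n %| j)%N.
Proof.
rewrite genb_expE; apply/eqP/idP => [[/(congr1 val)]|/dvdnP [l ->]].
  by rewrite /= val_Zp_nat ?gt1_2n // => /eqP.
by rewrite natrM pchar_Zp ?gt1_2n // mulr0.
Qed.

Lemma gen_expE (u : gT) : u = (gena ^+ u.1 * genb ^+ u.2)%g.
Proof.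
have fstM (x y : gT) : (x * y)%g.1 = x.1 + y.1 by [].
have sndM (x y : gT) : (x * y)%g.2 = x.2 + y.2 by [].
rewrite genb_expE; apply: injective_projections.
  by rewrite fstM expg_fst addr0 natr_Zp.
by rewrite sndM expg_snd mul0rn add0r natr_Zp.
Qed.

Lemma gena_genb_neq1 j : (gena * genb ^+ j != 1)%g.
Proof. by rewrite genb_expE; apply/eqP => -[]. Qed.

Lemma card_C2C2n : #|{: gT}| = (4 * n)%N.
Proof. by rewrite card_prod !card_ord Zp_2n mulnA. Qed.

Lemma snd_lt (u : gT) : (u.2 < 2 * n)%N.
Proof. by rewrite -[X in (_ < X)%N]Zp_2n. Qed.

End GroupC2C2n.


Theorem corollary1p4 (n : nat) (hn : odd n) (F : fieldType)
    (charF : [pchar F] =i pred0) (w : F) (hw : n.-primitive_root w)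
    (k : nat) (hk : (0 < k)%N) :
  stably_rational (@gcp_center_const F ('Z_2 * 'Z_(2 * n))%type k).
Proof.
(* The characters of s, r and t. They are multiplicative because the bases -1 and [w] have order
   dividing the modulus of the coordinate in the exponent. *)
pose psi (m : 'I_3) (u : 'Z_2 * 'Z_(2 * n)) : F :=
  nth 1 [:: (-1) ^+ u.1; (-1) ^+ u.2; w ^+ u.2] m.
have N12 : (-1) ^+ 2 = 1 :> F by rewrite sqrrN expr1n.
have psi1 m : psi m 1%g = 1 by case: m => -[|[|[|//]]].
have psiM m u v : psi m (u * v)%g = psi m u * psi m v.
  have prim2n (z : F) : z ^+ (2 * n) = 1 ->
      z ^+ (u * v)%g.2 = z ^+ u.2 * z ^+ v.2.
    by rewrite -{1}(Zp_2n hn) => z2; rewrite -exprD -[in RHS](expr_mod _ z2).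
  case: m => -[|[|[|//]]] ? /=.
  - by rewrite -exprD -[in RHS](expr_mod _ N12).
  - by apply: prim2n; rewrite exprM N12 expr1n.
  - by apply: prim2n; rewrite mulnC exprM (prim_expr_order hw) expr1n.
(* The exponent of the first generator has to be a boolean, so the coordinate in ['Z_2] becomes a
   test. *)
have gen_expE' (u : 'Z_2 * 'Z_(2 * n)) :
    u = (gena n ^+ (u.1 != 0) * genb n ^+ u.2)%g.
  rewrite {1}(gen_expE u); congr (_ ^+ _ * _)%g.
  by case: u => -[[|[|//]] ? u2].
apply: (stably_rational_of_characters psi1 psiM charF (@mulg_C2C2n n) hn
  (@gena2 n) (genb_exp_eq1 hn) (@gena_genb_neq1 n) gen_expE' (snd_lt hn)
  (card_C2C2n hn) hw hk) => m; first by case: m => -[|[|[|//]]].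
have b1 : nat_of_ord (genb n).2 = 1%N.
  by rewrite /= modn_small // Zp_2n // gt1_2n.
by rewrite /psi b1 !expr1.
Qed.
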